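(* Let $(\overline M,\mathbf p)$ be a connected projective manifold with boundary $\partial M$ and oriented interior $M$, of dimension $n\ge2$, and let $\zeta^{ab}$ be a solution of the metrisability equation with degeneracy locus $\partial M$ and such that $H^{AB}=L(\zeta^{ab})$ is non-degenerate on $\overline M$. Suppose that $H^{AB}$ is a normal solution to the metrisability equation and set, as operators on weighted tractor forms (sections of $(\Lambda^k\mathcal T^* )(\omega)$, all $k$ and $\omega$), $$x=\sigma,\qquad \tilde y=\frac1f\left(\mathscr D\mathscr D^*+\mathscr D^*\mathscr D\right),\qquad h=\boldsymbol\omega+\frac{n+1}{2},$$ where $x$ is multiplication by $\sigma$ and $\boldsymbol\omega$ is the weight operator ($\boldsymbol\omega F=\omega F$ for $F$ of weight $\omega$), and $\sigma,f,\mathscr D,\mathscr D^*$ are as defined in the context. Then $(x,\tilde y,h)$ is an $\mathfrak{sl}_2$-triple, i.e. $$[x,\tilde y]=h,\qquad[h,x]=2x,\qquad[h,\tilde y]=-2\tilde y.$$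
   Context: Abstract index notation. A projective structure $\mathbf p$ is a class of torsion-free affine connections related by $\hat\nabla=\nabla+\Upsilon$: $\hat\nabla_a\xi^b=\nabla_a\xi^b+\Upsilon_c\xi^c\delta_a^b+\Upsilon_a\xi^b$. $\mathcal E(\omega)$ is the real line bundle associated to the frame bundle via $A\mapsto|\det A|^{\omega/(n+1)}$; $\mathcal B(\omega)=\mathcal B\otimes\mathcal E(\omega)$. Curvature: $2\nabla_{[a}\nabla_{b]}X^c=R_{ab}{}^c{}_dX^d$, $R_{ab}=R_{ca}{}^c{}_b$, $\beta_{ab}=-\frac{2}{n+1}R_{[ab]}$, $(n-1)P_{ab}=R_{ab}+\beta_{ab}$. Tractor bundle $\mathcal T$ (rank $n+1$): each $\nabla\in\mathbf p$ gives $\mathcal T\cong TM(-1)\oplus\mathcal E(-1)$, $T^A\overset{\nabla}{=}\nu^aW^A_a+\rho X^A$; under $\hat\nabla=\nabla+\Upsilon$, $\hat\nu^a=\nu^a$, $\hat\rho=\rho-\Upsilon_b\nu^b$. Dual splitting $Y_A,Z_A^a$: $X^AY_A=1$, $Z_A^aW^A_b=\delta^a_b$, $Z^a_AX^A=0$, $W^A_aY_A=0$. The tractor connection coupled with $\nabla$: $\nabla_aY_A=P_{ab}Z_A^b$, $\nabla_aZ_A^b=-\delta_a^bY_A$, $\nabla_aX^A=W^A_a$, $\nabla_aW^A_c=-P_{ac}X^A$. Thomas operator on weight $\omega$: $D_AF\overset{\nabla}{=}\omega Y_AF+Z^a_A\nabla_aF$ (independent of $\nabla\in\mathbf p$, weight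 $\omega-1$). For $F\in\Gamma((\Lambda^k\mathcal T^* )(\omega))$ define $(\mathscr DF)_{A_1\dots A_{k+1}}=(k+1)D_{[A_1}F_{A_2\cdots A_{k+1}]}$. Metrisability equation for $\zeta^{ab}\in\Gamma(S^2TM(-2))$: $\nabla_c\zeta^{ab}-\frac{2}{n+1}\nabla_d\zeta^{d(a}\delta^{b)}_c=0$. Associated tractor: $H^{AB}=L(\zeta^{ab})\overset{\nabla}{=}\zeta^{ab}W^A_aW^B_b-\frac{2}{n+1}\nabla_a\zeta^{ab}X^{(A}W^{B)}_b+\Big(\frac{P_{ab}\zeta^{ab}}{n}+\frac{\nabla_a\nabla_b\zeta^{ab}}{n(n+1)}\Big)X^AX^B$. The solution is called normal if $H^{AB}$ is parallel for the tractor connection. On $M$, $\zeta^{ab}$ defines a (pseudo-)metric on $T^*M(1)$, with positive volume form $\omega_\zeta\in\Gamma((\Lambda^nT^*M)(n))$; $\sigma=|\omega_\zeta|^{-2}\in\Gamma(\mathcal E(2))$, $I_A=D_A\sigma$, $I^2=H^{AB}I_AI_B$, $f=\sigma^{-1}I^2$ (a nowhere vanishing function). $\nabla_g\in\mathbf p$ is the Levi-Civita connection of the metric with inverse $g^{ab}=\sigma\zeta^{ab}$ on $M$. Let $s$ be the sign of the determinant of $\zeta^{ab}$ on $M$ and $\varepsilon=\mathrm{sgn}(f)$. Tractor Hodge star on $M$: with $J^0_B=\frac{\sigma^{-1/2}}{\sqrt{|f|}}I_B$ and $J^i_B=Z^b_B\omega^i_b$ (splitting of $\nabla_g$) for a positive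 $\zeta$-orthonormal frame $(\omega^i)$ of $T^*M(1)$, the tractor volume form is $\Omega_{\mathcal T}=J^0\wedge\cdots\wedge J^n$, and $F\wedge\star G=\frac1{k!}H^{A_1B_1}\cdots H^{A_kB_k}F_{A_1\dots A_k}G_{B_1\dots B_k}\,\Omega_{\mathcal T}$ (extended to weighted tractor forms). Tractor codifferential on $k$-cotractor forms: $\mathscr D^*=(-1)^{(n+1)(k-1)+1}s\varepsilon\star\mathscr D\star$. The operator $\mathscr D^*$ is defined on $M$; identities are understood on $M$ and extend to $\overline M$ by density. *)

(* Defs.v *)
From HB Require Import structures.
From mathcomp Require Import all_boot all_order all_fingroup all_algebra.
From mathcomp Require Import all_classical all_reals all_analysis.

Set Implicit Arguments.
Unset Strict Implicit.
Unset Printing Implicit Defensive.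

Import Order.TTheory GRing.Theory Num.Theory.
Import numFieldNormedType.Exports.

Local Open Scope classical_set_scope.
Local Open Scope ring_scope.

(* Fields on a manifold are given by their components in the charts of an
   atlas, subject to the transformation laws of the relevant bundles.  A
   component in the chart c is a function of the point p; its values for p
   outside dom c are irrelevant.                                             *)

Section Manifolds.
Variables (R : realType) (n : nat) (T : topologicalType).

Definition halfspace : set 'rV[R]_n :=
  [set x | forall i : 'I_n, i = 0%N :> nat -> 0 <= x ord0 i].

Record chart := Chart {
  dom : set T;
  crd : T -> 'rV[R]_n;
  pt : 'rV[R]_n -> T }.

Definition is_chart (c : chart) : Prop :=
  [/\ open (dom c),
      (forall p, dom c p -> pt c (crd c p) = p),
      {within dom c, continuous (crd c)},
      {within crd c @` dom c, continuous (pt c)} &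
      exists2 O : set 'rV[R]_n, open O & crd c @` dom c = O `&` halfspace].

(* Partial derivatives are taken within the half-space, hence are one-sided
   in the normal direction at points of the boundary. *)
Definition pd_filter (c : chart) (i : 'I_n) (p : T) : set_system R :=
  within [set t : R | halfspace (crd c p + t *: delta_mx ord0 i)] (0 : R)^'.

Definition pd_quotient (c : chart) (i : 'I_n) (f : T -> R) (p : T) (t : R) : R :=
  t^-1 * (f (pt c (crd c p + t *: delta_mx ord0 i)) - f p).

Definition pd_exists (c : chart) (i : 'I_n) (f : T -> R) (p : T) : Prop :=
  cvg (pd_quotient c i f p @ pd_filter c i p).

Definition pd (c : chart) (i : 'I_n) (f : T -> R) (p : T) : R :=
  lim (pd_quotient c i f p @ pd_filter c i p).

Fixpoint is_Ck (k : nat) (c : chart) (U : set T) (f : T -> R) : Prop :=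
  (forall p, U p -> {for p, continuous f}) /\
  (if k is k'.+1 then
     forall i, (forall p, U p -> pd_exists c i f p) /\ is_Ck k' c U (pd c i f)
   else True).

Definition smooth_on (c : chart) (U : set T) (f : T -> R) : Prop :=
  forall k, is_Ck k c (U `&` dom c) f.

(* The atlas need not be maximal. *)
Definition smooth_manifold (atl : set chart) : Prop :=
  [/\ hausdorff_space T,
      @second_countable T,
      (forall c, atl c -> is_chart c),
      (forall p, exists2 c, atl c & dom c p) &
      (forall c c' j, atl c -> atl c' ->
         smooth_on c (dom c') (fun p => crd c' p ord0 j))].

(* Points in the domain of some chart sending them off the hyperplane x_0 = 0. *)
Definition mfd_interior (atl : set chart) : set T :=
  [set p | exists c, [/\ atl c, dom c p &
     forall i : 'I_n, i = 0%N :> nat -> 0 < crd c p ord0 i]].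

Definition mfd_boundary (atl : set chart) : set T := ~` mfd_interior atl.

(* jac c c' p a b = d x_c^a / d x_c'^b *)
Definition jac (c c' : chart) (p : T) : 'M[R]_n :=
  \matrix_(a, b) pd c' b (fun q => crd c q ord0 a) p.

(* A section s of E(w) satisfies s_c = density_factor w c c' * s_c'. *)
Definition density_factor (w : R) (c c' : chart) (p : T) : R :=
  `| \det (jac c c' p) | `^ (w / n.+1%:R).

(* o c p = 1 if the coordinate frame of c at p is positive, -1 otherwise. *)
Definition orientation (atl : set chart) (U : set T) (o : chart -> T -> R) : Prop :=
  forall c, atl c -> forall p, (U `&` dom c) p ->
    [/\ o c p = 1 \/ o c p = -1,
        {for p, continuous (o c)} &
        forall c', atl c' -> dom c' p ->
          o c' p = Num.sg (\det (jac c c' p)) * o c p].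

(* G c p a d b is the Christoffel symbol Gamma_{ad}^b in the chart c:
   nabla_a xi^b = d_a xi^b + Gamma_{ad}^b xi^d. *)
Definition connection := chart -> T -> 'I_n -> 'I_n -> 'I_n -> R.

Definition torsion_free_connection (atl : set chart) (G : connection) : Prop :=
  [/\ forall c, atl c -> forall a d b, smooth_on c setT (fun p => G c p a d b),
      forall c, atl c -> forall p, dom c p ->
        forall a d b, G c p a d b = G c p d a b &
      forall c c', atl c -> atl c' -> forall p, dom c p -> dom c' p ->
        forall a d b,
          \sum_e jac c c' p b e * G c' p a d e =
          pd c' a (fun q => jac c c' q b d) p +
          \sum_e \sum_h jac c c' p e a * jac c c' p h d * G c p e h b].

Definition one_form (atl : set chart) (U : chart -> T -> 'I_n -> R) : Prop :=
  (forall c, atl c -> forall a, smooth_on c setT (fun p => U c p a)) /\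
  (forall c c', atl c -> atl c' -> forall p, dom c p -> dom c' p ->
     forall a, U c' p a = \sum_b jac c c' p b a * U c p b).

(* G' = G + U in the notation for projective changes *)
Definition projective_change (atl : set chart) (G G' : connection)
    (U : chart -> T -> 'I_n -> R) : Prop :=
  one_form atl U /\
  forall c, atl c -> forall p, dom c p -> forall a d b,
    G' c p a d b = G c p a d b + U c p d * (a == b)%:R + U c p a * (d == b)%:R.

Definition projective_structure (atl : set chart) (pr : set connection) : Prop :=
  exists2 G0, torsion_free_connection atl G0 &
    pr = [set G | torsion_free_connection atl G /\
                  exists U, projective_change atl G0 G U].

(* riem G c p a b e d = R_{ab}^e_d *)
Definition riem (G : connection) (c : chart) (p : T) (a b e d : 'I_n) : R :=
  pd c a (fun q => G c q b d e) p - pd c b (fun q => G c q a d e) p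
  + \sum_h (G c p a h e * G c p b d h - G c p b h e * G c p a d h).

Definition ric (G : connection) (c : chart) (p : T) (a b : 'I_n) : R :=
  \sum_e riem G c p e a e b.

Definition beta (G : connection) (c : chart) (p : T) (a b : 'I_n) : R :=
  - (2 / n.+1%:R) * ((ric G c p a b - ric G c p b a) / 2).

Definition schouten (G : connection) (c : chart) (p : T) (a b : 'I_n) : R :=
  (ric G c p a b + beta G c p a b) / n.-1%:R.

(* Gamma_{ae}^e: on weight w, nabla_a s = d_a s + w / (n+1) Gamma_{ae}^e s. *)
Definition ctrace (G : connection) (c : chart) (p : T) (a : 'I_n) : R :=
  \sum_e G c p a e e.

Definition bivector_field := chart -> T -> 'M[R]_n.

(* sections of S^2 TM(-2) *)
Definition sym_bivector_weight_m2 (atl : set chart) (zeta : bivector_field) : Prop :=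
  [/\ forall c, atl c -> forall a b, smooth_on c setT (fun p => zeta c p a b),
      forall c, atl c -> forall p, dom c p -> (zeta c p)^T = zeta c p &
      forall c c', atl c -> atl c' -> forall p, dom c p -> dom c' p ->
        zeta c p = density_factor (- 2) c c' p *:
                   (jac c c' p *m zeta c' p *m (jac c c' p)^T)].

(* nabla_e zeta^{ab} *)
Definition nabla_zeta (zeta : bivector_field) (G : connection) (c : chart) (p : T)
    (e a b : 'I_n) : R :=
  pd c e (fun q => zeta c q a b) p
  + \sum_d G c p e d a * zeta c p d b
  + \sum_d G c p e d b * zeta c p a d
  - 2 / n.+1%:R * ctrace G c p e * zeta c p a b.

(* nabla_b zeta^{ab} *)
Definition div_zeta (zeta : bivector_field) (G : connection) (c : chart) (p : T)
    (a : 'I_n) : R :=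
  \sum_b nabla_zeta zeta G c p b a b.

(* nabla_a nabla_b zeta^{ab} *)
Definition divdiv_zeta (zeta : bivector_field) (G : connection) (c : chart) (p : T) : R :=
  \sum_a (pd c a (fun q => div_zeta zeta G c q a) p
          + \sum_d G c p a d a * div_zeta zeta G c p d
          - 2 / n.+1%:R * ctrace G c p a * div_zeta zeta G c p a).

Definition metrisability_eq (atl : set chart) (pr : set connection)
    (zeta : bivector_field) : Prop :=
  forall G, pr G -> forall c, atl c -> forall p, dom c p -> forall e a b,
    nabla_zeta zeta G c p e a b
    - 2 / n.+1%:R * ((div_zeta zeta G c p a * (b == e)%:R
                      + div_zeta zeta G c p b * (a == e)%:R) / 2) = 0.

Definition degeneracy_locus (atl : set chart) (zeta : bivector_field) : set T :=
  [set p | exists c, [/\ atl c, dom c p & zeta c p \notin unitmx]].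

(* A connection G in the class and a chart c give the local frame
   (X^A, W^A_1, ..., W^A_n) of the tractor bundle and the dual frame
   (Y_A, Z_A^1, ..., Z_A^n), trivialised by the coordinate scale: the index 0
   stands for X or Y, and lift ord0 a for W_a or Z^a. *)

(* the components of H = L(zeta) *)
Definition metric_tractor (zeta : bivector_field) (G : connection) (c : chart) (p : T) :
    'M[R]_n.+1 :=
  let h0 : 'rV[R]_n := \row_a (- (2 / n.+1%:R) * div_zeta zeta G c p a / 2) in
  let h00 : R := (\sum_a \sum_b schouten G c p a b * zeta c p a b) / n%:R
                 + divdiv_zeta zeta G c p / (n%:R * n.+1%:R) in
  @block_mx R 1 n 1 n (h00%:M) h0 h0^T (zeta c p).

(* The matrix A_a of the tractor connection in the local frame (e_B):
   nabla_a e_D = sum_B (A_a)_{BD} e_B.  The terms in ctrace come from the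
   weights: T = TM(-1) + E(-1), so that nabla_a X^A = W^A_a and
   nabla_a W^A_b = - P_{ab} X^A for the connection coupled with G. *)
Definition tractor_conn (G : connection) (c : chart) (p : T) (a : 'I_n) : 'M[R]_n.+1 :=
  let u : R := ctrace G c p a / n.+1%:R in
  @block_mx R 1 n 1 n (- u)%:M (\row_b (- schouten G c p a b))
    (delta_mx a ord0) (\matrix_(b, d) (G c p a d b - u * (b == d)%:R)).

Definition tractor_nondegenerate (atl : set chart) (pr : set connection)
    (zeta : bivector_field) : Prop :=
  forall G, pr G -> forall c, atl c -> forall p, dom c p ->
    metric_tractor zeta G c p \in unitmx.

Definition normal_solution (atl : set chart) (pr : set connection)
    (zeta : bivector_field) : Prop :=
  forall G, pr G -> forall c, atl c -> forall p, dom c p -> forall a : 'I_n,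
    let H := metric_tractor zeta G c in
    \matrix_(B, C) pd c a (fun q => H q B C) p
    + tractor_conn G c p a *m H p + H p *m (tractor_conn G c p a)^T = 0.

End Manifolds.

Section Forms.
Variables (R : realType) (n : nat).

(* F A is the component F_{A_1 ... A_k} for A = [:: A_1; ...; A_k]. *)
Definition cotensor := seq 'I_n.+1 -> R.

(* F_{[A_1 ... A_k]}, extended by 0 to the lists of length other than k *)
Definition antisym (k : nat) (F : cotensor) : cotensor := fun A =>
  if size A == k then
    (k`!%:R)^-1 * \sum_(s : 'S_k)
      (-1) ^+ s * F [seq nth ord0 A (s i) | i <- enum 'I_k]
  else 0.

Definition is_form (k : nat) (F : cotensor) : Prop := antisym k F = F.

Definition wedge (k l : nat) (F K : cotensor) : cotensor := fun A =>
  ((k + l)`!%:R / (k`!%:R * l`!%:R))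
  * antisym (k + l) (fun B => F (take k B) * K (drop k B)) A.

Definition one_cotensor (v : 'rV[R]_n.+1) : cotensor := fun A =>
  if A is [:: B] then v ord0 B else 0.

(* v_1 /\ ... /\ v_m *)
Fixpoint wedge_list (vs : seq 'rV[R]_n.+1) : cotensor :=
  if vs is v :: vs' then wedge 1 (size vs') (one_cotensor v) (wedge_list vs')
  else fun A => (A == [::])%:R.

Definition form_inner (H : 'M[R]_n.+1) (k : nat) (F G : cotensor) : R :=
  (k`!%:R)^-1 * \sum_(A : k.-tuple 'I_n.+1) \sum_(B : k.-tuple 'I_n.+1)
    (\prod_(i < k) H (tnth A i) (tnth B i)) * F A * G B.

(* The form K of degree n+1-k such that F /\ K = <F, G> Omega for all k-forms F.
   It is 0 by default if k > n+1, in which case k-forms vanish. *)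
Definition is_star (H : 'M[R]_n.+1) (Omega : cotensor) (k : nat) (G K : cotensor) : Prop :=
  exists l, [/\ (k + l = n.+1)%N, is_form l K &
    forall F, is_form k F ->
      forall A, wedge k l F K A = form_inner H k F G * Omega A].

Definition star (H : 'M[R]_n.+1) (Omega : cotensor) (k : nat) (G : cotensor) : cotensor :=
  xget (fun _ => 0) [set K | is_star H Omega k G K].

(* (S^* F)_{A_1 ... A_k} = S_{B_1 A_1} ... S_{B_k A_k} F_{B_1 ... B_k} *)
Definition pullback (S : 'M[R]_n.+1) (F : cotensor) : cotensor := fun A =>
  \sum_(B : (size A).-tuple 'I_n.+1)
    (\prod_(i < size A) S (tnth B i) (nth ord0 A i)) * F B.

End Forms.

Section Operators.
Variables (R : realType) (n : nat) (T : topologicalType).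
Variables (atl : set (chart R n T)) (pr : set (connection R n T)).
Variables (o : chart R n T -> T -> R) (zeta : bivector_field R n T).

Notation chart := (chart R n T).
Notation connection := (connection R n T).
Notation cotensor := (cotensor R n).

Definition tractor_field := connection -> chart -> T -> cotensor.

(* frame change T_c = S T_c' for a fixed connection, with T = TM(-1) + E(-1) *)
Definition chart_change (c c' : chart) (p : T) : 'M[R]_n.+1 :=
  density_factor (- 1) c c' p *: @block_mx R 1 n 1 n 1%:M 0 0 (jac c c' p).

(* T_G = S T_G' for G' = G + U, i.e. nu = nu' and rho = rho' + U_b nu'^b *)
Definition splitting_change (U : 'I_n -> R) : 'M[R]_n.+1 :=
  @block_mx R 1 n 1 n 1%:M (\row_b U b) 0 1%:M.

(* smooth sections over the interior of (Lambda^k T^* )(w) *)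
Definition tractor_form (k : nat) (w : R) (F : tractor_field) : Prop :=
  let M := mfd_interior atl in
  [/\ forall G, pr G -> forall c, atl c -> forall p, (M `&` dom c) p ->
        is_form k (F G c p),
      forall G, pr G -> forall c, atl c -> forall A,
        smooth_on c M (fun p => F G c p A),
      forall G, pr G -> forall c c', atl c -> atl c' ->
        forall p, M p -> dom c p -> dom c' p -> forall A,
          F G c' p A =
          density_factor (- w) c c' p * pullback (chart_change c c' p) (F G c p) A &
      forall G G' U, pr G -> pr G' -> projective_change atl G G' U ->
        forall c, atl c -> forall p, (M `&` dom c) p -> forall A,
          F G' c p A = pullback (splitting_change (U c p)) (F G c p) A].

(* nabla_a F for a cotractor field F of weight w: tractor connection coupled with G *)
Definition nabla_cotractor (w : R) (G : connection) (c : chart) (F : T -> cotensor)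
    (p : T) (a : 'I_n) (B : seq 'I_n.+1) : R :=
  pd c a (fun q => F q B) p
  + w / n.+1%:R * ctrace G c p a * F p B
  - \sum_(i < size B) \sum_(C < n.+1)
      tractor_conn G c p a C (nth ord0 B i) * F p (set_nth ord0 B i C).

(* D_A F = w Y_A F + Z_A^a nabla_a F *)
Definition thomas (w : R) (G : connection) (c : chart) (F : T -> cotensor)
    (p : T) (A : 'I_n.+1) (B : seq 'I_n.+1) : R :=
  if unlift ord0 A is Some a then nabla_cotractor w G c F p a B else w * F p B.

Definition ext_D (k : nat) (w : R) (F : tractor_field) : tractor_field :=
  fun G c p A => k.+1%:R *
    antisym k.+1 (fun B => if B is b :: B' then thomas w G c (F G c) p b B' else 0) A.

(* the component omega_{1 ... n} of the positive volume form of zeta on T^*M(1) *)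
Definition volume_zeta (c : chart) (p : T) : R :=
  o c p * (Num.sqrt `|\det (zeta c p)|)^-1.

Definition sigma (c : chart) (p : T) : R := `|volume_zeta c p| ^- 2.

(* I_A = D_A sigma *)
Definition scale_tractor (G : connection) (c : chart) (p : T) : 'rV[R]_n.+1 :=
  \row_A thomas 2 G c (fun q B => if B is [::] then sigma c q else 0) p A [::].

Definition scale_norm2 (G : connection) (c : chart) (p : T) : R :=
  let I := scale_tractor G c p in
  \sum_A \sum_B metric_tractor zeta G c p A B * I ord0 A * I ord0 B.

Definition f_fun (G : connection) (c : chart) (p : T) : R :=
  (sigma c p)^-1 * scale_norm2 G c p.

(* The rows of w form a positive zeta-orthonormal coframe in T^*M(1) at p. *)
Definition pos_orthonormal (c : chart) (p : T) (w : 'M[R]_n) : Prop :=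
  (exists2 e : 'rV[R]_n, (forall i, e ord0 i = 1 \/ e ord0 i = -1) &
     w *m zeta c p *m w^T = diag_mx e)
  /\ 0 < o c p * \det w.

Definition J0 (G : connection) (c : chart) (p : T) : 'rV[R]_n.+1 :=
  ((Num.sqrt (sigma c p))^-1 / Num.sqrt `|f_fun G c p|) *: scale_tractor G c p.

(* Z_A^b omega_b.  Since nu^b = Z_A^b T^A does not change with the splitting,
   Z_A^b is the same for all connections of the class (in particular for the
   Levi-Civita connection of sigma * zeta), and so are these components. *)
Definition Jform (v : 'rV[R]_n) : 'rV[R]_n.+1 := @row_mx R 1 1 n 0 v.

(* Omega_T = J^0 /\ ... /\ J^n, which does not depend on the choice of the coframe *)
Definition tractor_volume (G : connection) (c : chart) (p : T) : cotensor :=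
  xget (fun _ => 0) [set Om : cotensor | exists2 w, pos_orthonormal c p w &
    Om = wedge_list (J0 G c p :: [seq Jform (row i w) | i <- enum 'I_n])].

Definition tractor_star (k : nat) (F : tractor_field) : tractor_field :=
  fun G c p => star (metric_tractor zeta G c p) (tractor_volume G c p) k (F G c p).

(* The signs s and epsilon are constant on the interior M, which is connected.
   The truncated subtractions are harmless: for k = 0 and for k > n + 1 the
   result is 0. *)
Definition codiff (k : nat) (w : R) (F : tractor_field) : tractor_field :=
  fun G c p A =>
    (-1) ^+ (n.+1 * (k - 1)).+1 * Num.sg (\det (zeta c p)) * Num.sg (f_fun G c p)
    * tractor_star (n.+1 - k).+1 (ext_D (n.+1 - k) w (tractor_star k F)) G c p A.

(* Degree-preserving operators homogeneous in the weight: op_act P k w maps the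
   sections of (Lambda^k T^* )(w) to those of (Lambda^k T^* )(w + op_shift P). *)
Record weighted_op := WeightedOp {
  op_shift : R;
  op_act : nat -> R -> tractor_field -> tractor_field }.

Definition op_comm (P Q : weighted_op) : weighted_op :=
  WeightedOp (op_shift P + op_shift Q) (fun k w F G c p A =>
    op_act P k (w + op_shift Q) (op_act Q k w F) G c p A
    - op_act Q k (w + op_shift P) (op_act P k w F) G c p A).

Definition op_scale (a : R) (P : weighted_op) : weighted_op :=
  WeightedOp (op_shift P) (fun k w F G c p A => a * op_act P k w F G c p A).

Definition op_eq (P Q : weighted_op) : Prop :=
  op_shift P = op_shift Q /\
  forall (k : nat) (w : R) (F : tractor_field), tractor_form k w F ->
    forall G, pr G -> forall c, atl c ->
      forall p, (mfd_interior atl `&` dom c) p -> forall A,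
        op_act P k w F G c p A = op_act Q k w F G c p A.

Definition x_op : weighted_op :=
  WeightedOp 2 (fun k w F G c p A => sigma c p * F G c p A).

Definition y_op : weighted_op :=
  WeightedOp (- 2) (fun k w F G c p A =>
    (f_fun G c p)^-1 * (ext_D (k - 1) (w - 1) (codiff k w F) G c p A
                        + codiff k.+1 (w - 1) (ext_D k w F) G c p A)).

Definition h_op : weighted_op :=
  WeightedOp 0 (fun k w F G c p A => (w + n.+1%:R / 2) * F G c p A).

Definition sl2_triple (x y h : weighted_op) : Prop :=
  [/\ op_eq (op_comm x y) h,
      op_eq (op_comm h x) (op_scale 2 x) &
      op_eq (op_comm h y) (op_scale (- 2) y)].

End Operators.

(* Main.v *)
(* Everything happens in the tractor frame of a fixed connection and chart.  With
   H parallel, det H and s = sgn (det zeta) are locally constant, and Jacobi's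
   formula for the derivative of sigma = s det zeta together with Cramer's rule
   give, for I = D sigma,
     H^{AB} I_B = (f/2) X^A   and   f = 4 s det H,
   so f is locally constant; the tractor volume form is likewise a locally
   constant multiple of the Levi-Civita symbol.

   The Thomas operator obeys the Leibniz rule and D_A X^B = delta_A^B, which
   yields the Cartan formula  D i_X + i_X D = w + k  on k-forms of weight w.
   Multiplication by sigma changes D by  I /\ _  and, since the star exchanges
   I /\ _  and  (f/2) i_X  up to sign, it changes D^* by  - (f/2) i_X.  Hence
   [D D^* + D^* D, sigma] is the sum of  - (f/2) (D i_X + i_X D)  and of
   D^* (I /\ _) + I /\ D^*; the latter is the conjugate by the star of the same
   Cartan operator on (n+1-k)-forms.  The total is
     - (f/2) ((w + k) + (w + n + 1 - k)) = - f (w + (n + 1) / 2). *)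
Require Import Defs.
From mathcomp Require Import all_boot all_order all_fingroup all_algebra.
From mathcomp Require Import all_classical all_reals all_analysis.
From mathcomp Require Import ring zify.

Set Implicit Arguments.
Unset Strict Implicit.
Unset Printing Implicit Defensive.

Import Order.TTheory GRing.Theory Num.Theory.
Import numFieldNormedType.Exports.

Local Open Scope classical_set_scope.
Local Open Scope ring_scope.

(** That H is parallel enters only through the first derivatives of det H and det zeta: D is never
    commuted past the star. Beyond the Leibniz rule one needs only the algebra of the star and the
    vanishing derivative of f/2, which lets this factor pass through D. Both [star] and
    [tractor_volume] are chosen by [xget] with default 0, so existence and uniqueness must be
    settled before either can be computed. For the volume form, existence amounts to an oriented
    orthonormal coframe in arbitrary signature. The signs in D^* are matched to the star: s epsilon
    = sgn(det H) cancels the same sign coming from the double star, and the power of -1 combines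
    with the powers from the wedge exchange and the double star to -1 in every degree. Degrees are
    natural numbers with truncated subtraction, so degree 0, top degree and degrees above n+1 need
    their own arguments. *)

Local Notation chart_dom := Defs.dom.

(** * Alternating forms as functions of lists of indices *)

Section Prm.
Variable n : nat.
Implicit Types A B C : seq 'I_n.+1.

(** This is the list at which [antisym] evaluates its argument. By [prm_prm] the symmetric group
    acts on lists, so sign rules follow by reindexing sums over permutations. *)
Definition prm k (s : 'S_k) A : seq 'I_n.+1 :=
  [seq nth ord0 A (s i) | i <- enum 'I_k].

Lemma size_prm k (s : 'S_k) A : size (prm s A) = k.
Proof. by rewrite size_map size_enum_ord. Qed.

Lemma nth_prm k (s : 'S_k) A (i : 'I_k) : nth ord0 (prm s A) i = nth ord0 A (s i).
Proof. by rewrite (nth_map i) ?size_enum_ord // nth_ord_enum. Qed.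

Lemma eq_nth_ord k A B : size A = k -> size B = k ->
  (forall i : 'I_k, nth ord0 A i = nth ord0 B i) -> A = B.
Proof.
move=> sA sB h; apply: (@eq_from_nth _ ord0) => [|i]; first by rewrite sA sB.
by rewrite sA => ik; apply: (h (Ordinal ik)).
Qed.

Lemma prm_prm k (s t : 'S_k) A : prm t (prm s A) = prm (t * s)%g A.
Proof.
apply: (@eq_nth_ord k); rewrite ?size_prm // => i.
by rewrite !nth_prm permM.
Qed.

Lemma prm1 k A : size A = k -> prm (1%g : 'S_k) A = A.
Proof.
by move=> sA; apply: (@eq_nth_ord k); rewrite ?size_prm // => i; rewrite nth_prm perm1.
Qed.

Lemma perm_eq_prm A B : perm_eq A B -> exists s : 'S_(size A), B = prm s A.
Proof.
rewrite perm_sym => /(@tuple_permP _ _ _ (in_tuple A))[s ->]; exists s.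
apply: (@eq_nth_ord (size A)); rewrite ?size_tuple ?card_ord ?size_prm // => i.
by rewrite nth_prm /= (nth_map i) ?size_enum_ord // nth_ord_enum (tnth_nth ord0).
Qed.

End Prm.

Section FormBasics.
Variables (R : realType) (n : nat).
Implicit Types (F K : cotensor R n) (A B : seq 'I_n.+1).

Lemma antisymE k F A : size A = k ->
  antisym k F A = (k`!%:R)^-1 * \sum_(s : 'S_k) (-1) ^+ s * F (prm s A).
Proof. by rewrite /antisym => /eqP ->. Qed.

Lemma antisym_size k F A : size A != k -> antisym k F A = 0.
Proof. by rewrite /antisym => /negbTE ->. Qed.

Lemma factR_neq0 k : (k`!%:R : R) != 0.
Proof. by rewrite pnatr_eq0 -lt0n fact_gt0. Qed.

Lemma eq_antisym k F K : (forall A, size A = k -> F A = K A) -> antisym k F =1 antisym k K.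
Proof.
move=> h A; have [sA|sA] := eqVneq (size A) k; last by rewrite !antisym_size.
by rewrite !antisymE //; congr (_ * _); apply: eq_bigr => s _; rewrite h ?size_prm.
Qed.

Lemma antisym_prm k F A (s : 'S_k) : size A = k ->
  antisym k F (prm s A) = (-1) ^+ s * antisym k F A.
Proof.
move=> sA; rewrite !antisymE ?size_prm // mulrCA; congr (_ * _).
rewrite (reindex_inj (mulIg s^-1%g)) /= mulr_sumr; apply: eq_bigr => t _.
rewrite prm_prm mulgKV mulrA; congr (_ * _).
by rewrite odd_permM odd_permV signr_addb mulrC.
Qed.

(** For an alternating [F] the k! terms of the antisymmetrisation all equal [F A], which converts
    the fixed-point definition of a form into a sign rule. *)
Lemma is_formP k F : is_form k F <->
  (forall A, size A != k -> F A = 0) /\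
  (forall A (s : 'S_k), size A = k -> F (prm s A) = (-1) ^+ s * F A).
Proof.
split=> [<-|[h0 hs]].
  by split=> [A|A s]; [exact: antisym_size|exact: antisym_prm].
apply/funext => A; have [sA|sA] := eqVneq (size A) k; last by rewrite antisym_size ?h0.
rewrite antisymE // (eq_bigr (fun=> F A)) => [|s _].
  by rewrite sumr_const card_Sn -[F A *+ _]mulr_natl mulKf ?factR_neq0.
by rewrite hs // mulrA -signr_addb addbb mul1r.
Qed.

Lemma form_size k F A : is_form k F -> size A != k -> F A = 0.
Proof. by case/is_formP => h _ /h. Qed.

Lemma form_prm k F A (s : 'S_k) : is_form k F -> size A = k ->
  F (prm s A) = (-1) ^+ s * F A.
Proof. by case/is_formP => _; apply. Qed.

Lemma form_antisym k F A : is_form k F -> antisym k F A = F A.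
Proof. by move=> ->. Qed.

Lemma antisym_form k F : is_form k (antisym k F).
Proof.
apply/is_formP; split=> [A|A s]; [exact: antisym_size|exact: antisym_prm].
Qed.

Lemma form0 k : is_form k ((fun=> 0) : cotensor R n).
Proof. by apply/is_formP; split=> // A s _; rewrite mulr0. Qed.

Lemma form_scale k (a : R) F : is_form k F -> is_form k (fun A => a * F A).
Proof.
move=> hF; apply/is_formP; split=> [A sA|A s sA]; first by rewrite (form_size hF) ?mulr0.
by rewrite (form_prm _ hF) // mulrCA.
Qed.

Lemma form_sum k (I : finType) (F : I -> cotensor R n) :
  (forall i, is_form k (F i)) -> is_form k (fun A => \sum_i F i A).
Proof.
move=> hF; apply/is_formP; split=> [A sA|A s sA].
  by rewrite big1 // => i _; rewrite (form_size (hF i)).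
by rewrite mulr_sumr; apply: eq_bigr => i _; rewrite (form_prm _ (hF i)).
Qed.

Lemma antisym_scale k (a : R) F A : antisym k (fun B => a * F B) A = a * antisym k F A.
Proof.
have [sA|sA] := eqVneq (size A) k; last by rewrite !antisym_size ?mulr0.
rewrite !antisymE // [RHS]mulrCA; congr (_ * _); rewrite mulr_sumr.
by apply: eq_bigr => s _; rewrite mulrCA.
Qed.

Lemma antisym_add k F K A : antisym k (fun B => F B + K B) A = antisym k F A + antisym k K A.
Proof.
have [sA|sA] := eqVneq (size A) k; last by rewrite !antisym_size ?addr0.
rewrite !antisymE // -mulrDr -big_split; congr (_ * _).
by apply: eq_bigr => s _; rewrite mulrDr.
Qed.

Lemma tperm_split k (P Q S : seq 'I_n.+1) a b (i j : 'I_k) :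
  size (P ++ a :: Q ++ b :: S) = k ->
  i = size P :> nat -> j = (size P + (size Q).+1)%N :> nat ->
  prm (tperm i j) (P ++ a :: Q ++ b :: S) = P ++ b :: Q ++ a :: S.
Proof.
move=> hk hi hj; apply: (@eq_nth_ord _ k); rewrite ?size_prm //.
  by rewrite -hk !size_cat /= !size_cat /=.
have na T x y : nth ord0 (P ++ x :: Q ++ y :: T) (size P) = x.
  by rewrite nth_cat ltnn subnn.
have nb T x y : nth ord0 (P ++ x :: Q ++ y :: T) (size P + (size Q).+1)%N = y.
  by rewrite nth_cat ltnNge leq_addr /= addKn /= nth_cat ltnn subnn.
move=> m; rewrite nth_prm; case: tpermP => [->|->|ni nj].
- by rewrite hj hi na nb.
- by rewrite hj hi na nb.
rewrite !nth_cat; case: ltnP => // hm.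
have {}ni : (m - size P != 0)%N.
  by apply: contra_notN ni => /eqP h; apply: val_inj => /=; rewrite hi; lia.
case E : (m - size P)%N ni => [//|m'] _ /=; rewrite !nth_cat; case: ltnP => // hm'.
have : (m' - size Q != 0)%N.
  by apply: contra_notN nj => /eqP h; apply: val_inj => /=; rewrite hj; lia.
by case: (m' - size Q)%N.
Qed.

Lemma form_swap k F P Q S a b : is_form k F ->
  F (P ++ a :: Q ++ b :: S) = - F (P ++ b :: Q ++ a :: S).
Proof.
move=> hF; have [e|e] := eqVneq (size (P ++ a :: Q ++ b :: S)) k; last first.
  rewrite !(form_size hF) ?oppr0 //; apply: contraNneq e => <-.
  by rewrite !size_cat /= !size_cat.
have li : (size P < k)%N by rewrite -e !size_cat /= !size_cat; lia.
have lj : (size P + (size Q).+1 < k)%N by rewrite -e !size_cat /= !size_cat /=; lia.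
rewrite -(@tperm_split k P Q S a b (Ordinal li) (Ordinal lj)) //.
rewrite (form_prm _ hF) // odd_tperm -val_eqE /=.
by have -> : (size P != size P + (size Q).+1)%N by [lia]; rewrite expr1 mulN1r opprK.
Qed.

(** Transpositions generate the symmetric group. The criterion is phrased with concatenations
    because fixing a prefix or a suffix of the indices then visibly preserves it, as in [form_catl]
    and [form_catr]. *)
Lemma is_form_swap k F : (forall A, size A != k -> F A = 0) ->
  (forall P Q S a b, F (P ++ a :: Q ++ b :: S) = - F (P ++ b :: Q ++ a :: S)) ->
  is_form k F.
Proof.
move=> h0 hs; apply/is_formP; split=> // A s sA.
have hlt A' (i j : 'I_k) : size A' = k -> (i < j)%N ->
    F (prm (tperm i j) A') = - F A'.
  move=> sA' ij.
  pose P := take i A'; pose Q := take (j - i).-1 (drop i.+1 A').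
  pose S := drop j.+1 A'; pose x := nth ord0 A' i; pose y := nth ord0 A' j.
  have jk := ltn_ord j.
  have sP : size P = i by rewrite size_take sA'; case: ltnP => //; lia.
  have sQ : (size Q).+1 = (j - i)%N.
    by rewrite size_take size_drop sA'; case: ltnP => //; lia.
  have eA : A' = P ++ x :: Q ++ y :: S.
    rewrite -{1}(cat_take_drop i A') (drop_nth ord0); last first.
      by rewrite sA' (ltn_trans ij).
    congr (_ ++ _ :: _); rewrite -{1}(cat_take_drop (j - i).-1 (drop i.+1 A')).
    congr (_ ++ _); rewrite drop_drop (_ : _ + _ = j)%N; last by lia.
    by rewrite (drop_nth ord0) ?sA'.
  have := @tperm_split k P Q S x y i j; rewrite -eA => -> //; last by lia.
  by rewrite [in RHS]eA hs.
have {}hlt A' (i j : 'I_k) : size A' = k -> i != j ->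
    F (prm (tperm i j) A') = - F A'.
  move=> sA'; rewrite neq_ltn => /orP[|ij]; first exact: hlt.
  by rewrite tpermC hlt.
have [ts -> hts] := prod_tpermP s.
elim: ts hts => [|[i j] ts IH] /=.
  by rewrite big_nil prm1 // odd_perm1 mul1r.
case/andP => ij /IH {}IH; rewrite big_cons /= -prm_prm hlt ?size_prm // IH.
by rewrite odd_permM odd_tperm ij signr_addb expr1 mulN1r mulNr.
Qed.

Lemma form_move k F P Q S a : is_form k F ->
  F (P ++ a :: Q ++ S) = (-1) ^+ size Q * F (P ++ Q ++ a :: S).
Proof.
move=> hF; elim: Q P => [|b Q IH] P; first by rewrite expr0 mul1r.
have /= -> := form_swap P [::] (Q ++ S) a b hF; rewrite -cat_rcons IH cat_rcons exprS.
by rewrite mulN1r mulNr.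
Qed.

(** Each entry of [P] passes all of [Q]. This is the source of the sign in the double star. *)
Lemma form_rot k F P Q S : is_form k F ->
  F (P ++ Q ++ S) = (-1) ^+ (size P * size Q) * F (Q ++ P ++ S).
Proof.
move=> hF; elim: P S => [|a P IH] S; first by rewrite expr0 mul1r.
rewrite -[(a :: P) ++ _]/([::] ++ a :: (P ++ (Q ++ S))) catA.
rewrite (form_move _ _ _ _ hF) /= -catA IH (form_move _ _ _ _ hF).
by rewrite mulSn size_cat !exprD; ring.
Qed.

(** Swapping two equal entries fixes the list but changes the sign, so twice the component is 0. *)
Lemma form_dup k F A : is_form k F -> ~~ uniq A -> F A = 0.
Proof.
move=> hF; have [sA|sA] := eqVneq (size A) k; last by rewrite (form_size hF).
case/(uniqPn ord0) => i [j [ij js eij]]; rewrite sA in js.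
pose i' := Ordinal (ltn_trans ij js); pose j' := Ordinal js.
have nij : i' != j' by rewrite -val_eqE /= ltn_eqF.
have : F (prm (tperm i' j') A) = - F A.
  by rewrite (form_prm _ hF) // odd_tperm nij expr1 mulN1r.
rewrite (_ : prm _ _ = A).
  by move/eqP; rewrite -addr_eq0 -mulr2n -mulr_natl mulf_eq0 pnatr_eq0 => /eqP.
apply: (@eq_nth_ord _ k); rewrite ?size_prm // => m.
by rewrite nth_prm; case: tpermP => [->|->|] //=; rewrite eij.
Qed.

Lemma form_gt k F A : is_form k F -> (n.+1 < k)%N -> F A = 0.
Proof.
move=> hF nk; have [sA|sA] := eqVneq (size A) k; last by rewrite (form_size hF).
apply: (form_dup hF); apply: contraL nk => /card_uniqP; rewrite sA -leqNgt => <-.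
by rewrite -[X in (_ <= X)%N]card_ord max_card.
Qed.

Lemma form_catl k F B : is_form (k + size B) F -> is_form k (fun A => F (A ++ B)).
Proof.
move=> hF; apply: is_form_swap => [A sA|P Q S a b].
  by rewrite (form_size hF) // size_cat eqn_add2r.
by rewrite -!catA /= -!catA (form_swap _ _ _ _ _ hF).
Qed.

Lemma form_catr k F A : is_form (size A + k) F -> is_form k (fun B => F (A ++ B)).
Proof.
move=> hF; apply: is_form_swap => [B sB|P Q S a b].
  by rewrite (form_size hF) // size_cat eqn_add2l.
by rewrite !catA (form_swap _ _ _ _ _ hF).
Qed.

End FormBasics.

(** * Sums over index tuples of fixed length *)

Section TupleSums.
Variables (R : realType) (n : nat).
Implicit Types (F K : cotensor R n) (A B : seq 'I_n.+1).

Definition tsum k (F : cotensor R n) : R := \sum_(A : k.-tuple 'I_n.+1) F A.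

Lemma eq_tsum k F K : (forall A, size A = k -> F A = K A) -> tsum k F = tsum k K.
Proof. by move=> h; apply: eq_bigr => A _; rewrite h ?size_tuple. Qed.

Lemma tsum0 F : tsum 0 F = F [::].
Proof.
rewrite /tsum (bigD1 [tuple]) //= big1 ?addr0 // => A.
by case/eqP; rewrite [A]tuple0; apply: val_inj.
Qed.

Lemma tsumS k F : tsum k.+1 F = \sum_a tsum k (fun A => F (a :: A)).
Proof.
rewrite /tsum pair_big /= (reindex (fun p : 'I_n.+1 * k.-tuple 'I_n.+1 =>
  cons_tuple p.1 p.2)) //=.
exists (fun t => (thead t, behead_tuple t)) => [[a t] _|t _] /=.
  by congr (_, _); apply: val_inj.
by rewrite [RHS]tuple_eta; apply: val_inj.
Qed.

Lemma tsum_cat k l F : tsum (k + l) F = tsum k (fun A => tsum l (fun B => F (A ++ B))).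
Proof.
elim: k F => [|k IH] F; first by rewrite tsum0.
by rewrite addSn !tsumS; apply: eq_bigr => a _; rewrite IH.
Qed.

Lemma tsum_exchange k l (F : seq 'I_n.+1 -> seq 'I_n.+1 -> R) :
  tsum k (fun A => tsum l (fun B => F A B)) = tsum l (fun B => tsum k (fun A => F A B)).
Proof. exact: exchange_big. Qed.

Lemma tsum_mull k (a : R) F : tsum k (fun A => a * F A) = a * tsum k F.
Proof. by rewrite /tsum mulr_sumr. Qed.

Lemma tsum_mulr k (a : R) F : tsum k (fun A => F A * a) = tsum k F * a.
Proof. by rewrite /tsum mulr_suml. Qed.

Lemma tsum_add k F K : tsum k (fun A => F A + K A) = tsum k F + tsum k K.
Proof. exact: big_split. Qed.

Lemma tsum_sum k (I : finType) (F : I -> cotensor R n) :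
  tsum k (fun A => \sum_i F i A) = \sum_i tsum k (F i).
Proof. exact: exchange_big. Qed.

Lemma tsum_prm k (s : 'S_k) F : tsum k (fun A => F (prm s A)) = tsum k F.
Proof.
pose f (s : 'S_k) (A : k.-tuple 'I_n.+1) : k.-tuple 'I_n.+1 :=
  Tuple (introT eqP (size_prm s A)).
rewrite /tsum [RHS](reindex (f s)) //; exists (f s^-1%g) => A _.
  by apply: val_inj; rewrite /= prm_prm mulVg prm1 ?size_tuple.
by apply: val_inj; rewrite /= prm_prm mulgV prm1 ?size_tuple.
Qed.

(** The tuples that survive are the k! rearrangements of [C], all with the same value. *)
Lemma tsum_support k C F : size C = k -> uniq C ->
  (forall A, perm_eq C A -> F A = F C) ->
  (forall A, size A = k -> ~~ (all (mem C) A && uniq A) -> F A = 0) ->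
  tsum k F = k`!%:R * F C.
Proof.
move=> sC uC hperm h0; rewrite /tsum (bigID (fun A : k.-tuple _ => all (mem C) A && uniq A)) /=.
rewrite [X in _ + X]big1 => [|A]; last by apply: h0; rewrite size_tuple.
rewrite addr0 (eq_bigr (fun=> F C)) => [|A /andP[/allP sAC uA]]; last first.
  apply: hperm; rewrite perm_sym; apply: uniq_perm => //.
  by case: (uniq_min_size uA sAC) => //; rewrite size_tuple sC.
rewrite sumr_const -[F C *+ _]mulr_natl; congr (_%:R * _).
have := card_uniq_tuples k (mem C); rewrite (card_uniqP uC) sC ffactnn => <-.
by apply: eq_card => A; rewrite !inE.
Qed.

(** Antisymmetrisation is self-adjoint for the summation pairing, and an alternating [E] is fixed by
    it. *)
Lemma tsum_antisym k F E :
  (forall A (s : 'S_k), size A = k -> E (prm s A) = (-1) ^+ s * E A) ->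
  tsum k (fun A => antisym k F A * E A) = tsum k (fun A => F A * E A).
Proof.
move=> hE.
rewrite (@eq_tsum _ _ (fun A => (k`!%:R)^-1 * \sum_(s : 'S_k) F (prm s A) * E (prm s A))).
  rewrite tsum_mull tsum_sum (eq_bigr (fun=> tsum k (fun A => F A * E A))) => [|s _].
    by rewrite sumr_const card_Sn -[X in _ * X = _]mulr_natl mulKf ?factR_neq0.
  exact: (tsum_prm s (fun A => F A * E A)).
move=> A sA; rewrite antisymE // -mulrA mulr_suml; congr (_ * _).
by apply: eq_bigr => s _; rewrite hE // mulrCA mulrA.
Qed.

End TupleSums.

(** * The Levi-Civita symbol and its contractions *)

Section LeviCivita.
Variables (R : realType) (n : nat).
Implicit Types (F K : cotensor R n) (A B C : seq 'I_n.+1).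
Notation N := n.+1.

(** As the determinant of the basis vectors selected by [A], the symbol is alternating by
    permutation of columns, and its products with determinants reduce to [det_mulmx]. *)
Definition levi : cotensor R n := fun A =>
  if size A == N then \det (\matrix_(i < N, j < N) ((i == nth ord0 A j)%:R : R)) else 0.

Lemma levi_form : is_form N levi.
Proof.
apply/is_formP; rewrite /levi; split=> [A /negbTE -> //|A s sA].
rewrite size_prm sA eqxx -odd_permV -det_perm mulrC -det_mulmx -col_permE.
by congr (\det _); apply/matrixP => i j; rewrite !mxE nth_prm.
Qed.

Lemma levi_enum : levi (enum 'I_N) = 1.
Proof.
rewrite /levi size_enum_ord eqxx -[RHS](det1 _ N); congr (\det _).
by apply/matrixP => i j; rewrite !mxE nth_ord_enum.
Qed.

Lemma uniq_prm_enum A : size A = N -> uniq A -> exists s : 'S_N, A = prm s (enum 'I_N).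
Proof.
move=> sA uA; have sE : size (enum 'I_N) = N by rewrite size_enum_ord.
have : perm_eq (enum 'I_N) A.
  rewrite perm_sym uniq_perm ?enum_uniq //.
  by case: (uniq_min_size uA (_ : {subset A <= enum 'I_N})) => [i|| //]; rewrite ?mem_enum // sA sE.
by move/perm_eq_prm => [s ->]; move: s; rewrite sE => s; exists s.
Qed.

(** A top-degree form lives on rearrangements of [enum 'I_N], hence is determined by a single
    component. *)
Lemma nform_levi F A : is_form N F -> F A = levi A * F (enum 'I_N).
Proof.
move=> hF; have [sA|sA] := eqVneq (size A) N; last first.
  by rewrite (form_size hF) // (form_size levi_form) // mul0r.
have [uA|uA] := boolP (uniq A); last first.
  by rewrite (form_dup hF) // (form_dup levi_form) // mul0r.
have sE : size (enum 'I_N) = N by rewrite size_enum_ord.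
have [s ->] := uniq_prm_enum sA uA.
by rewrite (form_prm _ hF) // (form_prm _ levi_form) // levi_enum mulr1.
Qed.

Lemma levi_sqr A : size A = N -> uniq A -> levi A * levi A = 1.
Proof.
move=> sA uA; have sE : size (enum 'I_N) = N by rewrite size_enum_ord.
have [s ->] := uniq_prm_enum sA uA.
by rewrite (form_prm _ levi_form) // levi_enum mulr1 -signr_addb addbb.
Qed.

(* Only permutations A of C and enumerations B of the complement of C contribute. *)
Lemma levi_contract k l F C : (k + l = N)%N -> is_form k F -> size C = k ->
  tsum k (fun A => tsum l (fun B => F A * (levi (A ++ B) * levi (C ++ B)))) =
  k`!%:R * l`!%:R * F C.
Proof.
move=> kl hF sC; have [uC|uC] := boolP (uniq C); last first.
  rewrite (form_dup hF) // mulr0 /tsum big1 // => A _; rewrite big1 // => B _.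
  by rewrite [levi (C ++ B)](form_dup levi_form) ?mulr0 // cat_uniq (negbTE uC).
have lform D : size D = l -> is_form k (fun A => levi (A ++ D)).
  by move=> sD; apply: form_catl; rewrite sD kl; exact: levi_form.
have rform D : size D = k -> is_form l (fun A => levi (D ++ A)).
  by move=> sD; apply: form_catr; rewrite sD kl; exact: levi_form.
rewrite tsum_exchange.
rewrite (@eq_tsum _ _ _ _ (fun B => k`!%:R * F C * (levi (C ++ B) * levi (C ++ B)))).
  rewrite tsum_mull [RHS]mulrAC; congr (_ * _).
  pose B0 := [seq i <- enum 'I_N | i \notin C].
  have uB0 : uniq B0 by rewrite filter_uniq ?enum_uniq.
  have dis : ~~ has (mem C) B0.
    by apply/hasPn => i; rewrite mem_filter => /andP[].
  have uCB0 : uniq (C ++ B0) by rewrite cat_uniq uC dis uB0.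
  have sCB0 : size (C ++ B0) = N.
    rewrite -(card_uniqP uCB0) -[RHS]card_ord; apply: eq_card => i.
    by rewrite inE mem_cat mem_filter mem_enum andbT orbN.
  have sB0 : size B0 = l by apply: (@addnI k); rewrite kl -[RHS]sCB0 size_cat sC.
  rewrite (@tsum_support _ _ _ B0) //; first by rewrite levi_sqr // mulr1.
    move=> B /perm_eq_prm[s ->]; move: s; rewrite sB0 => s.
    by rewrite (form_prm _ (rform _ sC)) // mulrACA -signr_addb addbb mul1r.
  move=> B sB; apply: contraNeq; rewrite mulf_eq0 negb_or => /andP[h _].
  have : uniq (C ++ B) by apply: contraNT h => h; rewrite (form_dup levi_form).
  rewrite cat_uniq => /and3P[_ /hasPn hC ->]; rewrite andbT.
  by apply/allP => i iB; rewrite /= mem_filter mem_enum andbT; apply: hC.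
move=> B sB; have [uCB|uCB] := boolP (uniq (C ++ B)); last first.
  rewrite [levi (C ++ B)](form_dup levi_form) // !mulr0 -[RHS](mulr0 0).
  by rewrite /tsum big1 ?mulr0 // => A _; rewrite !mulr0.
rewrite (eq_tsum (K := fun A => F A * levi (A ++ B) * levi (C ++ B))); last first.
  by move=> A _; rewrite mulrA.
rewrite tsum_mulr mulrA; congr (_ * _); rewrite -mulrA.
apply: tsum_support => //.
  move=> A /perm_eq_prm[s ->]; move: s; rewrite sC => s.
  by rewrite (form_prm _ (lform _ sB)) // (form_prm _ hF) // mulrACA -signr_addb addbb mul1r.
move=> A sA; apply: contraNeq; rewrite mulf_eq0 negb_or => /andP[_ h].
have : uniq (A ++ B) by apply: contraNT h => h; rewrite (form_dup levi_form).
rewrite cat_uniq => /and3P[-> /hasPn hA uB]; rewrite andbT.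
have : (C ++ B) =i enum 'I_N.
  case: (uniq_min_size uCB (_ : {subset C ++ B <= enum 'I_N})) => [i|| //]; rewrite ?mem_enum //.
  by rewrite size_cat sC sB kl size_enum_ord.
move=> hCB; apply/allP => i iA /=; have := hCB i; rewrite mem_enum mem_cat => /orP[//|iB].
by have := hA _ iB; rewrite /= iA.
Qed.

Lemma levi_contract_r k l F C : (k + l = N)%N -> is_form l F -> size C = l ->
  tsum k (fun A => tsum l (fun B => levi (A ++ C) * (F B * levi (A ++ B)))) =
  k`!%:R * l`!%:R * F C.
Proof.
move=> kl hF sC; rewrite tsum_exchange [k`!%:R * _]mulrC.
rewrite -(levi_contract (k := l) (l := k)) 1?addnC //.
apply: eq_tsum => B sB; apply: eq_tsum => A sA.
(* Both symbols acquire the same sign when the two blocks of indices change places, so the signs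
   square to 1. *)
have h D : size D = l -> levi (A ++ D) = (-1) ^+ (k * l) * levi (D ++ A).
  move=> sD; have := form_rot A D [::] levi_form; rewrite !cats0 sD sA => ->.
  by [].
have sg : (-1) ^+ (k * l) * (-1) ^+ (k * l) = 1 :> R by rewrite -expr2 sqrr_sign.
move: h sg; move: ((-1) ^+ (k * l)) => e h sg; rewrite !h //; transitivity (e * e *
  (F B * (levi (B ++ A) * levi (C ++ A)))); first by ring.
by rewrite sg mul1r.
Qed.

End LeviCivita.

(** * Alternation over one extra index, and interior multiplication by X *)

Section Alternation.
Variables (R : realType) (n : nat).
Implicit Types (F K : cotensor R n) (A B C : seq 'I_n.+1).

(** Common shape of the operators that raise the degree by one: [K b] is the derivative in direction
    [b] for the exterior Thomas operator, and a covector component times a form for the wedge. Both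
    carry the factor [k.+1]. *)
Definition alt1 k (K : 'I_n.+1 -> cotensor R n) : cotensor R n := fun A =>
  k.+1%:R * antisym k.+1 (fun B => if B is b :: B' then K b B' else 0) A.

Lemma alt1_form k (K : 'I_n.+1 -> cotensor R n) : is_form k.+1 (alt1 k K).
Proof. exact: form_scale (antisym_form _ _). Qed.

Lemma eq_alt1 k (K L : 'I_n.+1 -> cotensor R n) A :
  (forall b B, size B = k -> K b B = L b B) -> alt1 k K A = alt1 k L A.
Proof.
move=> h; rewrite /alt1; congr (_ * _).
by apply: eq_antisym => -[|b B] // [sB]; exact: h.
Qed.

Lemma alt1_scale k (a : R) (K : 'I_n.+1 -> cotensor R n) A :
  alt1 k (fun b B => a * K b B) A = a * alt1 k K A.
Proof.
rewrite /alt1 [RHS]mulrCA; congr (_ * _); rewrite -antisym_scale.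
by apply: eq_antisym => -[|b B].
Qed.

Lemma alt1_add k (K L : 'I_n.+1 -> cotensor R n) A :
  alt1 k (fun b B => K b B + L b B) A = alt1 k K A + alt1 k L A.
Proof.
rewrite /alt1 -mulrDr -antisym_add; congr (_ * _).
by apply: eq_antisym => -[|b B].
Qed.

Lemma alt1_0 k A : alt1 k (fun _ _ => 0) A = 0.
Proof.
transitivity (0 * alt1 k (fun _ _ => 0) A); last by rewrite mul0r.
by rewrite -alt1_scale; apply: eq_alt1 => b B _; rewrite mul0r.
Qed.

(** The argument is already alternating, so only the normalising factor remains; it becomes the
    degree in the Cartan formula. *)
Lemma alt1_cons k F A : is_form k.+1 F -> alt1 k (fun b B => F (b :: B)) A = k.+1%:R * F A.
Proof.
move=> hF; rewrite /alt1 -[F A in RHS](form_antisym A hF); congr (_ * _).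
by apply: eq_antisym => -[|b B].
Qed.

Definition del k (j : 'I_k.+1) A : seq 'I_n.+1 :=
  [seq nth ord0 A (lift j i) | i <- enum 'I_k].

Lemma size_del k (j : 'I_k.+1) A : size (del j A) = k.
Proof. by rewrite size_map size_enum_ord. Qed.

Lemma nth_del k (j : 'I_k.+1) A (i : 'I_k) :
  nth ord0 (del j A) i = nth ord0 A (lift j i).
Proof. by rewrite (nth_map i) ?size_enum_ord // nth_ord_enum. Qed.

(** A permutation of k+1 points is the image [j] of the first one together with a permutation of the
    rest; injectivity and a count give the bijection. *)
Lemma sum_perm_lift k (G : 'S_k.+1 -> R) :
  \sum_s G s = \sum_(j < k.+1) \sum_(t : 'S_k) G (lift_perm ord0 j t).
Proof.
rewrite pair_big /= (reindex (fun p : 'I_k.+1 * 'S_k => lift_perm ord0 p.1 p.2)) //=.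
apply: onW_bij; apply: inj_card_bij => [[j s] [j' s'] /= e|].
  have ej : j = j' by rewrite -(lift_perm_id ord0 j s) e lift_perm_id.
  rewrite -{j'}ej in e *; congr (_, _); apply/permP => i.
  by apply: (@lift_inj _ j); rewrite -!(lift_perm_lift ord0) e.
by rewrite card_prod !card_Sn card_ord factS.
Qed.

(** Laplace expansion over the index that fills the extra slot: each [K b] is alternating, so the
    inner sum over permutations collapses. *)
Lemma alt1E k (K : 'I_n.+1 -> cotensor R n) A :
  (forall b, is_form k (K b)) -> size A = k.+1 ->
  alt1 k K A = \sum_(j < k.+1) (-1) ^+ j * K (nth ord0 A j) (del j A).
Proof.
move=> hK sA; rewrite /alt1 antisymE // sum_perm_lift mulrA mulr_sumr.
apply: eq_bigr => j _.
rewrite -(form_antisym (del j A) (hK _)) antisymE ?size_del // mulrCA.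
congr (_ * _); last first.
  rewrite mulr_sumr; apply: eq_bigr => t _.
  rewrite odd_lift_perm /= signr_addb signr_odd -mulrA; congr (_ * (_ * _)).
  rewrite /prm enum_ordSl /= lift_perm_id; congr (K _ _).
  apply: (@eq_nth_ord _ k); rewrite ?size_map -?enumT ?size_enum_ord // => i.
  rewrite nth_prm nth_del -map_comp (nth_map i) ?size_enum_ord //= nth_ord_enum.
  by rewrite lift_perm_lift.
by rewrite factS natrM invfM mulrA divff ?pnatr_eq0 // mul1r.
Qed.

(* Interior multiplication by X in the frame (X, W_1, ..., W_n). *)
Definition iota_X F : cotensor R n := fun B => F (ord0 :: B).

Lemma iota_X_form k F : is_form k.+1 F -> is_form k (iota_X F).
Proof. by move=> hF; apply: (@form_catr _ _ _ _ [:: ord0]). Qed.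

(** Degree 0 stands apart because the second term of [alt1_iota_X] would involve forms of degree
    -1. *)
Lemma alt1_iota_X0 (K : 'I_n.+1 -> cotensor R n) B :
  (forall b, is_form 0 (K b)) -> alt1 0 K (ord0 :: B) = K ord0 B.
Proof.
move=> hK; have [sB|sB] := eqVneq (size B) 0%N; last first.
  by rewrite (form_size (alt1_form 0 K)) ?(form_size (hK _)).
rewrite alt1E //= ?sB // big_ord1 mul1r /=; congr (K _ _).
by move/size0nil: sB => ->; apply/size0nil; rewrite size_del.
Qed.

(** Interior multiplication is an antiderivation: every summand of the first expansion, except the
    one where the index of X goes to [K], cancels against the second term. *)
Lemma alt1_iota_X k (K : 'I_n.+1 -> cotensor R n) B :
  (forall b, is_form k.+1 (K b)) ->
  alt1 k.+1 K (ord0 :: B) + alt1 k (fun b => iota_X (K b)) B = K ord0 B.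
Proof.
move=> hK; have [sB|sB] := eqVneq (size B) k.+1; last first.
  rewrite (form_size (alt1_form _ _)) // (form_size (alt1_form _ _)) //.
  by rewrite (form_size (hK _)) ?addr0.
rewrite !alt1E //=; last 2 first.
- by move=> b; apply/iota_X_form/hK.
- by rewrite sB.
rewrite big_ord_recl /= mul1r -addrA -big_split /= big1 ?addr0 => [|j _].
  congr (K _ _); apply: (@eq_nth_ord _ k.+1); rewrite ?size_del // => i.
  by rewrite nth_del.
rewrite exprS mulN1r mulNr -[X in - X + _](_ : (-1) ^+ j * K (nth ord0 B j)
  (ord0 :: del j B) = _) ?addNr //.
congr (_ * K _ _); apply: (@eq_nth_ord _ k.+1); rewrite /= ?size_del //= => i.
case: (unliftP ord0 i) => [i'|] ->; rewrite nth_del //= nth_del.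
by rewrite /= /bump !leq0n !add1n ltnS addnS.
Qed.

End Alternation.

(** * The Hodge star of a metric with a multiple of the Levi-Civita symbol *)

Section Star.
Variables (R : realType) (n : nat).
Implicit Types (F K : cotensor R n) (A B C : seq 'I_n.+1).
Notation N := n.+1.

(* The coefficient of [H^{A_1 B_1} ... H^{A_k B_k}]; surplus indices of the longer
   list are ignored. *)
Definition raise (H : 'M[R]_N) A B : R := \prod_(x <- zip A B) H x.1 x.2.

Lemma raise_cons H a b A B : raise H (a :: A) (b :: B) = H a b * raise H A B.
Proof. by rewrite /raise /= big_cons. Qed.

Lemma raise_cat H A B C D : size A = size C ->
  raise H (A ++ B) (C ++ D) = raise H A C * raise H B D.
Proof. by move=> e; rewrite /raise zip_cat // big_cat. Qed.

Lemma raiseE H k A B : size A = k -> size B = k ->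
  raise H A B = \prod_(i < k) H (nth ord0 A i) (nth ord0 B i).
Proof.
move=> sA sB; rewrite /raise (big_nth (ord0, ord0)) size_zip sA sB minnn big_mkord.
by apply: eq_bigr => i _; rewrite nth_zip ?sA ?sB.
Qed.

Lemma raise_prm H k A B (s : 'S_k) : size A = k -> size B = k ->
  raise H (prm s A) (prm s B) = raise H A B.
Proof.
move=> sA sB; rewrite !(@raiseE _ k) ?size_prm // [RHS](reindex_inj (@perm_inj _ s)).
by apply: eq_bigr => i _; rewrite !nth_prm.
Qed.

Lemma raise_sym H A B : H^T = H -> size A = size B -> raise H A B = raise H B A.
Proof.
move=> hH e; rewrite !(@raiseE _ (size A)) //.
by apply: eq_bigr => i _; rewrite -{1}hH mxE.
Qed.

Lemma form_innerE H k F G : form_inner H k F G =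
  (k`!%:R)^-1 * tsum k (fun A => tsum k (fun C => raise H A C * F A * G C)).
Proof.
congr (_ * _); apply: eq_bigr => A _; apply: eq_bigr => C _; congr (_ * _ * _).
rewrite (@raiseE _ k) ?size_tuple //; apply: eq_bigr => i _.
by rewrite !(tnth_nth ord0).
Qed.

(** Expanding the symbol of [L] over permutations [s] leaves only the tuple with entries [s i]; what
    remains is the determinant of a product. *)
Lemma levi_det H A : size A = N ->
  tsum N (fun L => raise H L A * levi R L) = \det H * levi R A.
Proof.
move=> sA; pose M L : 'M[R]_N := \matrix_(i, j) ((i == nth ord0 L j)%:R).
transitivity (\det ((M A)^T *m H^T)); last first.
  by rewrite det_mulmx !det_tr mulrC /levi sA eqxx.
rewrite (eq_tsum (K := fun L : seq 'I_N => \sum_(s : 'S_N)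
    (-1) ^+ s * \prod_(i < N) (H (nth ord0 L i) (nth ord0 A i) * (s i == nth ord0 L i)%:R))).
  rewrite tsum_sum; apply: eq_bigr => s _; rewrite tsum_mull; congr (_ * _).
  rewrite /tsum (bigD1 [tuple s i | i < N]) //= [X in _ + X]big1 ?addr0 => [|L hL].
    apply: eq_bigr => j _; rewrite (nth_map j) ?size_enum_ord // nth_ord_enum eqxx mulr1.
    rewrite mxE (bigD1 (nth ord0 A j)) //= !mxE eqxx mul1r big1 ?addr0 // => i hi.
    by rewrite !mxE (negbTE hi) mul0r.
  have [i hi] : exists i, s i != nth ord0 L i.
    apply/existsP; apply: contraR hL; rewrite negb_exists => /forallP h.
    apply/eqP/eq_from_tnth => i; rewrite tnth_mktuple (tnth_nth ord0).
    by have := h i; rewrite negbK => /eqP.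
  by rewrite (bigD1 i) //= (negbTE hi) mulr0 mul0r.
move=> L sL; rewrite (@raiseE _ N) // /levi sL eqxx -det_tr mulr_sumr.
apply: eq_bigr => s _; rewrite mulrCA -big_split; congr (_ * _).
by apply: eq_bigr => i _; rewrite !mxE.
Qed.

Lemma form_tsum k l (F : seq 'I_N -> cotensor R n) :
  (forall A, size A = k -> is_form l (F A)) -> is_form l (fun B => tsum k (fun A => F A B)).
Proof. by move=> h; apply: form_sum => A; apply: h; rewrite size_tuple. Qed.

(** In index notation w/k! H^{AC} G_C epsilon_{AB}, the star for the volume form [w * levi]. The
    contracted block [A] comes first, as [F] does in the defining relation of [is_star]. *)
Definition star_form (H : 'M[R]_N) (w : R) k (G : cotensor R n) : cotensor R n := fun B =>
  w / k`!%:R * tsum k (fun A => tsum k (fun C => raise H A C * G C * levi R (A ++ B))).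

Lemma star_form_form H w k l G : (k + l = N)%N -> is_form l (star_form H w k G).
Proof.
move=> kl; apply: form_scale; apply: form_tsum => A sA; apply: form_tsum => C sC.
by apply: form_scale; apply: form_catr; rewrite sA kl; exact: levi_form.
Qed.

Lemma star_form_size H w k G B : (k + size B)%N != N -> star_form H w k G B = 0.
Proof.
move=> kB; rewrite /star_form /tsum big1 ?mulr0 // => A _; rewrite big1 // => C _.
by rewrite (form_size (levi_form _ _)) ?mulr0 // size_cat size_tuple.
Qed.

Lemma star_form_gt H w k G B : (N < k)%N -> star_form H w k G B = 0.
Proof.
move=> kN; apply: star_form_size.
by apply: contraTneq kN => <-; rewrite -leqNgt leq_addr.
Qed.

Lemma eq_star_form H w k G G' B : (forall A, size A = k -> G A = G' A) ->
  star_form H w k G B = star_form H w k G' B.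
Proof.
move=> h; congr (_ * _); apply: eq_tsum => A _; apply: eq_tsum => C sC.
by rewrite h.
Qed.

Lemma star_form_scale H w k a G B :
  star_form H w k (fun A => a * G A) B = a * star_form H w k G B.
Proof.
rewrite /star_form [RHS]mulrCA; congr (_ * _); rewrite -tsum_mull.
apply: eq_tsum => A _; rewrite -tsum_mull; apply: eq_tsum => C sC.
by ring.
Qed.

Lemma star_form_add H w k F G B :
  star_form H w k (fun A => F A + G A) B = star_form H w k F B + star_form H w k G B.
Proof.
rewrite /star_form -mulrDr -tsum_add; congr (_ * _).
apply: eq_tsum => A _; rewrite -tsum_add; apply: eq_tsum => C sC.
by ring.
Qed.

Lemma wedge_enum k l F K : (k + l = N)%N ->
  k`!%:R * l`!%:R * wedge k l F K (enum 'I_N) =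
  tsum k (fun A => tsum l (fun B => levi R (A ++ B) * (F A * K B))).
Proof.
move=> kl; rewrite /wedge kl.
set W := fun B => _; have hW := antisym_form N W.
have := levi_contract (addn0 N) hW (size_enum_ord N).
rewrite (eq_tsum (K := fun A => antisym N W A * levi R A)); last first.
  by move=> A _; rewrite tsum0 !cats0 levi_enum mulr1.
rewrite tsum_antisym ?mulr1 => [|A s sA]; last exact: (form_prm _ (levi_form R n)).
move=> h; transitivity (N`!%:R * antisym N W (enum 'I_N)).
  by rewrite mulrA [_ * (_ / _)]mulrC divfK // mulf_neq0 ?factR_neq0.
rewrite -h; transitivity (tsum (k + l) (fun A => W A * levi R A)); first by rewrite kl.
rewrite tsum_cat; apply: eq_tsum => A sA; apply: eq_tsum => B sB.
by rewrite /W take_size_cat // drop_size_cat // mulrC.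
Qed.

Lemma tsum_exchange4 k l p q (F : seq 'I_N -> seq 'I_N -> seq 'I_N -> seq 'I_N -> R) :
  tsum k (fun A => tsum l (fun B => tsum p (fun C => tsum q (fun D => F A B C D)))) =
  tsum p (fun C => tsum q (fun D => tsum k (fun A => tsum l (fun B => F A B C D)))).
Proof.
transitivity (tsum k (fun A => tsum p (fun C => tsum l (fun B => tsum q (fun D => F A B C D))))).
  by apply: eq_tsum => A _; rewrite tsum_exchange.
rewrite tsum_exchange; apply: eq_tsum => C _.
transitivity (tsum k (fun A => tsum q (fun D => tsum l (fun B => F A B C D)))).
  by apply: eq_tsum => A _; rewrite tsum_exchange.
by rewrite tsum_exchange.
Qed.

(** Only one component of the top-degree identity has to be checked, and there the wedge becomes a
    contraction of two symbols. *)
Lemma star_formP H w k l G : (k + l = N)%N ->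
  is_star H (fun A => w * levi R A) k G (star_form H w k G).
Proof.
move=> kl; exists l; split=> //; first exact: star_form_form.
move=> F hF A.
have hW : is_form N (wedge k l F (star_form H w k G)).
  by rewrite /wedge kl; apply: form_scale; apply: antisym_form.
rewrite (nform_levi _ hW) [RHS]mulrCA mulrA [RHS]mulrC; congr (_ * _).
have nz : k`!%:R * l`!%:R != 0 :> R by rewrite mulf_neq0 ?factR_neq0.
apply: (mulfI nz); rewrite wedge_enum // form_innerE.
pose c := w / k`!%:R.
transitivity (tsum k (fun A' => tsum k (fun C => tsum k (fun A => tsum l (fun B =>
    c * (raise H A' C * G C * (F A * (levi R (A ++ B) * levi R (A' ++ B))))))))).
  rewrite -tsum_exchange4; apply: eq_tsum => A1 _; apply: eq_tsum => B1 _.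
  rewrite /star_form -/c !mulrA -tsum_mull; apply: eq_tsum => A2 _.
  rewrite -tsum_mull; apply: eq_tsum => C1 _; rewrite /c; ring.
transitivity (tsum k (fun A => c * (k`!%:R * l`!%:R) * tsum k (fun C => raise H A C * F A * G C))).
  apply: eq_tsum => A1 sA1; rewrite -tsum_mull; apply: eq_tsum => C1 sC1.
  transitivity (c * (raise H A1 C1 * G C1) * (k`!%:R * l`!%:R * F A1)); last by ring.
  rewrite -(levi_contract kl hF sA1) -tsum_mull; apply: eq_tsum => A2 _.
  by rewrite -tsum_mull; apply: eq_tsum => B2 _; ring.
by rewrite tsum_mull /c; ring.
Qed.

Lemma star_starE H w k G :
  star H (fun A => w * levi R A) k G = star_form H w k G.
Proof.
(* Above degree n+1 there is no complementary degree, so [xget] returns its default 0, in agreement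
   with the formula. *)
have [kN|kN] := leqP k N; last first.
  rewrite /star xgetPN => [|K [l [kl _ _]]]; last by lia.
  by apply/funext => B; rewrite star_form_gt.
have kl : (k + (N - k) = N)%N by rewrite subnKC.
have hP := star_formP H w G kl.
apply: xget_unique; first exact: hP.
move=> K [l' [kl' hK1 hK2]]; case: hP => l [{}kl hS1 hS2].
have el : l' = l by apply: (@addnI k); rewrite kl kl'.
subst l'.
apply/funext => B; have [sB|sB] := eqVneq (size B) l; last first.
  by rewrite (form_size hK1) // (form_size hS1).
(* Wedging this test form with a candidate isolates the component [B] of the candidate, whence
   uniqueness. *)
pose F A := levi R (A ++ B).
have hF : is_form k F by apply: form_catl; rewrite sB kl; exact: levi_form.
have nz : k`!%:R * l`!%:R != 0 :> R by rewrite mulf_neq0 ?factR_neq0.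
have h L : is_form l L -> k`!%:R * l`!%:R * wedge k l F L (enum 'I_N) =
    k`!%:R * l`!%:R * L B.
  move=> hL; rewrite wedge_enum // -(levi_contract_r kl hL sB).
  by apply: eq_tsum => A _; apply: eq_tsum => C _; rewrite /F; ring.
by apply: (mulfI nz); rewrite -(h _ hS1) -(h _ hK1) hS2 // hK2.
Qed.

(** Raising the index of [I] gives [lam] times X, which fills one slot of the symbol; moving that
    slot past the [k] contracted ones gives the sign. *)
Lemma star_form_wedge (H : 'M[R]_N) w lam (I : 'I_N -> R) k F B :
  (forall a, \sum_b H a b * I b = lam * (a == ord0)%:R) ->
  star_form H w k.+1 (alt1 k (fun b B' => I b * F B')) B =
  (-1) ^+ k * lam * iota_X (star_form H w k F) B.
Proof.
move=> hI; have [sB|sB] := eqVneq (k.+1 + size B)%N N; last first.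
  by rewrite /iota_X !star_form_size ?mulr0 //= addnS.
pose E C := tsum k.+1 (fun A => raise H A C * levi R (A ++ B)).
have hE C (s : 'S_k.+1) : size C = k.+1 -> E (prm s C) = (-1) ^+ s * E C.
  move=> sC; rewrite /E -(tsum_prm s) -tsum_mull; apply: eq_tsum => A sA.
  have hl : is_form k.+1 (fun A => levi R (A ++ B)).
    by apply: form_catl; rewrite sB; exact: levi_form.
  by rewrite raise_prm // (form_prm _ hl) // mulrCA.
pose W C := if C is c :: C' then I c * F C' else 0.
transitivity (w / k`!%:R * tsum k.+1 (fun C => W C * E C)).
  rewrite -(tsum_antisym _ hE) /star_form tsum_exchange.
  rewrite (eq_tsum (K := fun C => k.+1%:R * (antisym k.+1 W C * E C))) => [|C sC].
    rewrite tsum_mull mulrA; congr (_ * _); rewrite factS natrM invfM mulrA.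
    by rewrite mulrAC divfK ?pnatr_eq0.
  rewrite /alt1 -/W /E -!tsum_mull; apply: eq_tsum => A _; ring.
rewrite /star_form /iota_X [RHS]mulrCA; congr (_ * _).
transitivity (tsum k (fun C => tsum k (fun A =>
  raise H A C * F C * \sum_a (\sum_c H a c * I c) * levi R (a :: A ++ B)))).
  rewrite tsumS /W -tsum_sum; apply: eq_tsum => C sC.
  rewrite /E (eq_bigr (fun c => tsum k (fun A =>
    \sum_a (raise H A C * F C * (H a c * I c * levi R (a :: A ++ B)))))) => [|c _].
    rewrite -tsum_sum; apply: eq_tsum => A _; rewrite exchange_big /= mulr_sumr.
    by apply: eq_bigr => a _; rewrite mulr_suml mulr_sumr.
  rewrite tsumS -tsum_sum -tsum_mull; apply: eq_tsum => A _; rewrite mulr_sumr.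
  by apply: eq_bigr => a _; rewrite raise_cons /=; ring.
rewrite tsum_exchange -!tsum_mull; apply: eq_tsum => A sA.
rewrite -!tsum_mull; apply: eq_tsum => C sC.
rewrite (bigD1 ord0) //= hI eqxx big1 ?addr0 => [|a ha]; last first.
  by rewrite hI (negbTE ha) mulr0 mul0r.
rewrite -[ord0 :: A ++ B]/([::] ++ ord0 :: A ++ B) (form_move _ _ _ _ (levi_form R n)) sA /=.
by move: ((-1) ^+ k) => e; ring.
Qed.

(** The metrics of the two stars together raise all n+1 indices of one symbol, which [levi_det]
    turns into [\det H] times a symbol. Contracting the two remaining symbols returns [G], with a
    sign from interchanging blocks. *)
Lemma star_form_star_form H w k G B : (k <= N)%N -> is_form k G -> H^T = H ->
  star_form H w (N - k) (star_form H w k G) B =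
  w ^+ 2 * \det H * (-1) ^+ (k * (N - k)) * G B.
Proof.
move=> kN hG hH; pose l := (N - k)%N; rewrite -/l.
have kl : (k + l = N)%N by rewrite subnKC.
have [sB|sB] := eqVneq (size B) k; last first.
  rewrite (form_size hG) // mulr0; apply: (form_size _ sB).
  by apply: star_form_form; rewrite addnC.
transitivity (w / l`!%:R * (w / k`!%:R) * tsum k (fun C => tsum l (fun D =>
    G C * (\det H * levi R (C ++ D)) * levi R (D ++ B)))).
  rewrite /star_form -[RHS]mulrA; congr (_ * _).
  transitivity (w / k`!%:R * tsum l (fun D => tsum l (fun C => tsum k (fun A =>
    tsum k (fun A' => raise H D C * (raise H A A' * G A' * levi R (A ++ C)) *
       levi R (D ++ B)))))).
    rewrite -tsum_mull; apply: eq_tsum => D _; rewrite -tsum_mull.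
    apply: eq_tsum => C _.
    transitivity (raise H D C * (w / k`!%:R) * levi R (D ++ B) * tsum k (fun A =>
      tsum k (fun A' => raise H A A' * G A' * levi R (A ++ C)))); first by ring.
    rewrite -!tsum_mull; apply: eq_tsum => A _; rewrite -!tsum_mull.
    by apply: eq_tsum => A' _; ring.
  congr (_ * _); rewrite [RHS]tsum_exchange; apply: eq_tsum => D sD.
  rewrite (eq_tsum (K := fun C => tsum k (fun A' => tsum k (fun A => 
    raise H D C * (raise H A A' * G A' * levi R (A ++ C)) * levi R (D ++ B))))).
    rewrite tsum_exchange; apply: eq_tsum => A' sA'.
    have -> : \det H * levi R (A' ++ D) = tsum k (fun A => tsum l (fun C =>
        raise H (A ++ C) (A' ++ D) * levi R (A ++ C))).
      rewrite -levi_det; last by rewrite size_cat sA' sD.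
      by rewrite -(tsum_cat k l (fun L => raise H L (A' ++ D) * levi R L)) kl.
    rewrite tsum_exchange -tsum_mull -tsum_mulr; apply: eq_tsum => A sA.
    rewrite -tsum_mull -tsum_mulr; apply: eq_tsum => C sC.
    by rewrite raise_cat ?sA ?sA' // (raise_sym (A := D)) ?sC ?sD //; ring.
  by move=> C _; rewrite tsum_exchange.
have sg : (-1) ^+ (k * l) * (-1) ^+ (k * l) = 1 :> R by rewrite -expr2 sqrr_sign.
rewrite (eq_tsum (K := fun C => \det H * (-1) ^+ (k * l) * tsum l (fun D =>
    G C * (levi R (C ++ D) * levi R (B ++ D))))) => [|C sC].
  rewrite tsum_mull levi_contract //.
  move: ((-1) ^+ _) => e; field.
  by rewrite !factR_neq0.
rewrite -tsum_mull; apply: eq_tsum => D sD.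
have := form_rot B D [::] (levi_form R n); rewrite !cats0 sD sB => ->.
move: sg; move: ((-1) ^+ (k * l)) => e sg.
transitivity (e * e * (G C * (\det H * levi R (C ++ D)) * levi R (D ++ B))).
  by rewrite sg mul1r.
by ring.
Qed.


End Star.

(** * Wedges of covectors, the algebraic Cartan formula, and duality under the star *)

Section Duality.
Variables (R : realType) (n : nat).
Implicit Types (F K : cotensor R n) (A B C : seq 'I_n.+1).
Notation N := n.+1.

Lemma wedge1E m (v : 'rV[R]_N) K A :
  wedge 1 m (one_cotensor v) K A = alt1 m (fun b B => v ord0 b * K B) A.
Proof.
rewrite /wedge /alt1 add1n; congr (_ * _).
  by rewrite factS natrM (_ : 1`! = 1%N) // mul1r mulfK ?factR_neq0.
by apply: eq_antisym => -[|b B] //= _; rewrite take0 drop0.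
Qed.

Lemma wedge_list_form (vs : seq 'rV[R]_N) : is_form (size vs) (wedge_list vs).
Proof.
case: vs => [|v vs] /=.
  apply/is_formP; split=> [A|A s sA]; first by case: A.
  by rewrite (size0nil sA) [s]permS0 prm1 // odd_perm1 mul1r.
by rewrite /wedge -add1n; apply: form_scale; apply: antisym_form.
Qed.

(** The expansion of [alt1] is the cofactor expansion along the row of the first covector. *)
Lemma wedge_listE (vs : seq 'rV[R]_N) A m : size vs = m -> size A = m ->
  wedge_list vs A = \det (\matrix_(i < m, j < m) nth 0 vs i ord0 (nth ord0 A j)).
Proof.
elim: vs m A => [|v vs IH] [|m] A //=.
  by move=> _ /size0nil ->; rewrite det_mx00.
case=> <- {m} sA; rewrite wedge1E alt1E //; last first.
  by move=> b; apply: form_scale; apply: wedge_list_form.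
rewrite (expand_det_row _ ord0); apply: eq_bigr => j _.
rewrite !mxE /= mulrCA; congr (_ * _); rewrite /cofactor add0n; congr (_ * _).
rewrite (IH (size vs)) ?size_del //; congr (\det _); apply/matrixP => i k.
by rewrite !mxE nth_del.
Qed.

Lemma wedge_list_levi (vs : seq 'rV[R]_N) A : size vs = N ->
  wedge_list vs A = \det (\matrix_(i < N, j < N) nth 0 vs i ord0 j) * levi R A.
Proof.
move=> sv; have [sA|sA] := eqVneq (size A) N; last first.
  rewrite (form_size (levi_form _ _)) // mulr0; apply: (form_size _ sA).
  by rewrite -[X in is_form X]sv; exact: wedge_list_form.
rewrite (wedge_listE sv sA) /levi sA eqxx -det_mulmx; congr (\det _).
apply/matrixP => i j; rewrite !mxE (bigD1 (nth ord0 A j)) //= !mxE eqxx mulr1.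
by rewrite big1 ?addr0 // => k hk; rewrite !mxE (negbTE hk) mulr0.
Qed.

(** Here [K] stands for the derivative of [F] and [L] for that of its interior product; the Leibniz
    term [F (b :: B)] contributes the degree. *)
Lemma cartan_alt1 k (K L : 'I_N -> cotensor R n) F B : is_form k F ->
  (forall b, is_form k (K b)) ->
  (forall b B, L b B = iota_X (K b) B + F (b :: B)) ->
  alt1 (k - 1) L B + alt1 k K (ord0 :: B) = K ord0 B + k%:R * F B.
Proof.
move=> hF hK hL; case: k => [|k] in hF hK *.
  (* For [k = 0] the truncated [k - 1] is 0, and [L] vanishes on the empty list because it evaluates
     0-forms on one index. *)
  rewrite mul0r addr0 alt1_iota_X0 // [X in X + _](_ : _ = 0) ?add0r //.
  rewrite -(alt1_0 R 0 B); apply: eq_alt1 => b C _.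
  by rewrite hL (form_size hF) // addr0; apply: (form_size (hK b)).
rewrite subn1 /= -(alt1_iota_X B hK) -(alt1_cons B hF) addrC -addrA; congr (_ + _).
by rewrite -alt1_add; apply: eq_alt1.
Qed.

Section WithMetric.
Variables (H : 'M[R]_N) (w lam : R) (I : 'I_N -> R).
Hypothesis hH : H^T = H.
Hypothesis hI : forall a, \sum_b H a b * I b = lam * (a == ord0)%:R.

Lemma star_wedge_star k F B : (k <= N)%N -> is_form k F ->
  star_form H w (N - k).+1 (alt1 (N - k) (fun b C => I b * star_form H w k F C)) B =
  (-1) ^+ (N - k) * (-1) ^+ (k * (N - k)) * lam * (w ^+ 2 * \det H) * F (ord0 :: B).
Proof.
move=> kN hF; rewrite (star_form_wedge _ _ _ _ hI) /iota_X star_form_star_form //.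
by move: ((-1) ^+ _) ((-1) ^+ _) => e1 e2; ring.
Qed.

(** By [star_wedge_star], the star of [P] is a multiple of the interior product of [Q]. One more
    star returns a multiple of [P], and the common factor [w ^+ 2 * \det H] cancels. *)
Lemma star_iota_X m Q B : (m < N)%N -> is_form m.+1 Q -> w ^+ 2 * \det H != 0 ->
  lam * star_form H w m (iota_X Q) B =
  (-1) ^+ m * alt1 (N - m.+1) (fun b C => I b * star_form H w m.+1 Q C) B.
Proof.
move=> mN hQ nz; set P := alt1 _ _.
have em : (N - m.+1).+1 = (N - m)%N by lia.
have hP : is_form (N - m) P by rewrite -em; apply: alt1_form.
have := star_form_star_form w B (leq_subr m N) hP hH.
rewrite subKn 1?ltnW // => e1.
have e2 C : star_form H w (N - m) P C = (-1) ^+ (N - m.+1) *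
    (-1) ^+ (m.+1 * (N - m.+1)) * lam * (w ^+ 2 * \det H) * iota_X Q C.
  by rewrite -em; apply: star_wedge_star.
have sgn (j : nat) : (-1) ^+ j * (-1) ^+ j = 1 :> R by rewrite -expr2 sqrr_sign.
move: e1; rewrite (eq_star_form _ _ _ (fun C _ => e2 C)) star_form_scale.
have -> : ((N - m) * m = (N - m.+1) * m + m)%N by rewrite -em mulSn addnC.
have -> : (m.+1 * (N - m.+1) = (N - m.+1) * m + (N - m.+1))%N.
  by rewrite mulSn addnC mulnC.
rewrite !exprD; have := (sgn (N - m.+1)%N); have := (sgn ((N - m.+1) * m)%N).
move: nz; move: (w ^+ 2 * \det H) ((-1) ^+ m) => dl em'.
move: ((-1) ^+ (N - m.+1)) ((-1) ^+ ((N - m.+1) * m)) => r1 r2 nz h2 h1 e1.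
apply: (mulfI nz).
transitivity (r1 * r1 * (r2 * r2) * dl * (lam * star_form H w m (iota_X Q) B)).
  by rewrite h1 h2 !mul1r.
transitivity (r2 * (r1 * (r2 * r1) * lam * dl * star_form H w m (iota_X Q) B)); first by ring.
rewrite e1; transitivity (r2 * r2 * (dl * (em' * P B))); first by ring.
by rewrite h2 mul1r.
Qed.

End WithMetric.

End Duality.

(** * Smooth functions of a chart *)

Section PartialDerivatives.
Variables (R : realType) (n : nat) (T : topologicalType).
Variables (c : chart R n T) (hc : is_chart c).
Variables (V : set T) (oV : open V) (VD : V `<=` chart_dom c).
Implicit Types (f g : T -> R) (p q : T) (i : 'I_n).

(** A relation in place of the value [pd], because [lim] is informative only when the quotient
    converges; [is_pd_pd] recovers the value. *)
Definition is_pd f p i (l : R) : Prop := pd_quotient c i f p @ pd_filter c i p --> l.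

Definition shift_pt p i (t : R) : T := pt c (crd c p + t *: delta_mx ord0 i).

#[local] Instance pd_filter_filter p i : Filter (pd_filter c i p).
Proof. exact: within_filter. Qed.

Lemma crd_halfspace p : chart_dom c p -> halfspace (crd c p).
Proof.
case: hc => _ _ _ _ [U _ e] dp.
have : (crd c @` chart_dom c) (crd c p) by exists p.
by rewrite e => -[].
Qed.

(** Positive increments stay in the half-space even from a boundary point. Properness is what makes
    the limits unique. *)
Lemma pd_filter_proper p i : chart_dom c p -> ProperFilter (pd_filter c i p).
Proof.
move=> dp; apply: Build_ProperFilter.
rewrite /pd_filter /within /= => h0.
have [e /= e0 he] : \forall t \near (0 : R),
   t != 0 -> halfspace (crd c p + t *: delta_mx ord0 i) -> False by exact: h0.
apply: (he (e / 2)); rewrite /= ?gt_eqF ?divr_gt0 // ?sub0r ?normrN.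
  by rewrite gtr0_norm ?divr_gt0 // ltr_pdivrMr // ltr_pMr // ltr1n.
move=> j hj; rewrite !mxE eqxx /= addr_ge0 ?(crd_halfspace dp) // mulr_ge0 ?ler0n //.
by rewrite divr_ge0 // ltW.
Qed.

(** The image of a chart is relatively open in the half-space, so small admissible increments remain
    in it and continuity of [pt c] applies. *)
Lemma shift_pt_cvg p i : chart_dom c p -> shift_pt p i @ pd_filter c i p --> p.
Proof.
case: hc => _ hpt _ hcont [U oO eO] dp.
have hp : (crd c @` chart_dom c) (crd c p) by exists p.
have {}hcont : pt c x @[x --> within (crd c @` chart_dom c) (nbhs (crd c p))] --> p.
  by rewrite -[X in _ --> X]hpt //; move/subspace_continuousP : hcont; apply.
have hsh : crd c p + t *: delta_mx ord0 i @[t --> (0 : R)] --> crd c p.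
  suff : crd c p + t *: delta_mx ord0 i @[t --> (0 : R)] --> crd c p + 0 *: delta_mx ord0 i.
    by rewrite scale0r addr0.
  by apply: cvgD; [exact: cvg_cst|apply: cvgZr_tmp; exact: cvg_id].
have hO : nbhs (crd c p) U.
  by apply: open_nbhs_nbhs; split=> //; move: hp; rewrite eO => -[].
move=> W /hcont hW.
have := @nbhs_dnbhs R 0 _ (hsh _ (@filterI _ _ (nbhs_filter (crd c p)) _ _ hO hW)).
by apply: (@filterS _ (0 : R)^') => t [tO tW] th; apply: tW; rewrite eO.
Qed.

Lemma shift_pt_in p i : V p -> \forall t \near pd_filter c i p, V (shift_pt p i t).
Proof. by move=> Vp; apply: (shift_pt_cvg i (VD Vp)); apply: open_nbhs_nbhs. Qed.

Lemma comp_shift_pt f p i : V p -> {for p, continuous f} ->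
  f (shift_pt p i t) @[t --> pd_filter c i p] --> f p.
Proof. by move=> Vp hf; apply: cvg_comp; [exact/shift_pt_cvg/VD|exact: hf]. Qed.

Lemma is_pd_pd f p i l : V p -> is_pd f p i l -> pd c i f p = l.
Proof.
by move=> Vp; have ? := pd_filter_proper i (VD Vp); apply: cvg_lim.
Qed.

Lemma is_pd_exists f p i l : is_pd f p i l -> pd_exists c i f p.
Proof. by move=> h; apply/cvg_ex; exists l. Qed.

Lemma pd_exists_is_pd f p i : pd_exists c i f p -> is_pd f p i (pd c i f p).
Proof. by []. Qed.

Lemma is_pd_ext f g p i l : V p -> (forall q, V q -> f q = g q) ->
  is_pd f p i l -> is_pd g p i l.
Proof.
move=> Vp fg; apply: cvg_trans; apply: near_eq_cvg.
have := shift_pt_in i Vp; apply: filterS => t Vt.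
by rewrite /pd_quotient -/(shift_pt _ _ _) !fg.
Qed.

Lemma is_pd_cst p i (a : R) : is_pd (fun=> a) p i 0.
Proof.
apply: cvg_near_cst; apply: nearW => t.
by rewrite /pd_quotient subrr mulr0.
Qed.

Lemma is_pd_add f g p i a b : is_pd f p i a -> is_pd g p i b ->
  is_pd (fun q => f q + g q) p i (a + b).
Proof.
move=> hf hg; apply: cvg_trans (cvgD hf hg); apply: near_eq_cvg.
by apply: nearW => t; rewrite ?fctE /pd_quotient /=; ring.
Qed.

Lemma is_pd_mul f g p i a b : V p -> {for p, continuous g} ->
  is_pd f p i a -> is_pd g p i b ->
  is_pd (fun q => f q * g q) p i (a * g p + f p * b).
Proof.
move=> Vp cg hf hg.
apply: cvg_trans (cvgD (cvgM hf (comp_shift_pt i Vp cg)) (cvgM (cvg_cst (f p)) hg)).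
apply: near_eq_cvg; apply: nearW => t; rewrite ?fctE /pd_quotient /shift_pt /=; ring.
Qed.

Lemma is_pd_scale f p i a b : is_pd f p i b -> is_pd (fun q => a * f q) p i (a * b).
Proof.
move=> hf; apply: cvg_trans (cvgM (cvg_cst a) hf); apply: near_eq_cvg.
by apply: nearW => t; rewrite ?fctE /pd_quotient /=; ring.
Qed.

Lemma is_pd_sum (I : Type) (r : seq I) (F : I -> T -> R) (F' : I -> R) p i :
  (forall j, is_pd (F j) p i (F' j)) ->
  is_pd (fun q => \sum_(j <- r) F j q) p i (\sum_(j <- r) F' j).
Proof.
move=> h; elim: r => [|j r IH].
  rewrite big_nil (_ : (fun _ => _) = (fun=> 0)); first exact: is_pd_cst.
  by apply/funext => q; rewrite big_nil.
rewrite big_cons (_ : (fun _ => _) = (fun q => F j q + \sum_(j <- r) F j q)).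
  exact: is_pd_add.
by apply/funext => q; rewrite big_cons.
Qed.

Lemma continuous_prod (I : Type) (r : seq I) (F : I -> T -> R) p :
  (forall j, {for p, continuous (F j)}) ->
  {for p, continuous (fun q => \prod_(j <- r) F j q)}.
Proof.
move=> h; elim: r => [|j r IH].
  rewrite (_ : (fun _ => _) = (fun=> 1)); first exact: cst_continuous.
  by apply/funext => q; rewrite big_nil.
rewrite (_ : (fun _ => _) = (fun q => F j q * \prod_(j <- r) F j q)).
  by apply: cvgM; [exact: h|exact: IH].
by apply/funext => q; rewrite big_cons.
Qed.

Lemma is_pd_prod (I : eqType) (r : seq I) (F : I -> T -> R) (F' : I -> R) p i :
  V p -> uniq r -> (forall j, {for p, continuous (F j)}) ->
  (forall j, is_pd (F j) p i (F' j)) ->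
  is_pd (fun q => \prod_(j <- r) F j q) p i
    (\sum_(j <- r) F' j * \prod_(k <- r | j != k) F k p).
Proof.
move=> Vp ur cF h; elim: r ur => [_|j r IH /= /andP[jr ur]].
  rewrite big_nil (_ : (fun _ => _) = (fun=> 1)); first exact: is_pd_cst.
  by apply/funext => q; rewrite big_nil.
rewrite (_ : (fun _ => _) = (fun q => F j q * \prod_(j <- r) F j q)); last first.
  by apply/funext => q; rewrite big_cons.
have := is_pd_mul Vp (continuous_prod (r := r) cF) (h j) (IH ur).
rewrite big_cons big_cons eqxx /=; congr (is_pd _ _ _ (_ + _)).
  congr (_ * _); rewrite big_seq [RHS]big_seq_cond; apply: eq_bigl => k.
  by case: eqP => [<-|_]; rewrite ?(negbTE jr) ?andbT.
rewrite mulr_sumr !big_seq; apply: eq_bigr => k kr; rewrite big_cons.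
rewrite (_ : k != j); last by apply: contraNneq jr => <-.
by rewrite mulrCA.
Qed.

(** Jacobi's formula. The trace is rewritten as a sum over permutations to match the termwise
    product rule. *)
Lemma is_pd_det m (M : T -> 'M[R]_m) (M' : 'M[R]_m) p i : V p ->
  (forall a b, {for p, continuous (fun q => M q a b)}) ->
  (forall a b, is_pd (fun q => M q a b) p i (M' a b)) ->
  is_pd (fun q => \det (M q)) p i (\tr (M' *m \adj (M p))).
Proof.
move=> Vp cM h; rewrite /determinant.
have -> : \tr (M' *m \adj (M p)) = \sum_(s : 'S_m) (-1) ^+ s *
    \sum_j M' j (s j) * \prod_(k | j != k) M p k (s k).
  under eq_bigr do rewrite mulr_sumr.
  rewrite exchange_big /=; apply: eq_bigr => j _; rewrite !mxE.
  (* The cofactor at (j, k) collects the permutations with [s j = k]. *)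
  transitivity (\sum_k \sum_(s : 'S_m | s j == k)
      M' j k * ((-1) ^+ s * \prod_(l | j != l) M p l (s l))).
    by apply: eq_bigr => k _; rewrite !mxE expand_cofactor mulr_sumr.
  rewrite [RHS](partition_big (fun s : 'S_m => s j) predT) //=.
  by apply: eq_bigr => k _; apply: eq_bigr => s /eqP <-; rewrite mulrCA.
apply: is_pd_sum => s; apply: is_pd_scale.
apply: (@is_pd_prod _ _ (fun a q => M q a (s a)) (fun a => M' a (s a))) => //.
exact: index_enum_uniq.
Qed.

Lemma is_Ck_ext k f g : (forall q, V q -> f q = g q) -> is_Ck k c V f -> is_Ck k c V g.
Proof.
have cont_ext f' g' : (forall q, V q -> f' q = g' q) ->
    (forall p, V p -> {for p, continuous f'}) -> forall p, V p -> {for p, continuous g'}.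
  move=> fg cf p Vp; have Vn : nbhs p V by apply: open_nbhs_nbhs.
  have : f' x @[x --> p] --> g' p by rewrite -fg //; exact: cf.
  apply: cvg_trans; apply: near_eq_cvg.
  by apply: filterS Vn => q /fg.
elim: k f g => [|k IH] f g fg [cf hf].
  by split=> //; apply: cont_ext cf.
split; first exact: cont_ext cf.
move=> i; have [ef Cf] := hf i; split=> [p Vp|].
  by apply: is_pd_exists; apply: is_pd_ext (pd_exists_is_pd (ef p Vp)).
apply: IH Cf => q Vq; symmetry; apply: is_pd_pd => //.
by apply: is_pd_ext (pd_exists_is_pd (ef q Vq)).
Qed.

Lemma is_Ck_cont k f p : is_Ck k c V f -> V p -> {for p, continuous f}.
Proof. by case: k => [|k] [cf _]; apply: cf. Qed.

Lemma is_Ck_pd k f p i : is_Ck k.+1 c V f -> V p -> is_pd f p i (pd c i f p).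
Proof. by move=> [_ /(_ i)[h _]] Vp; apply/pd_exists_is_pd/h. Qed.

Lemma is_CkW k f : is_Ck k.+1 c V f -> is_Ck k c V f.
Proof.
elim: k f => [|k IH] f [cf hf]; split=> // i.
by have [ef Cf] := hf i; split=> //; apply: IH.
Qed.

Lemma is_Ck_cst k (a : R) : is_Ck k c V (fun=> a).
Proof.
elim: k a => [|k IH] a; first by split=> // p _; exact: cst_continuous.
split=> [p _|i]; first exact: cst_continuous.
split=> [p Vp|]; first exact: is_pd_exists (is_pd_cst _ _ _).
by apply: is_Ck_ext (IH 0) => q Vq; symmetry; apply: is_pd_pd => //; apply: is_pd_cst.
Qed.

Lemma is_Ck_add k f g : is_Ck k c V f -> is_Ck k c V g -> is_Ck k c V (fun q => f q + g q).
Proof.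
elim: k f g => [|k IH] f g hf hg.
  by split=> // p Vp; apply: cvgD; [exact: is_Ck_cont hf Vp|exact: is_Ck_cont hg Vp].
split=> [p Vp|i]; first by apply: cvgD; [exact: is_Ck_cont hf Vp|exact: is_Ck_cont hg Vp].
have h p : V p -> is_pd (fun q => f q + g q) p i (pd c i f p + pd c i g p).
  by move=> Vp; apply: is_pd_add; [exact: is_Ck_pd hf Vp|exact: is_Ck_pd hg Vp].
split=> [p Vp|]; first exact: is_pd_exists (h p Vp).
apply: (is_Ck_ext (f := fun q => pd c i f q + pd c i g q)) => [q Vq|].
  by symmetry; apply: is_pd_pd (h q Vq).
by apply: IH; [case: hf => _ /(_ i)[]|case: hg => _ /(_ i)[]].
Qed.

Lemma is_Ck_mul k f g : is_Ck k c V f -> is_Ck k c V g -> is_Ck k c V (fun q => f q * g q).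
Proof.
elim: k f g => [|k IH] f g hf hg.
  by split=> // p Vp; apply: cvgM; [exact: is_Ck_cont hf Vp|exact: is_Ck_cont hg Vp].
split=> [p Vp|i]; first by apply: cvgM; [exact: is_Ck_cont hf Vp|exact: is_Ck_cont hg Vp].
have h p : V p -> is_pd (fun q => f q * g q) p i (pd c i f p * g p + f p * pd c i g p).
  move=> Vp; apply: is_pd_mul => //; first exact: is_Ck_cont hg Vp.
    exact: is_Ck_pd hf Vp.
  exact: is_Ck_pd hg Vp.
split=> [p Vp|]; first exact: is_pd_exists (h p Vp).
apply: (is_Ck_ext (f := fun q => pd c i f q * g q + f q * pd c i g q)) => [q Vq|].
  by symmetry; apply: is_pd_pd (h q Vq).
apply: is_Ck_add; apply: IH; try exact: is_CkW.
- by case: hf => _ /(_ i)[].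
- by case: hg => _ /(_ i)[].
Qed.

Definition smooth_in f := forall k, is_Ck k c V f.

Lemma smooth_cont f p : smooth_in f -> V p -> {for p, continuous f}.
Proof. by move=> /(_ 0%N) hf; apply: is_Ck_cont hf. Qed.

Lemma smooth_is_pd f p i : smooth_in f -> V p -> is_pd f p i (pd c i f p).
Proof. by move=> /(_ 1%N) hf; apply: is_Ck_pd hf. Qed.

Lemma smooth_pd f i : smooth_in f -> smooth_in (pd c i f).
Proof. by move=> hf k; have [_ /(_ i)[]] := hf k.+1. Qed.

Lemma smooth_ext f g : (forall q, V q -> f q = g q) -> smooth_in f -> smooth_in g.
Proof. by move=> fg hf k; apply: is_Ck_ext (hf k). Qed.

Lemma smooth_cst (a : R) : smooth_in (fun=> a).
Proof. by move=> k; apply: is_Ck_cst. Qed.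

Lemma smooth_add f g : smooth_in f -> smooth_in g -> smooth_in (fun q => f q + g q).
Proof. by move=> hf hg k; apply: is_Ck_add. Qed.

Lemma smooth_mul f g : smooth_in f -> smooth_in g -> smooth_in (fun q => f q * g q).
Proof. by move=> hf hg k; apply: is_Ck_mul. Qed.

Lemma smooth_opp f : smooth_in f -> smooth_in (fun q => - f q).
Proof.
move=> hf; apply: (smooth_ext (f := fun q => -1 * f q)) => [q _|].
  by rewrite mulN1r.
by apply: smooth_mul => //; apply: smooth_cst.
Qed.

Lemma smooth_sum (I : Type) (r : seq I) (P : pred I) (F : I -> T -> R) :
  (forall j, smooth_in (F j)) -> smooth_in (fun q => \sum_(j <- r | P j) F j q).
Proof.
move=> h; elim: r => [|j r IH].
  by apply: smooth_ext (smooth_cst 0) => q _; rewrite big_nil.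
apply: (smooth_ext (f := fun q => (P j)%:R * F j q + \sum_(j <- r | P j) F j q)).
  by move=> q _; rewrite big_cons; case: (P j); rewrite ?mul1r // mul0r add0r.
by apply: smooth_add => //; apply: smooth_mul => //; apply: smooth_cst.
Qed.

Lemma smooth_prod (I : Type) (r : seq I) (F : I -> T -> R) :
  (forall j, smooth_in (F j)) -> smooth_in (fun q => \prod_(j <- r) F j q).
Proof.
move=> h; elim: r => [|j r IH].
  by apply: smooth_ext (smooth_cst 1) => q _; rewrite big_nil.
apply: (smooth_ext (f := fun q => F j q * \prod_(j <- r) F j q)).
  by move=> q _; rewrite big_cons.
exact: smooth_mul.
Qed.

Lemma smooth_det m (M : T -> 'M[R]_m) :
  (forall a b, smooth_in (fun q => M q a b)) -> smooth_in (fun q => \det (M q)).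
Proof.
move=> h; apply: smooth_sum => s; apply: smooth_mul; first exact: smooth_cst.
by apply: smooth_prod => j; apply: h.
Qed.

(* Locally constant functions enter only through their vanishing derivatives, so
   that no mean value theorem is needed. *)
Definition flat f := forall p, V p -> {for p, continuous f} /\ forall i, is_pd f p i 0.

Lemma flat_smooth f : flat f -> smooth_in f.
Proof.
move=> hf [|k]; first by split=> // p /hf[].
split=> [p /hf[] //|i]; split=> [p Vp|]; first exact: is_pd_exists ((hf p Vp).2 i).
apply: is_Ck_ext (is_Ck_cst _ 0) => q Vq.
by symmetry; apply: is_pd_pd => //; have [_] := hf q Vq.
Qed.

Lemma flat_pd f p i : flat f -> V p -> pd c i f p = 0.
Proof. by move=> hf Vp; apply: is_pd_pd => //; have [_] := hf p Vp. Qed.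

Lemma smooth_flat f : smooth_in f -> (forall p i, V p -> is_pd f p i 0) -> flat f.
Proof. by move=> hf h p Vp; split=> [|i]; [exact: smooth_cont|exact: h]. Qed.

Lemma flat_ext f g : (forall q, V q -> f q = g q) -> flat f -> flat g.
Proof.
move=> fg hf; apply: smooth_flat; first exact: smooth_ext fg (flat_smooth hf).
by move=> p i Vp; apply: is_pd_ext fg _ => //; have [_] := hf p Vp.
Qed.

Lemma flat_cst (a : R) : flat (fun=> a).
Proof. by move=> p Vp; split=> [|i]; [exact: cst_continuous|exact: is_pd_cst]. Qed.

Lemma flat_mul f g : flat f -> flat g -> flat (fun q => f q * g q).
Proof.
move=> hf hg p Vp; have [cf df] := hf p Vp; have [cg dg] := hg p Vp.
split=> [|i]; first exact: cvgM.
by have := is_pd_mul Vp cg (df i) (dg i); rewrite mul0r mulr0 addr0.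
Qed.

Lemma flat_inv f : (forall q, V q -> f q != 0) -> flat f -> flat (fun q => (f q)^-1).
Proof.
move=> f0 hf p Vp; have [cf df] := hf p Vp.
split=> [|i]; first by apply: cvgV => //; apply: f0.
have cs := comp_shift_pt i Vp cf.
have FF := pd_filter_filter p i.
have cp := @cvgM _ _ _ FF _ _ _ _ (df i) (@cvgM _ _ _ FF _ _ _ _
  (@cvgV _ _ _ FF _ _ (f0 p Vp) cs) (@cvg_cst _ (- (f p)^-1) _ _ FF)).
rewrite mul0r in cp; apply: cvg_trans cp; apply: near_eq_cvg.
have := shift_pt_in i Vp; apply: filterS => t /f0; rewrite ?fctE /pd_quotient -/(shift_pt p i t).
rewrite /shift_pt /=; move: (f0 p Vp) (t^-1) (f _) => h1 t' y h2.
by field; rewrite h1 h2.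
Qed.

(* [g(q) - g(p) = (g(q)^2 - g(p)^2) / (g(q) + g(p))] *)
Lemma flat_sqr f : (forall q, V q -> {for q, continuous f}) ->
  (forall q, V q -> f q != 0) -> flat (fun q => f q * f q) -> flat f.
Proof.
move=> cf f0 hf p Vp; split=> [|i]; first exact: cf.
have [_ df] := hf p Vp; have cs := comp_shift_pt i Vp (cf p Vp).
have nz : f p + f p != 0 by rewrite -mulr2n mulrn_eq0 negb_or f0.
have FF := pd_filter_filter p i.
have cD := @cvgD _ _ _ _ FF _ _ _ _ cs (@cvg_cst _ (f p) _ _ FF).
have cp := @cvgM _ _ _ FF _ _ _ _ (df i) (@cvgV _ _ _ FF _ _ nz cD).
rewrite mul0r in cp; apply: cvg_trans cp; apply: near_eq_cvg.
have : \forall t \near pd_filter c i p, f (shift_pt p i t) + f p != 0.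
  by have := @cvgr_neq0 _ _ _ _ FF _ _ cD nz; apply: filterS.
apply: filterS => t; rewrite ?fctE /pd_quotient /shift_pt /= => h.
by move: (t^-1) => t'; field.
Qed.

End PartialDerivatives.

(** * Symmetric matrices *)

Section SymmetricMatrices.
Variable R : realType.

(** Polarisation: a symmetric bilinear form whose quadratic form vanishes is zero. *)
Lemma sym_anisotropic m (A : 'M[R]_m) : A^T = A -> A != 0 ->
  exists v : 'rV[R]_m, v *m A *m v^T != 0.
Proof.
move=> sA; apply: contra_neqP => /forallNP h.
have {}h (v : 'rV[R]_m) : v *m A *m v^T = 0 by apply/eqP/negPn/negP; exact: h.
have h2 (u v : 'rV[R]_m) : u *m A *m v^T = 0.
  have sym : v *m A *m u^T = u *m A *m v^T.
    transitivity ((v *m A *m u^T)^T); first by apply/matrixP => i j; rewrite !ord1 [RHS]mxE.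
    by rewrite !trmx_mul trmxK sA mulmxA.
  have := h (u + v); rewrite linearD /= mulmxDr !mulmxDl !h sym add0r addr0.
  by move/eqP; rewrite -mulr2n -scaler_nat scaler_eq0 pnatr_eq0 => /eqP.
apply/matrixP => i j; have /matrixP/(_ 0 0) := h2 (delta_mx 0 i) (delta_mx 0 j).
by rewrite -rowE trmx_delta -colE !mxE.
Qed.

(** Diagonalisation by congruence in any signature: split off a non-isotropic vector, clear its row
    and column, and recurse on the Schur complement. *)
Lemma sym_diagonalizable m (A : 'M[R]_m) : A^T = A -> A \in unitmx ->
  exists P : 'M[R]_m, exists2 e : 'rV[R]_m,
    (forall i, e ord0 i = 1 \/ e ord0 i = -1) & P *m A *m P^T = diag_mx e.
Proof.
elim: m A => [|m IH] A sA uA.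
  by exists 1%:M; exists 0 => [[]//|]; apply/matrixP => -[].
have A0 : A != 0 by apply: contraTneq uA => ->; rewrite unitmxE det0 unitr0.
have [v hv] := sym_anisotropic sA A0.
have v0 : v != 0 by apply: contraNneq hv => ->; rewrite !mul0mx.
(* The first row of this invertible matrix is proportional to [v], so the corner of [B] cannot
   vanish and serves as the pivot. *)
pose Q : 'M[R]_(1 + m) := row_ebase v.
pose B : 'M[R]_(1 + m) := Q *m A *m Q^T.
have uQ : Q \in unitmx by apply: row_ebase_unit.
have sB : B^T = B by rewrite /B !trmx_mul trmxK sA mulmxA.
have uB : B \in unitmx by rewrite !unitmx_mul unitmx_tr uQ uA.
pose a := B 0 0.
have a0 : a != 0.
  apply: contraNneq hv => ha.
  have rv : \rank v = 1%N by rewrite rank_rV v0.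
  have : v = (col_ebase v *m pid_mx (\rank v) : 'rV_(1 + m)) *m Q by rewrite mulmx_ebase.
  set r := _ *m pid_mx _ => hr.
  have er : r = r 0 0 *: delta_mx 0 0.
    rewrite /r rv; apply/matrixP => i j; rewrite !ord1 !mxE !big_ord1 !mxE eqxx /=.
    case: (unliftP ord0 j) => [j' ->|->] /=; last by rewrite !mulr1.
    by rewrite !mulr0.
  rewrite hr er trmx_mul linearZ /= -!mulmxA (mulmxA A) (mulmxA Q) (mulmxA Q) -/B.
  rewrite -!scalemxAl -!scalemxAr mulmxA trmx_delta -rowE -colE.
  rewrite [col 0 _](_ : _ = 0) ?scaler0 //; apply/matrixP => i j.
  by transitivity a; [rewrite [LHS]mxE [LHS]mxE|rewrite ha mxE].
pose b : 'rV[R]_m := @ursubmx R 1 m 1 m B.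
pose D : 'M[R]_m := @drsubmx R 1 m 1 m B.
have eB : B = @block_mx R 1 m 1 m a%:M b b^T D.
  rewrite -[LHS](@submxK R 1 m 1 m); congr block_mx.
    apply/matrixP => i j; rewrite !ord1 [RHS]mxE eqxx mulr1n [LHS]mxE [LHS]mxE /a.
    by congr (fun_of_matrix B _ _); apply: val_inj.
  by rewrite /b trmx_ursub sB.
pose L : 'M[R]_(1 + m) := @block_mx R 1 m 1 m 1%:M 0 (- (a^-1 *: b^T)) 1%:M.
pose D' := D - a^-1 *: (b^T *m b).
have eL : L *m B *m L^T = @block_mx R 1 m 1 m a%:M 0 0 D'.
  rewrite eB /L tr_block_mx !mulmx_block !trmx1 !trmx0.
  rewrite !mul1mx !mul0mx !mulmx1 !addr0 !mulmx0 !addr0.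
  have e1 : - (a^-1 *: b^T) *m a%:M + b^T = 0.
    by rewrite mulNmx mul_mx_scalar scalerA divff // scale1r addNr.
  rewrite e1 mul0mx add0r; congr block_mx.
    rewrite linearN linearZ /= trmxK mulmxN mul_scalar_mx scalerA divff // scale1r addNr //.
  by rewrite mulNmx -scalemxAl addrC.
have sD' : D'^T = D'.
  rewrite /D' linearB linearZ /= trmx_mul trmxK; congr (_ - _).
  by rewrite /D trmx_drsub sB.
have uL : L \in unitmx by rewrite unitmxE det_lblock !det1 mulr1 unitr1.
have uD' : D' \in unitmx.
  have : L *m B *m L^T \in unitmx by rewrite unitmx_mul unitmx_tr uL unitmx_mul uL uB.
  by rewrite eL !unitmxE det_ublock unitrM => /andP[].
have [P' [e' he' hP']] := IH D' sD' uD'.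
(* Dividing by [s] on both sides reduces the pivot [a] to its sign. *)
pose s := Num.sqrt `|a|.
have s0 : s != 0 by rewrite gt_eqF // sqrtr_gt0 normr_gt0.
have ss : s * s = `|a| by rewrite -expr2 sqr_sqrtr.
pose S : 'M[R]_(1 + m) := @block_mx R 1 m 1 m (s^-1)%:M 0 0 P'.
pose e0 : 'rV[R]_(1 + m) := @row_mx R 1 1 m (Num.sg a)%:M e'.
have he0 (i : 'I_(1 + m)) : e0 ord0 i = 1 \/ e0 ord0 i = -1.
  rewrite /e0; case: (split_ordP i) => j ->; last by rewrite row_mxEr.
  by rewrite row_mxEl !ord1 mxE eqxx mulr1n; case: (sgrP a) a0 => // _ _; [left|right].
exists (S *m L *m Q); exists e0; first exact: he0.
rewrite /e0 !trmx_mul !mulmxA.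
have -> : S *m L *m Q *m A *m Q^T *m L^T *m S^T = S *m (L *m B *m L^T) *m S^T.
  by rewrite /B !mulmxA.
rewrite eL /S tr_block_mx !mulmx_block !(mul0mx, mulmx0, trmx0, addr0, add0r).
rewrite hP'.
transitivity (@block_mx R 1 m 1 m (diag_mx (Num.sg a)%:M) 0 0 (diag_mx e')); last first.
  exact: esym (@diag_mx_row _ m 1 _ _).
suff -> : (s^-1)%:M *m a%:M *m (s^-1)%:M^T = diag_mx (Num.sg a)%:M :> 'M[R]_1 by [].
rewrite tr_scalar_mx -!scalar_mxM; apply/matrixP => i j; rewrite !ord1 !mxE eqxx !mulr1n.
by rewrite mulrAC -invfM ss mulrC {1}[a]numEsg mulfK ?normr_eq0.
Qed.

(** If the orientation comes out wrong, changing the sign of the first covector reverses it and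
    keeps orthonormality. *)
Lemma orthonormal_coframe m (A : 'M[R]_m) (o : R) :
  (0 < m)%N -> A^T = A -> A \in unitmx -> o != 0 ->
  exists w : 'M[R]_m, (exists2 e : 'rV[R]_m,
    (forall i, e ord0 i = 1 \/ e ord0 i = -1) & w *m A *m w^T = diag_mx e) /\
    0 < o * \det w.
Proof.
case: m A => // m A _ sA uA o0; have [P [e he hP]] := sym_diagonalizable sA uA.
have dP : \det P != 0.
  apply/eqP => h; have := congr1 determinant hP.
  rewrite !det_mulmx h !mul0r det_diag => /esym/eqP.
  rewrite prodf_seq_eq0 => /hasP[i _ /=].
  by case: (he i) => ->; rewrite ?oppr_eq0 oner_eq0.
case: (ltrP 0 (o * \det P)) => hpos; first by exists P; split=> //; exists e.
pose S : 'M[R]_m.+1 := diag_mx (\row_i (-1) ^+ (i == ord0)).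
have dS : \det S = -1.
  rewrite det_diag big_ord_recl mxE eqxx big1 ?mulr1 // => i _.
  by rewrite mxE.
exists (S *m P); split; last first.
  rewrite det_mulmx dS mulN1r mulrN oppr_gt0 lt_neqAle hpos andbT.
  by rewrite mulf_neq0.
exists e => //.
have -> : S *m P *m A *m (S *m P)^T = S *m (P *m A *m P^T) *m S^T.
  by rewrite trmx_mul !mulmxA.
rewrite hP tr_diag_mx !mulmx_diag.
congr diag_mx; apply/matrixP => i j; rewrite !mxE.
by rewrite mulrAC -expr2 sqrr_sign mul1r (ord1 i).
Qed.

(** Cramer's rule: the row on the left is the first row of the adjugate of the block matrix, and the
    scale tractor will be a multiple of it. The determinant is computed through the Schur complement
    [t]. *)
Lemma adj_block_solve m (h : R) (b : 'rV[R]_m) (Z : 'M[R]_m) : Z \in unitmx ->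
  @row_mx R 1 1 m (\det Z)%:M (- (b *m \adj Z)) *m @block_mx R 1 m 1 m h%:M b b^T Z =
  @row_mx R 1 1 m (\det (@block_mx R 1 m 1 m h%:M b b^T Z))%:M 0.
Proof.
move=> uZ; have dZ : \det Z != 0 by move: uZ; rewrite unitmxE unitfE.
pose H := @block_mx R 1 m 1 m h%:M b b^T Z.
pose t := h%:M - b *m invmx Z *m b^T.
have eH : @block_mx R 1 m 1 m 1%:M (- (b *m invmx Z)) 0 1%:M *m H =
    @block_mx R 1 m 1 m t 0 b^T Z.
  rewrite /H mulmx_block !mul1mx !mul0mx !add0r; congr block_mx.
    by rewrite mulNmx.
  by rewrite mulNmx mulmxKV // subrr.
have dH : \det H = t 0 0 * \det Z.
  have := congr1 determinant eH; rewrite det_mulmx det_ublock !det1 !mul1r det_lblock => ->.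
  by rewrite det_mx11.
rewrite mul_row_block mul_scalar_mx mulNmx -/H.
have aZ : \adj Z = \det Z *: invmx Z.
  by rewrite /invmx uZ scalerA divff // scale1r.
congr row_mx.
  rewrite dH aZ -scalemxAr -scalemxAl -scalerN -scalerDr; apply/matrixP => i j.
  by rewrite !ord1 [RHS]mxE eqxx mulr1n mxE mulrC.
by rewrite mul_scalar_mx mulNmx -mulmxA mul_adj_mx mul_mx_scalar subrr.
Qed.

End SymmetricMatrices.

(** * The Thomas operator and the tractor codifferential over a chart *)

Section FieldOperators.
Variables (R : realType) (n : nat) (T : topologicalType).
Variables (c : chart R n T) (hc : is_chart c).
Variables (V : set T) (hV : open V) (dV : V `<=` chart_dom c).
Variable G : connection R n T.
Notation N := n.+1.
Notation field := (T -> cotensor R n).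
Implicit Types (F K : field) (B : seq 'I_N).
Local Notation smoothV := (smooth_in c V).
Local Notation flatV := (flat c V).
Local Notation D w := (thomas w G c).

Hypothesis smooth_trace : forall a, smoothV (fun p => ctrace G c p a).
Hypothesis smooth_conn : forall a (A B : 'I_N), smoothV (fun p => tractor_conn G c p a A B).

Definition smooth_field F : Prop := forall A, smoothV (fun p => F p A).

Definition form_field k F : Prop := (forall p, V p -> is_form k (F p)) /\ smooth_field F.

(** Components outside [V] are arbitrary, so replacing a field under a derivative goes through
    [thomas_ext] instead of rewriting. *)
Definition eq_field F K : Prop := forall p, V p -> forall A, F p A = K p A.

Lemma eq_smooth_field F K : eq_field F K -> smooth_field F -> smooth_field K.
Proof. by move=> FK sF A; apply: (smooth_ext hc hV dV _ (sF A)) => q Vq; apply: FK. Qed.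

Lemma eq_form_field k F K : eq_field F K -> form_field k F -> form_field k K.
Proof.
move=> FK [fF sF]; split; last exact: eq_smooth_field FK sF.
by move=> p Vp; rewrite (_ : K p = F p); [exact: fF|apply/funext => A; rewrite FK].
Qed.

Lemma form_field0 k : form_field k (fun _ _ => 0).
Proof. by split=> [p _|A]; [exact: form0|exact: smooth_cst]. Qed.

Lemma form_field_mul k (g : T -> R) F : smoothV g -> form_field k F ->
  form_field k (fun p A => g p * F p A).
Proof.
move=> sg [fF sF]; split=> [p Vp|A]; first by apply: form_scale; exact: fF.
exact: (smooth_mul hc hV dV).
Qed.

Definition iota_field F : field := fun p => iota_X (F p).

Definition thomas0 (w : R) (g : T -> R) p (A : 'I_N) : R :=
  D w (fun q B => if B is [::] then g q else 0) p A [::].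

Lemma thomas0E w g p A : thomas0 w g p A =
  if unlift ord0 A is Some a then pd c a g p + w / N%:R * ctrace G c p a * g p else w * g p.
Proof. by rewrite /thomas0 /thomas /nabla_cotractor; case: unlift => // a; rewrite big_ord0 subr0. Qed.

Lemma thomas0_smooth w g A : smoothV g -> smoothV (fun p => thomas0 w g p A).
Proof.
move=> sg; apply: (smooth_ext hc hV dV (f := fun p => if unlift ord0 A is Some a
  then pd c a g p + w / N%:R * ctrace G c p a * g p else w * g p)) => [p _|].
  by rewrite thomas0E.
case: unlift => [a|]; last by apply: (smooth_mul hc hV dV) => //; exact: smooth_cst.
apply: (smooth_add hc hV dV); first exact: smooth_pd.
by apply: (smooth_mul hc hV dV) => //; apply: (smooth_mul hc hV dV) => //; exact: smooth_cst.
Qed.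

(** With [thomas_mul] this lets factors of weight 0 and zero derivative pass through D. *)
Lemma thomas0_flat g p A : flatV g -> V p -> thomas0 0 g p A = 0.
Proof.
move=> fg Vp; rewrite thomas0E; case: unlift => [a|]; last by rewrite mul0r.
by rewrite (flat_pd hc dV) // !mul0r addr0.
Qed.

Lemma thomas_ext w F K p a B : smooth_field F -> eq_field F K -> V p ->
  D w F p a B = D w K p a B.
Proof.
move=> sF FK Vp; rewrite /thomas; case: unlift => [b|]; last by rewrite FK.
rewrite /nabla_cotractor FK //; congr (_ + _ - _); last first.
  by apply: eq_bigr => i _; apply: eq_bigr => C _; rewrite FK.
symmetry; apply: (is_pd_pd hc dV Vp).
apply: (is_pd_ext hc hV dV Vp _ (smooth_is_pd (sF B) Vp)) => q Vq; exact: FK.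
Qed.

Lemma thomas_add w F K p a B : smooth_field F -> smooth_field K -> V p ->
  D w (fun q A => F q A + K q A) p a B = D w F p a B + D w K p a B.
Proof.
move=> sF sK Vp; rewrite /thomas; case: unlift => [b|]; last by rewrite mulrDr.
rewrite /nabla_cotractor.
rewrite (is_pd_pd hc dV Vp (is_pd_add (smooth_is_pd (sF B) Vp) (smooth_is_pd (sK B) Vp))).
have -> : \sum_(i < size B) \sum_C tractor_conn G c p b C (nth ord0 B i) *
      (F p (set_nth ord0 B i C) + K p (set_nth ord0 B i C)) =
  \sum_(i < size B) \sum_C tractor_conn G c p b C (nth ord0 B i) * F p (set_nth ord0 B i C) +
  \sum_(i < size B) \sum_C tractor_conn G c p b C (nth ord0 B i) * K p (set_nth ord0 B i C).
  rewrite -big_split; apply: eq_bigr => i _; rewrite -big_split; apply: eq_bigr => C _.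
  by rewrite mulrDr.
by ring.
Qed.

Lemma thomas_mul v w g F p a B : smoothV g -> smooth_field F -> V p ->
  D (v + w) (fun q A => g q * F q A) p a B =
  thomas0 v g p a * F p B + g p * D w F p a B.
Proof.
move=> sg sF Vp; rewrite thomas0E /thomas; case: unlift => [b|]; last by ring.
rewrite /nabla_cotractor.
rewrite (is_pd_pd hc dV Vp (is_pd_mul hc dV Vp (smooth_cont (sF B) Vp)
  (smooth_is_pd sg Vp) (smooth_is_pd (sF B) Vp))).
have -> : \sum_(i < size B) \sum_C tractor_conn G c p b C (nth ord0 B i) *
      (g p * F p (set_nth ord0 B i C)) =
  g p * \sum_(i < size B) \sum_C
     tractor_conn G c p b C (nth ord0 B i) * F p (set_nth ord0 B i C).
  rewrite mulr_sumr; apply: eq_bigr => i _; rewrite mulr_sumr; apply: eq_bigr => C _.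
  by rewrite mulrCA.
by rewrite !mulrDl; ring.
Qed.

Lemma thomas_smooth w F a : smooth_field F -> smooth_field (fun p => D w F p a).
Proof.
move=> sF B; rewrite /thomas; case: unlift => [b|].
  apply: (smooth_add hc hV dV); last first.
    apply: (smooth_opp hc hV dV); apply: (smooth_sum hc hV dV) => i.
    by apply: (smooth_sum hc hV dV) => C; apply: (smooth_mul hc hV dV).
  apply: (smooth_add hc hV dV); first exact: smooth_pd.
  apply: (smooth_mul hc hV dV) => //; apply: (smooth_mul hc hV dV) => //.
  exact: smooth_cst.
by apply: (smooth_mul hc hV dV) => //; exact: smooth_cst.
Qed.

Lemma set_nth_prm k (s : 'S_k) (A : seq 'I_N) (i : 'I_k) x : size A = k ->
  set_nth ord0 (prm s A) i x = prm s (set_nth ord0 A (s i) x).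
Proof.
move=> sA; apply: (@eq_nth_ord _ k); rewrite ?size_prm //.
  by rewrite size_set_nth size_prm; apply/maxn_idPr.
move=> j; rewrite nth_prm !nth_set_nth /= nth_prm.
by rewrite !val_eqE (inj_eq perm_inj).
Qed.

Lemma thomas_form k w F p a : form_field k F -> V p -> is_form k (D w F p a).
Proof.
move=> [fF sF] Vp; apply/is_formP; split=> [A sA|A s sA].
  rewrite /thomas; case: unlift => [b|]; last by rewrite (form_size (fF _ Vp)) // mulr0.
  rewrite /nabla_cotractor (form_size (fF _ Vp)) // mulr0 addr0.
  rewrite (is_pd_pd hc dV Vp (l := 0)); last first.
    apply: (is_pd_ext hc hV dV Vp _ (is_pd_cst _ _ _ 0)) => q Vq.
    by rewrite (form_size (fF _ Vq)).
  rewrite sub0r big1 ?oppr0 // => i _; rewrite big1 // => C _.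
  rewrite (form_size (fF _ Vp)) ?mulr0 // size_set_nth.
  by rewrite (maxn_idPr _) // ltn_ord.
rewrite /thomas; case: unlift => [b|]; last by rewrite (form_prm _ (fF _ Vp)) // mulrCA.
rewrite /nabla_cotractor size_prm sA (form_prm _ (fF _ Vp)) //.
rewrite (is_pd_pd hc dV Vp (l := (-1) ^+ s * pd c b (fun q => F q A) p)); last first.
  apply: (is_pd_ext hc hV dV Vp _ (is_pd_scale
    (smooth_is_pd (sF A) Vp))) => q Vq.
  by rewrite (form_prm _ (fF _ Vq)).
have -> : \sum_(i < k) \sum_C tractor_conn G c p b C (nth ord0 (prm s A) i) *
      F p (set_nth ord0 (prm s A) i C) =
    (-1) ^+ s * \sum_(i < k) \sum_C tractor_conn G c p b C (nth ord0 A i) *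
      F p (set_nth ord0 A i C).
  rewrite [in RHS](reindex_inj (@perm_inj _ s)) mulr_sumr; apply: eq_bigr => i _.
  rewrite mulr_sumr; apply: eq_bigr => C _; rewrite nth_prm set_nth_prm //.
  rewrite (form_prm _ (fF _ Vp)) 1?mulrCA // size_set_nth sA.
  by rewrite (maxn_idPr _) // ltn_ord.
by rewrite [w / _ * _ * _]mulrCA -mulrDr -mulrBr.
Qed.

(** Matrix form of nabla_a X = W_a; the trace term stems from trivialising the weight -1 by the
    coordinate scale. *)
Lemma tractor_conn_col0 p a (C : 'I_N) : tractor_conn G c p a C ord0 =
  - (ctrace G c p a / N%:R) * (C == ord0)%:R + (C == lift ord0 a)%:R.
Proof.
have e0 : ord0 = lshift n (ord0 : 'I_1) :> 'I_(1 + n) by apply: val_inj.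
have el b : lift ord0 b = rshift 1 b :> 'I_(1 + n) by apply: val_inj.
case: (unliftP ord0 C) => [b|] ->.
  apply: etrans (congr2 (fun i j : 'I_(1 + n) => tractor_conn G c p a i j) (el b) e0) _.
  apply: etrans (@block_mxEdl R 1 n 1 n _ _ _ _ _ _) _.
  by rewrite mxE eqxx andbT mulr0 add0r (inj_eq lift_inj).
apply: etrans (congr2 (fun i j : 'I_(1 + n) => tractor_conn G c p a i j) e0 e0) _.
apply: etrans (@block_mxEul R 1 n 1 n _ _ _ _ _ _) _.
by rewrite mxE eqxx mulr1n mulr1 addr0.
Qed.

(* Leibniz rule for [D_A (X^C F_{C B})], with [D_A X^C = delta_A^C]. *)
Lemma thomas_iota w F p a B :
  D (w + 1) (iota_field F) p a B = iota_X (D w F p a) B + F p (a :: B).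
Proof.
rewrite /iota_field /iota_X /thomas; case: unliftP => [b|] ->; last first.
  by rewrite mulrDl mul1r.
rewrite /nabla_cotractor /= big_ord_recl /=.
have sum_delta (x : 'I_N) (f : 'I_N -> R) : \sum_C (C == x)%:R * f C = f x.
  rewrite (bigD1 x) //= eqxx mul1r big1 ?addr0 // => C hC.
  by rewrite (negbTE hC) mul0r.
have -> : \sum_C tractor_conn G c p b C ord0 * F p (C :: B) =
    - (ctrace G c p b / N%:R) * F p (ord0 :: B) + F p (lift ord0 b :: B).
  rewrite -(sum_delta ord0 (fun C => F p (C :: B))) -[X in _ + X](sum_delta (lift ord0 b)
    (fun C => F p (C :: B))) mulr_sumr -big_split; apply: eq_bigr => C _ /=.
  by rewrite tractor_conn_col0; ring.
by ring.
Qed.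

Definition ext_field k (w : R) F : field := fun p => alt1 k (D w F p).

Lemma smooth_alt1 k (K : T -> 'I_N -> cotensor R n) :
  (forall a B, smoothV (fun p => K p a B)) -> smooth_field (fun p => alt1 k (K p)).
Proof.
move=> sK A; apply: (smooth_mul hc hV dV); first exact: smooth_cst.
have [sA|sA] := eqVneq (size A) k.+1; last first.
  apply: (smooth_ext hc hV dV _ (@smooth_cst _ _ _ _ hc _ hV dV 0)) => q _.
  by rewrite antisym_size.
apply: (smooth_ext hc hV dV (f := fun p => (k.+1`!%:R)^-1 * \sum_(s : 'S_k.+1)
    (-1) ^+ s * (if prm s A is b :: B' then K p b B' else 0))) => [q _|].
  by rewrite antisymE.
apply: (smooth_mul hc hV dV); first exact: smooth_cst.
apply: (smooth_sum hc hV dV) => s; apply: (smooth_mul hc hV dV); first exact: smooth_cst.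
by case: (prm s A) => [|b B] //; exact: smooth_cst.
Qed.

Lemma form_field_alt1 k (K : T -> 'I_N -> cotensor R n) :
  (forall a B, smoothV (fun p => K p a B)) -> form_field k.+1 (fun p => alt1 k (K p)).
Proof. by move=> sK; split=> [p _|]; [exact: alt1_form|exact: smooth_alt1]. Qed.

Lemma form_field_ext k w F : smooth_field F -> form_field k.+1 (ext_field k w F).
Proof. by move=> sF; apply: form_field_alt1 => a; apply: thomas_smooth. Qed.

Lemma ext_field_eq k w F K : smooth_field F -> eq_field F K ->
  eq_field (ext_field k w F) (ext_field k w K).
Proof. by move=> sF FK p Vp A; apply: eq_alt1 => b B _; apply: thomas_ext. Qed.

Lemma ext_field0 k w : eq_field (ext_field k w (fun _ _ => 0)) (fun _ _ => 0).
Proof.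
move=> p Vp A; rewrite /ext_field -[RHS](alt1_0 R k A); apply: eq_alt1 => b B _.
rewrite /thomas; case: unlift => [a|]; last by rewrite mulr0.
rewrite /nabla_cotractor (is_pd_pd hc dV Vp (is_pd_cst _ _ _ 0)) mulr0 add0r sub0r.
by rewrite big1 ?oppr0 // => i _; rewrite big1 // => C _; rewrite mulr0.
Qed.

Lemma ext_field_add k w F K : smooth_field F -> smooth_field K ->
  eq_field (ext_field k w (fun p A => F p A + K p A))
           (fun p A => ext_field k w F p A + ext_field k w K p A).
Proof.
move=> sF sK p Vp A; rewrite /ext_field -alt1_add.
by apply: eq_alt1 => b B _; apply: thomas_add.
Qed.

Lemma ext_field_mul k v w g F : smoothV g -> smooth_field F ->
  eq_field (ext_field k (v + w) (fun p A => g p * F p A))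
    (fun p A => alt1 k (fun b B => thomas0 v g p b * F p B) A + g p * ext_field k w F p A).
Proof.
move=> sg sF p Vp A; rewrite /ext_field -alt1_scale -alt1_add.
by apply: eq_alt1 => b B _; apply: thomas_mul.
Qed.

Lemma ext_field_flat k w g F : flatV g -> smooth_field F ->
  eq_field (ext_field k w (fun p A => g p * F p A)) (fun p A => g p * ext_field k w F p A).
Proof.
move=> fg sF p Vp A; have := ext_field_mul k 0 w (flat_smooth hc hV dV fg) sF Vp A.
rewrite add0r => ->; rewrite -[RHS]add0r; congr (_ + _).
rewrite -[RHS](alt1_0 R k A); apply: eq_alt1 => b B _.
by rewrite thomas0_flat // mul0r.
Qed.

(** The weight is the component of [D F] along Y, left over by the antiderivation rule; the degree
    comes from the Leibniz terms of X. *)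
Lemma cartan k w F : form_field k F ->
  eq_field (fun p A => ext_field (k - 1) (w + 1) (iota_field F) p A +
                       iota_field (ext_field k w F) p A)
           (fun p A => (w + k%:R) * F p A).
Proof.
move=> hF p Vp A; rewrite /ext_field /iota_field {2}/iota_X.
rewrite (cartan_alt1 _ (hF.1 p Vp) (fun b => thomas_form w b hF Vp)).
  by rewrite /thomas unlift_none mulrDl.
by move=> b B; rewrite -thomas_iota.
Qed.

(** * Star, codifferential and Laplacian for a metric H and a scale with H (D sig) = lam X *)

Variables (H : T -> 'M[R]_N) (vol lam sig : T -> R).
Hypothesis smooth_H : forall a b, smoothV (fun p => H p a b).
Hypothesis sym_H : forall p, V p -> (H p)^T = H p.
Hypothesis det_H : forall p, V p -> \det (H p) != 0.
Hypothesis flat_vol : flatV vol.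
Hypothesis vol_det : forall p, V p -> vol p ^+ 2 * \det (H p) = Num.sg (\det (H p)).
Hypothesis flat_lam : flatV lam.
Hypothesis smooth_sig : smoothV sig.
Hypothesis metric_scale : forall p, V p -> forall a,
  \sum_b H p a b * thomas0 2 sig p b = lam p * (a == ord0)%:R.

Definition star_field k F : field := fun p => star_form (H p) (vol p) k (F p).

Lemma smooth_star k F : smooth_field F -> smooth_field (star_field k F).
Proof.
move=> sF B; have sv := flat_smooth hc hV dV flat_vol.
apply: (smooth_mul hc hV dV); first by apply: (smooth_mul hc hV dV) => //; exact: smooth_cst.
apply: (smooth_sum hc hV dV) => A; apply: (smooth_sum hc hV dV) => C.
apply: (smooth_mul hc hV dV); last exact: smooth_cst.
apply: (smooth_mul hc hV dV) => //.
exact: (smooth_prod hc hV dV).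
Qed.

Lemma form_field_star k l F : (k + l = N)%N -> smooth_field F -> form_field l (star_field k F).
Proof. by move=> kl sF; split=> [p _|]; [exact: star_form_form|exact: smooth_star]. Qed.

Lemma star_field_eq k F K : eq_field F K -> eq_field (star_field k F) (star_field k K).
Proof. by move=> FK p Vp A; apply: eq_star_form => B _; apply: FK. Qed.

Lemma star_field0 k : eq_field (star_field k (fun _ _ => 0)) (fun _ _ => 0).
Proof.
move=> p _ A; rewrite -[RHS](mul0r (star_field k (fun _ _ => 0) p A)) /star_field.
by rewrite -star_form_scale; apply: eq_star_form => B _; rewrite mul0r.
Qed.

Lemma star_field_gt k F : (N < k)%N -> eq_field (star_field k F) (fun _ _ => 0).
Proof. by move=> kN p _ A; apply: star_form_gt. Qed.

Lemma sqr_sg_det p : V p -> Num.sg (\det (H p)) * Num.sg (\det (H p)) = 1.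
Proof. by move=> Vp; rewrite -expr2 sqr_sg det_H. Qed.

Lemma smooth_sg_det : smoothV (fun p => Num.sg (\det (H p))).
Proof.
have sv := flat_smooth hc hV dV flat_vol.
apply: (smooth_ext hc hV dV (f := fun p => vol p * vol p * \det (H p))) => [p Vp|].
  by rewrite -expr2 vol_det.
apply: (smooth_mul hc hV dV); first exact: (smooth_mul hc hV dV).
exact: (smooth_det hc hV dV).
Qed.

(* The sign of det H is the product s epsilon of the signs of det zeta and f. *)
Definition codiff_field k (w : R) F : field := fun p A =>
  (-1) ^+ (N * (k - 1)).+1 * Num.sg (\det (H p)) *
  star_field (N - k).+1 (ext_field (N - k) w (star_field k F)) p A.

(** The outer star acts in degree n+2, where it vanishes. *)
Lemma codiff_field_deg0 w F : eq_field (codiff_field 0 w F) (fun _ _ => 0).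
Proof. by move=> p Vp A; rewrite /codiff_field subn0 star_field_gt // mulr0. Qed.

Lemma codiff_field_eq k w F K : smooth_field F -> eq_field F K ->
  eq_field (codiff_field k w F) (codiff_field k w K).
Proof.
move=> sF FK p Vp A; congr (_ * _); apply: star_field_eq => //.
by apply: ext_field_eq; [exact: smooth_star|exact: star_field_eq].
Qed.

Lemma codiff_field_gt k w F : (N < k)%N -> eq_field (codiff_field k w F) (fun _ _ => 0).
Proof.
move=> kN p Vp A; rewrite /codiff_field.
rewrite (@star_field_eq _ _ (fun _ _ => 0)) //; first by rewrite star_field0 // mulr0.
move=> q Vq B; rewrite -(ext_field0 (N - k) w Vq B); symmetry.
apply: ext_field_eq => // [|r Vr C]; first exact: (form_field0 0).2.
by rewrite star_field_gt.
Qed.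

Lemma form_field_codiff k w F : smooth_field F -> form_field (k - 1) (codiff_field k w F).
Proof.
move=> sF; have [kN|kN] := leqP k N; last first.
  apply: eq_form_field (form_field0 _) => p Vp A; by rewrite codiff_field_gt.
case: k kN => [|k] kN.
  apply: eq_form_field (form_field0 _) => p Vp A; by rewrite codiff_field_deg0.
rewrite /codiff_field; apply: form_field_mul.
  by apply: (smooth_mul hc hV dV); [exact: smooth_cst|exact: smooth_sg_det].
apply: form_field_star; first by lia.
by apply: (form_field_ext _ _ _).2; exact: smooth_star.
Qed.

Lemma codiff_field_add k w F K : smooth_field F -> smooth_field K ->
  eq_field (codiff_field k w (fun p A => F p A + K p A))
           (fun p A => codiff_field k w F p A + codiff_field k w K p A).
Proof.
move=> sF sK p Vp A; rewrite /codiff_field -mulrDr; congr (_ * _).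
rewrite /star_field -star_form_add; apply: eq_star_form => B _.
rewrite -ext_field_add //; try exact: smooth_star.
apply: ext_field_eq => // [|q Vq C]; last by rewrite /star_field star_form_add.
apply: smooth_star => C; exact: (smooth_add hc hV dV).
Qed.

Lemma codiff_field_flat k w g F : flatV g -> smooth_field F ->
  eq_field (codiff_field k w (fun p A => g p * F p A)) (fun p A => g p * codiff_field k w F p A).
Proof.
move=> fg sF p Vp A; rewrite /codiff_field [RHS]mulrCA; congr (_ * _).
rewrite /star_field -star_form_scale; apply: eq_star_form => B _.
rewrite -(ext_field_flat _ _ fg (smooth_star k sF)) //.
apply: ext_field_eq => // [|q Vq C]; last by rewrite /star_field star_form_scale.
apply: smooth_star => C; apply: (smooth_mul hc hV dV) => //.
exact: (flat_smooth hc hV dV).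
Qed.

Definition wedge_scale k F : field := fun p => alt1 k (fun b B => thomas0 2 sig p b * F p B).

Lemma form_field_wedge_scale k F : smooth_field F -> form_field k.+1 (wedge_scale k F).
Proof.
move=> sF; apply: form_field_alt1 => b B; apply: (smooth_mul hc hV dV) => //.
exact: thomas0_smooth.
Qed.

(** The factors are the sign in the codifferential of forms of degree [k = j.+1] and the two signs
    in [star_wedge_star], with n + 1 = k + m. *)
Lemma sign_codiff j m : (-1) ^+ ((j.+1 + m) * j).+1 * ((-1) ^+ m * (-1) ^+ (j.+1 * m)) = -1 :> R.
Proof.
rewrite -!exprD -signr_odd !(oddD, oddS, oddM) /=.
by case: (odd j); case: (odd m).
Qed.

(** Between the two stars the Leibniz rule adds the wedge of I with the star of [F], which
    [star_wedge_star] returns as an interior product. The sgn(det H) from [vol_det] cancels the one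
    in the codifferential. *)
Lemma codiff_mul_scale k w F : form_field k F ->
  eq_field (codiff_field k (2 + w) (fun p A => sig p * F p A))
    (fun p A => sig p * codiff_field k w F p A - lam p * iota_X (F p) A).
Proof.
move=> hF p Vp A; have fF := hF.1 p Vp; have [kN|kN] := leqP k N; last first.
  by rewrite !codiff_field_gt // /iota_X (form_gt _ fF kN) !mulr0 subrr.
case: k => [|j] in hF fF kN *.
  by rewrite !codiff_field_deg0 // /iota_X (form_size fF) // !mulr0 subrr.
have sF := hF.2; have sS := smooth_star j.+1 sF.
have hext : eq_field (ext_field (N - j.+1) (2 + w) (star_field j.+1 (fun p A => sig p * F p A)))
    (fun q B => alt1 (N - j.+1) (fun b C => thomas0 2 sig q b * star_field j.+1 F q C) B +
       sig q * ext_field (N - j.+1) w (star_field j.+1 F) q B).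
  move=> q Vq B; rewrite -ext_field_mul //; apply: ext_field_eq => // [|r Vr C].
    by apply: smooth_star => C; apply: (smooth_mul hc hV dV).
  by rewrite /star_field star_form_scale.
rewrite /codiff_field (star_field_eq _ hext) // {1}/star_field star_form_add star_form_scale.
rewrite (star_wedge_star (I := thomas0 2 sig p) _ (sym_H Vp) (metric_scale Vp)) //.
rewrite vol_det // -/(iota_X (F p) A) -/(star_field (N - j.+1).+1 _ p A).
have := sign_codiff j (N - j.+1); rewrite subn1 /= subnKC // => h1.
have := sqr_sg_det Vp => h2; move: h1 h2; move: (star_field _ _ p A) (Num.sg _) (iota_X _ A).
move: ((-1) ^+ _) ((-1) ^+ _) ((-1) ^+ _) => s3 s2 s1 X e Y h1 h2.
transitivity (sig p * (s1 * e * X) + (s1 * (s2 * s3)) * (e * e) * lam p * Y); first by ring.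
by rewrite h1 h2 mulr1 mulN1r mulNr.
Qed.

Lemma codiff_wedge_scale k w F : form_field k F -> (k <= N)%N ->
  eq_field (fun p A => codiff_field k.+1 (w + 1) (wedge_scale k F) p A +
      alt1 (k - 1) (fun b B => thomas0 2 sig p b * codiff_field k w F p B) A)
    (fun p A => - (lam p * (w + (N - k)%:R) * F p A)).
Proof.
move=> hF kN p Vp A; have fF := hF.1 p Vp; have sF := hF.2.
pose m := (N - k)%N; pose S := star_field k F; pose Q := ext_field m w S.
have km : (k + m = N)%N by rewrite subnKC.
have hS : form_field m S by apply: form_field_star.
have hQ : form_field m.+1 Q := form_field_ext m w hS.2.
pose Y := ext_field (m - 1) (w + 1) (iota_field S).
have em : (N - k.+1 = m - 1)%N by rewrite subn1 subnS.
have sI : smooth_field (iota_field S) by move=> B; apply: hS.2.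
(* The star turns the wedge with I into interior multiplication; the resulting factor has zero
   derivative and leaves D. *)
have ext1 : eq_field (ext_field (m - 1) (w + 1) (star_field k.+1 (wedge_scale k F)))
    (fun q B => (-1) ^+ k * lam q * Y q B).
  have fg : flatV (fun q => (-1) ^+ k * lam q).
    by apply: (flat_mul hc dV) => //; exact: flat_cst.
  move=> q Vq B; rewrite /Y -(ext_field_flat _ _ fg sI) //.
  apply: ext_field_eq => // [|r Vr C].
    by apply: smooth_star; apply: (form_field_wedge_scale _ sF).2.
  exact: (star_form_wedge _ _ _ _ (metric_scale Vr)).
(* The degrees differ only for [m = 0], where [Y] vanishes because 0-forms have no interior
   product. *)
have starY : star_field (m - 1).+1 Y p A = star_field m Y p A.
  case: (posnP m) => [m0|mpos]; last by rewrite subn1 prednK.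
  have Y0 : eq_field Y (fun _ _ => 0).
    move=> q Vq B; rewrite /Y -(ext_field0 (m - 1) (w + 1) Vq B).
    apply: ext_field_eq => // r Vr C; rewrite /iota_field /iota_X.
    by rewrite (form_size (hS.1 r Vr)) // m0.
  by rewrite !(star_field_eq _ Y0) // !star_field0.
pose X := star_field m (iota_field Q) p A.
(* Cartan formula for [S], followed by the double star. The extra term [X] is to cancel against the
   second summand of the claim. *)
have starS : star_field m Y p A =
    (w + m%:R) * (Num.sg (\det (H p)) * (-1) ^+ (k * m) * F p A) - X.
  apply/eqP; rewrite eq_sym subr_eq eq_sym; apply/eqP.
  rewrite /X /star_field -star_form_add.
  rewrite (@eq_star_form _ _ _ _ _ _ (fun B => (w + m%:R) * S p B)); last first.
    by move=> B _; apply: (cartan w hS).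
  by rewrite star_form_scale /S /star_field star_form_star_form ?vol_det //; exact: sym_H.
have signk : (-1) ^+ (N * k).+1 * ((-1) ^+ k * (-1) ^+ (k * m)) = -1 :> R.
  rewrite -!exprD -signr_odd -km !(oddD, oddS, oddM) /=.
  by case: (odd k); case: (odd m).
(* By [star_iota_X] the wedge of I with the star of [Q] is a multiple of [X]. For [k = 0] both sides
   vanish, [Q] having degree n+2. *)
have altQ : (-1) ^+ (N * (k - 1)).+1 * alt1 (k - 1) (fun b B => thomas0 2 sig p b *
     star_field m.+1 Q p B) A = (-1) ^+ (N * k).+1 * (-1) ^+ k * (lam p * X).
  case: k @m @S @Q hF fF kN km hS hQ @Y em sI ext1 starY @X starS signk =>
    [|j] m S Q hF fF kN km hS hQ Y em sI ext1 starY X starS signk.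
    have -> : X = 0.
      rewrite /X -(star_field0 m Vp A); apply: star_field_eq => // q Vq B.
      by apply: (form_gt _ (hQ.1 q Vq)); rewrite /m subn0.
    rewrite !mulr0 -[RHS](mulr0 ((-1) ^+ (N * (0 - 1)).+1)); congr (_ * _).
    rewrite -[RHS](alt1_0 R 0 A); apply: eq_alt1 => b B _.
    by rewrite star_field_gt ?mulr0 // /m subn0.
  have mN : (m < N)%N by rewrite /m; lia.
  have vd0 : vol p ^+ 2 * \det (H p) != 0 by rewrite vol_det // sgr_eq0 det_H.
  rewrite (star_iota_X (sym_H Vp) (metric_scale Vp) _ mN (hQ.1 p Vp) vd0).
  have -> : (N - m.+1 = j.+1 - 1)%N by rewrite /m; lia.
  rewrite mulrA; congr (_ * _); rewrite -!exprD -[LHS]signr_odd -[RHS]signr_odd.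
  rewrite -km subn1 /= !(oddD, oddS, oddM) /=.
  by case: (odd j); case: (odd m).
rewrite {1}/codiff_field em (star_field_eq _ ext1) // {1}/star_field star_form_scale.
rewrite -/(star_field (m - 1).+1 Y p A) starY starS subSS subn0.
rewrite (eq_alt1 (L := fun b B => ((-1) ^+ (N * (k - 1)).+1 * Num.sg (\det (H p))) *
  (thomas0 2 sig p b * star_field m.+1 Q p B))) => [|b B _]; last first.
  by rewrite /codiff_field mulrCA.
rewrite alt1_scale [_ * Num.sg _ * alt1 _ _ _]mulrAC altQ -/m.
have := sqr_sg_det Vp => h2; move: signk h2; move: (Num.sg _) (X).
move: ((-1) ^+ _) ((-1) ^+ _) ((-1) ^+ _) => s3 s2 s1 e X' h1 h2.
transitivity (s1 * (s2 * s3) * (e * e) * (lam p * (w + m%:R) * F p A)); first by ring.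
by rewrite h1 h2 mulr1 mulN1r.
Qed.

Definition laplace_field k (w : R) F : field := fun p A =>
  ext_field (k - 1) (w - 1) (codiff_field k w F) p A +
  codiff_field k.+1 (w - 1) (ext_field k w F) p A.

Lemma laplace_field_mul_scale k w F : form_field k F ->
  eq_field (laplace_field k (2 + w) (fun p A => sig p * F p A))
    (fun p A => sig p * laplace_field k w F p A - lam p * (2 * w + N%:R) * F p A).
Proof.
move=> hF p Vp A; have sF := hF.2; rewrite /laplace_field.
have [kN|kN] := leqP k N; last first.
  have c0 w1 w2 K : ext_field (k - 1) w1 (codiff_field k w2 K) p A = 0.
    rewrite -(ext_field0 (k - 1) w1 Vp A); symmetry.
    by apply: ext_field_eq => // [|q Vq B]; [exact: (form_field0 0).2|rewrite codiff_field_gt].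
  rewrite !(codiff_field_gt _ _ (leqW kN)) // !addr0.
  by rewrite !c0 (form_gt _ (hF.1 p Vp) kN) !mulr0 subrr.
have sC := (form_field_codiff k w sF).2.
have sE := (form_field_ext k w sF).2.
have sW := (form_field_wedge_scale k sF).2.
have sI : smooth_field (iota_field F) by move=> B; apply: sF.
have sSC : smooth_field (fun q B => sig q * codiff_field k w F q B).
  by move=> B; apply: (smooth_mul hc hV dV).
have sSE : smooth_field (fun q B => sig q * ext_field k w F q B).
  by move=> B; apply: (smooth_mul hc hV dV).
(* The interior term is written as a summand with factor [-1 * lam], so that [ext_field_add] and
   [ext_field_flat] apply. *)
have fl : flatV (fun q => -1 * lam q).
  by apply: (flat_mul hc dV) => //; exact: flat_cst.
have sLI : smooth_field (fun q B => (-1 * lam q) * iota_field F q B).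
  by move=> B; apply: (smooth_mul hc hV dV) => //; exact: (flat_smooth hc hV dV).
have e1 : ext_field (k - 1) (2 + w - 1) (codiff_field k (2 + w) (fun q B => sig q * F q B)) p A =
    alt1 (k - 1) (fun b B => thomas0 2 sig p b * codiff_field k w F p B) A +
    sig p * ext_field (k - 1) (w - 1) (codiff_field k w F) p A -
    lam p * ext_field (k - 1) (w + 1) (iota_field F) p A.
  rewrite (@ext_field_eq _ _ _ (fun q B => sig q * codiff_field k w F q B +
     (-1 * lam q) * iota_field F q B)) //; first last.
  - by move=> q Vq B; rewrite codiff_mul_scale // mulN1r mulNr.
  - by apply: (form_field_codiff _ _ _).2 => B; apply: (smooth_mul hc hV dV).
  rewrite ext_field_add // (ext_field_flat _ _ fl sI) // mulN1r mulNr.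
  have ew : 2 + w - 1 = w + 1 by ring.
  congr (_ - _); last by rewrite ew.
  by have -> : 2 + w - 1 = 2 + (w - 1) by [ring]; rewrite ext_field_mul.
have e2 : codiff_field k.+1 (2 + w - 1) (ext_field k (2 + w) (fun q B => sig q * F q B)) p A =
    codiff_field k.+1 (w + 1) (wedge_scale k F) p A +
    (sig p * codiff_field k.+1 (w - 1) (ext_field k w F) p A -
     lam p * iota_X (ext_field k w F p) A).
  rewrite (@codiff_field_eq _ _ _ (fun q B => wedge_scale k F q B +
     sig q * ext_field k w F q B)) //; first last.
  - by move=> q Vq B; rewrite ext_field_mul.
  - by apply: (form_field_ext _ _ _).2 => B; apply: (smooth_mul hc hV dV).
  rewrite codiff_field_add //; congr (_ + _).
    by congr codiff_field; ring.
  have -> : 2 + w - 1 = 2 + (w - 1) by ring.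
  by rewrite codiff_mul_scale //; exact: form_field_ext.
rewrite e1 e2.
have := cartan w hF Vp A; have := codiff_wedge_scale w hF kN Vp A.
rewrite /= -/(iota_field _ p A) natrB //.
move: (ext_field _ _ (iota_field F) p A) (iota_field (ext_field k w F) p A) => a1 a2.
move: (codiff_field _ _ (wedge_scale k F) p A) (alt1 _ _ A) => a3 a4.
move: (ext_field _ _ (codiff_field k w F) p A) (codiff_field _ _ (ext_field k w F) p A) => a5 a6.
move=> h1 h2; transitivity (sig p * (a5 + a6) + (a3 + a4) - lam p * (a1 + a2)); first by ring.
by rewrite h1 h2; ring.
Qed.

Lemma laplace_field_scale k w (a : R) F : form_field k F ->
  eq_field (laplace_field k w (fun p A => a * F p A)) (fun p A => a * laplace_field k w F p A).
Proof.
move=> hF p Vp A; have sF := hF.2; rewrite /laplace_field mulrDr.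
have fa : flatV (fun=> a) by exact: flat_cst.
have saF : smooth_field (fun q B => a * F q B).
  by move=> B; apply: (smooth_mul hc hV dV) => //; exact: smooth_cst.
congr (_ + _).
  rewrite -(ext_field_flat _ _ fa (form_field_codiff k w sF).2) //.
  apply: ext_field_eq => // [|q Vq B]; first exact: (form_field_codiff _ _ _).2.
  by rewrite (codiff_field_flat _ _ fa).
rewrite -(codiff_field_flat _ _ fa (form_field_ext k w sF).2) //.
apply: codiff_field_eq => // [|q Vq B]; first exact: (form_field_ext _ _ _).2.
by rewrite (ext_field_flat _ _ fa).
Qed.

End FieldOperators.

(** * The metric tractor and the scale tractor over the interior *)

Section InteriorGeometry.
Variables (R : realType) (n : nat) (T : topologicalType).

Lemma is_Ck_sub (c : chart R n T) k (U U' : set T) f :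
  U `<=` U' -> is_Ck k c U' f -> is_Ck k c U f.
Proof.
move=> UU'; elim: k f => [|k IH] f [cf hf]; first by split=> // p /UU'; apply: cf.
split=> [p /UU'|i]; first exact: cf.
by have [ef Cf] := hf i; split=> [p /UU'|]; [exact: ef|exact: IH].
Qed.

Lemma interior_open (atl : set (chart R n T)) :
  (0 < n)%N -> (forall c, atl c -> is_chart c) -> open (mfd_interior atl).
Proof.
move=> n0 hatl; rewrite openE => p [c [ac dp hp]].
have [oc _ cc _ _] := hatl c ac.
pose j0 : 'I_n := Ordinal n0.
have dn : nbhs p (chart_dom c) by apply: open_nbhs_nbhs.
have hc : crd c x ord0 j0 @[x --> within (chart_dom c) (nbhs p)] --> crd c p ord0 j0.
  move/subspace_continuousP : cc => /(_ p dp) cc.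
  exact: (cvg_comp _ _ cc (@coord_continuous _ _ _ ord0 j0 (crd c p))).
have hn : nbhs p (fun q => chart_dom c q -> 0 < crd c q ord0 j0).
  by apply: (cvgr_gt _ hc); apply: hp.
rewrite /interior /=; near=> q.
have dq : chart_dom c q by near: q.
have hq : 0 < crd c q ord0 j0 by move: dq; near: q.
exists c; split=> // i hi; suff -> : i = j0 by [].
exact: val_inj.
Unshelve. all: by end_near.
Qed.

Variables (atl : set (chart R n T)) (o : chart R n T -> T -> R).
Variables (zeta : bivector_field R n T) (G : connection R n T) (c : chart R n T).
Notation M := (mfd_interior atl).
Notation V := (M `&` chart_dom c).

Hypothesis n0 : (0 < n)%N.
Hypothesis hatl : forall c, atl c -> is_chart c.
Hypothesis ac : atl c.
Hypothesis ho : orientation atl M o.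
Hypothesis hG : torsion_free_connection atl G.
Hypothesis hzeta : sym_bivector_weight_m2 atl zeta.
Hypothesis hdeg : degeneracy_locus atl zeta = mfd_boundary atl.
Hypothesis hunit : forall p, chart_dom c p -> metric_tractor zeta G c p \in unitmx.
Hypothesis hnormal : forall p, chart_dom c p -> forall a : 'I_n,
  \matrix_(B, C) pd c a (fun q => metric_tractor zeta G c q B C) p
    + tractor_conn G c p a *m metric_tractor zeta G c p
    + metric_tractor zeta G c p *m (tractor_conn G c p a)^T = 0.

Let hc : is_chart c := hatl ac.

Lemma V_dom : V `<=` chart_dom c.
Proof. by move=> p []. Qed.

Lemma V_open : open V.
Proof. by case: hc => dc _ _ _ _; apply: openI => //; apply: interior_open. Qed.

Local Notation smoothV := (smooth_in c V).
Local Notation flatV := (flat c V).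
Let hV := V_open.
Let dV := V_dom.

Lemma smooth_onT f : smooth_on c setT f -> smoothV f.
Proof. by move=> h k; apply: is_Ck_sub (h k) => p []. Qed.

Lemma smooth_gamma a d b : smoothV (fun p => G c p a d b).
Proof. by apply: smooth_onT; case: hG => h _ _; apply: h. Qed.

Lemma smooth_zeta a b : smoothV (fun p => zeta c p a b).
Proof. by apply: smooth_onT; case: hzeta => h _ _; apply: h. Qed.

Lemma smooth_ctrace a : smoothV (fun p => ctrace G c p a).
Proof. by apply: smooth_sum => // e; apply: smooth_gamma. Qed.

Lemma smooth_riem a b e d : smoothV (fun p => riem G c p a b e d).
Proof.
rewrite /riem; apply: smooth_add => //.
  by apply: smooth_add => //; [|apply: smooth_opp => //]; apply: smooth_pd; apply: smooth_gamma.
apply: smooth_sum => // h.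
by apply: smooth_add => //; [|apply: smooth_opp => //]; apply: smooth_mul => //;
  apply: smooth_gamma.
Qed.

Lemma smooth_ric a b : smoothV (fun p => ric G c p a b).
Proof. by apply: smooth_sum => // e; apply: smooth_riem. Qed.

Lemma smooth_schouten a b : smoothV (fun p => schouten G c p a b).
Proof.
rewrite /schouten /beta; apply: smooth_mul => //; last exact: smooth_cst.
apply: smooth_add => //; first exact: smooth_ric.
apply: smooth_mul => //; first exact: smooth_cst.
apply: smooth_mul => //; last exact: smooth_cst.
by apply: smooth_add => //; [|apply: smooth_opp => //]; apply: smooth_ric.
Qed.

Lemma smooth_div_zeta a : smoothV (fun p => div_zeta zeta G c p a).
Proof.
apply: smooth_sum => // b; rewrite /nabla_zeta.
have hz := smooth_zeta; have hg := smooth_gamma; have ht := smooth_ctrace.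
apply: smooth_add => //; last first.
  apply: smooth_opp => //; apply: smooth_mul => //.
  by apply: smooth_mul => //; apply: smooth_cst.
apply: smooth_add => //; last by apply: smooth_sum => // d; apply: smooth_mul.
apply: smooth_add => //; first exact: smooth_pd.
by apply: smooth_sum => // d; apply: smooth_mul.
Qed.

Lemma smooth_divdiv_zeta : smoothV (fun p => divdiv_zeta zeta G c p).
Proof.
have hz := smooth_div_zeta; have hg := smooth_gamma; have ht := smooth_ctrace.
apply: smooth_sum => // a; apply: smooth_add => //; last first.
  apply: smooth_opp => //; apply: smooth_mul => //.
  by apply: smooth_mul => //; apply: smooth_cst.
apply: smooth_add => //; first exact: smooth_pd.
by apply: smooth_sum => // d; apply: smooth_mul.
Qed.

Lemma smooth_block (A11 : T -> 'M[R]_1) (A12 : T -> 'M[R]_(1, n))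
    (A21 : T -> 'M[R]_(n, 1)) (A22 : T -> 'M[R]_n) (i j : 'I_(1 + n)) :
  (forall a b, smoothV (fun p => A11 p a b)) -> (forall a b, smoothV (fun p => A12 p a b)) ->
  (forall a b, smoothV (fun p => A21 p a b)) -> (forall a b, smoothV (fun p => A22 p a b)) ->
  smoothV (fun p => block_mx (A11 p) (A12 p) (A21 p) (A22 p) i j).
Proof.
move=> h11 h12 h21 h22.
case: (split_ordP i) => i' ->; case: (split_ordP j) => j' ->.
- by apply: smooth_ext (h11 i' j') => // q _; rewrite block_mxEul.
- by apply: smooth_ext (h12 i' j') => // q _; rewrite block_mxEur.
- by apply: smooth_ext (h21 i' j') => // q _; rewrite block_mxEdl.
- by apply: smooth_ext (h22 i' j') => // q _; rewrite block_mxEdr.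
Qed.

Notation H := (metric_tractor zeta G c).

Definition metric_row (p : T) : 'rV[R]_n :=
  \row_a (- (2 / n.+1%:R) * div_zeta zeta G c p a / 2).

Definition metric_corner (p : T) : R :=
  (\sum_a \sum_b schouten G c p a b * zeta c p a b) / n%:R
    + divdiv_zeta zeta G c p / (n%:R * n.+1%:R).

Lemma metric_tractorE p : H p =
  @block_mx R 1 n 1 n (metric_corner p)%:M (metric_row p) (metric_row p)^T (zeta c p).
Proof. by []. Qed.

Lemma smooth_metric_row a b : smoothV (fun p => metric_row p a b).
Proof.
apply: (@smooth_ext _ _ _ _ hc _ hV dV
  (fun p => - (2 / n.+1%:R) * div_zeta zeta G c p b / 2)) => [q _|].
  by rewrite !mxE.
apply: smooth_mul => //; last exact: smooth_cst.
by apply: smooth_mul => //; [exact: smooth_cst|exact: smooth_div_zeta].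
Qed.

Lemma smooth_metric A B : smoothV (fun p => H p A B).
Proof.
apply: (@smooth_block (fun p => (metric_corner p)%:M) metric_row
  (fun p => (metric_row p)^T) (zeta c)) => a b; last exact: smooth_zeta.
- apply: (@smooth_ext _ _ _ _ hc _ hV dV metric_corner) => [q _|].
    by rewrite !ord1 mxE eqxx mulr1n.
  apply: smooth_add => //; apply: smooth_mul => //; try exact: smooth_cst.
    apply: smooth_sum => // a'; apply: smooth_sum => // b'; apply: smooth_mul => //.
      exact: smooth_schouten.
    exact: smooth_zeta.
  exact: smooth_divdiv_zeta.
- exact: smooth_metric_row.
- by apply: smooth_ext (smooth_metric_row b a) => // q _; rewrite [RHS]mxE.
Qed.

Lemma smooth_tractor_conn a A B : smoothV (fun p => tractor_conn G c p a A B).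
Proof.
have hu : smoothV (fun p => ctrace G c p a / n.+1%:R).
  by apply: smooth_mul => //; [exact: smooth_ctrace|exact: smooth_cst].
apply: (@smooth_block (fun p => (- (ctrace G c p a / n.+1%:R))%:M)
  (fun p => \row_b (- schouten G c p a b)) (fun p => delta_mx a ord0)
  (fun p => \matrix_(b, d) (G c p a d b - ctrace G c p a / n.+1%:R * (b == d)%:R))) => i j.
- apply: (@smooth_ext _ _ _ _ hc _ hV dV (fun p => - (ctrace G c p a / n.+1%:R))) => [q _|].
    by rewrite !ord1 mxE eqxx mulr1n.
  exact: smooth_opp.
- apply: (@smooth_ext _ _ _ _ hc _ hV dV (fun p => - schouten G c p a j)) => [q _|].
    by rewrite mxE.
  by apply: smooth_opp => //; apply: smooth_schouten.
- exact: smooth_cst.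
- apply: (@smooth_ext _ _ _ _ hc _ hV dV
    (fun p => G c p a j i - ctrace G c p a / n.+1%:R * (i == j)%:R)) => [q _|].
    by rewrite mxE.
  apply: smooth_add => //; first exact: smooth_gamma.
  by apply: smooth_opp => //; apply: smooth_mul => //; apply: smooth_cst.
Qed.

Lemma metric_tractor_sym p : V p -> (H p)^T = H p.
Proof.
move=> [_ dp]; rewrite metric_tractorE.
apply: etrans (@tr_block_mx R 1 n 1 n _ _ _ _) _; rewrite trmxK tr_scalar_mx.
by case: hzeta => _ h _; rewrite h.
Qed.

Lemma det_zeta_neq0 p : V p -> \det (zeta c p) != 0.
Proof.
move=> [Mp dp]; rewrite -unitfE -unitmxE; apply/negPn/negP => h.
have : degeneracy_locus atl zeta p by exists c.
by rewrite hdeg; apply.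
Qed.

Lemma det_metric_neq0 p : V p -> \det (H p) != 0.
Proof. by move=> [_ dp]; rewrite -unitfE -unitmxE; apply: hunit. Qed.

(** The value that normality forces on the partial derivative of [H]. *)
Definition metric_pd p a : 'M[R]_n.+1 :=
  - (tractor_conn G c p a *m H p + H p *m (tractor_conn G c p a)^T).

Lemma is_pd_metric p a A B : V p -> is_pd c (fun q => H q A B) p a (metric_pd p a A B).
Proof.
move=> Vp; have := @smooth_is_pd _ _ _ _ _ _ _ a (smooth_metric A B) Vp.
have : \matrix_(B, C) pd c a (fun q => H q B C) p = metric_pd p a.
  by apply/eqP; rewrite -addr_eq0 addrA; apply/eqP/hnormal/dV.
by move/matrixP/(_ A B); rewrite [in LHS]mxE => <-.
Qed.

(** The n+1 weight corrections add up to the trace of the Christoffel symbols, so the local tractor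
    frame is unimodular. *)
Lemma tr_tractor_conn p a : \tr (tractor_conn G c p a) = 0.
Proof.
rewrite (@mxtrace_block R 1 n) mxtrace_scalar mulr1n.
have -> : \tr (\matrix_(b, d) (G c p a d b - ctrace G c p a / n.+1%:R * (b == d)%:R)) =
   ctrace G c p a - n%:R * (ctrace G c p a / n.+1%:R).
  rewrite /mxtrace (eq_bigr (fun b => G c p a b b - ctrace G c p a / n.+1%:R)) => [|b _].
    by rewrite sumrB sumr_const card_ord mulr_natl.
  by rewrite mxE eqxx mulr1.
have : n.+1%:R != 0 :> R by rewrite pnatr_eq0.
by rewrite -natr1 => h; field.
Qed.

(** By Jacobi's formula the derivative is -2 det H times the trace of the connection matrix, which
    is 0. *)
Lemma flat_det_metric : flatV (fun p => \det (H p)).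
Proof.
apply: smooth_flat => // [|p a Vp]; first by apply: smooth_det => // A B; apply: smooth_metric.
have := is_pd_det hc dV Vp (fun A B => smooth_cont (smooth_metric A B) Vp)
  (fun A B => @is_pd_metric p a A B Vp).
rewrite /metric_pd mulNmx mulmxDl linearN linearD /= -mulmxA mul_mx_adj.
rewrite mul_mx_scalar linearZ /= tr_tractor_conn mulr0 add0r.
rewrite mxtrace_mulC mulmxA mul_adj_mx mul_scalar_mx linearZ /= mxtrace_tr.
by rewrite tr_tractor_conn mulr0 oppr0.
Qed.

Lemma pd_det_zeta p a : V p -> is_pd c (fun q => \det (zeta c q)) p a
  (- 2 * ((metric_row p *m \adj (zeta c p)) ord0 a
          + ctrace G c p a / n.+1%:R * \det (zeta c p))).
Proof.
move=> Vp; pose u := ctrace G c p a / n.+1%:R; rewrite -/u.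
pose g : 'M[R]_n := \matrix_(b, d) (G c p a d b - u * (b == d)%:R).
(* The lower right block of A_a H. Its first term comes from nabla_a X = W_a and brings the
   divergence row of [H] into the derivative of det zeta. *)
pose K : 'M[R]_n := delta_mx a ord0 *m metric_row p + g *m zeta c p.
have sz : (zeta c p)^T = zeta c p by case: hzeta => _ h _; apply: h => //; exact: dV.
have eK b d : (tractor_conn G c p a *m H p) (rshift 1 b) (rshift 1 d) = K b d.
  apply: etrans (congr1 (fun X : 'M[R]_(1 + n) => X (rshift 1 b) (rshift 1 d))
    (@mulmx_block R 1 n 1 n 1 n _ _ _ _ _ _ _ _)) _.
  by rewrite block_mxEdr.
have eZ b d : metric_pd p a (rshift 1 b) (rshift 1 d) = - (K b d + K d b).
  rewrite /metric_pd -{2}(metric_tractor_sym Vp) -trmx_mul [LHS]mxE [X in - X]mxE eK.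
  by rewrite [X in _ + X]mxE eK.
have := @is_pd_det R n T c hc V dV n (zeta c) (- (K + K^T)) p a Vp
  (fun b d => smooth_cont (smooth_zeta b d) Vp).
have hpd b d : is_pd c (fun q => zeta c q b d) p a ((- (K + K^T)) b d).
  rewrite [X in is_pd _ _ _ _ X]mxE [X in - X]mxE [X in _ + X]mxE -eZ.
  have := @is_pd_metric p a (rshift 1 b) (rshift 1 d) Vp.
  by apply: (is_pd_ext hc hV dV Vp) => q Vq; exact: (@block_mxEdr R 1 n 1 n).
move/(_ hpd); congr is_pd.
have trg : \tr g = u.
  have := tr_tractor_conn p a; rewrite (@mxtrace_block R 1 n) -/u -/g.
  by rewrite mxtrace_scalar mulr1n addrC => /subr0_eq.
have trK : \tr (K *m \adj (zeta c p)) = (metric_row p *m \adj (zeta c p)) ord0 a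
    + u * \det (zeta c p).
  rewrite /K mulmxDl linearD /= -!mulmxA mul_mx_adj mul_mx_scalar linearZ /= trg mulrC.
  rewrite mxtrace_mulC -[_ *m delta_mx _ _]colE /mxtrace big_ord1 [in LHS]mxE.
  by [].
have trK' : \tr (K^T *m \adj (zeta c p)) = \tr (K *m \adj (zeta c p)).
  by rewrite -mxtrace_tr trmx_mul trmxK trmx_adj sz mxtrace_mulC.
by rewrite mulNmx mulmxDl linearN linearD /= trK' trK; ring.
Qed.

(** The sign is continuous as the quotient of [f] by its absolute value, and its square is constant,
    so [flat_sqr] applies. *)
Lemma flat_sg f : smoothV f -> (forall q, V q -> f q != 0) -> flatV (fun q => Num.sg (f q)).
Proof.
move=> sf f0; apply: (flat_sqr hc dV) => [q Vq|q Vq|]; last 2 first.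
- by rewrite sgr_eq0 f0.
- apply: (flat_ext hc hV dV _ (@flat_cst _ _ _ c V 1)) => q Vq.
  by rewrite -expr2 sqr_sg f0.
have cf := smooth_cont sf Vq.
suff h : is_Ck 0 c V (fun q => Num.sg (f q)) by apply: is_Ck_cont h Vq.
apply: (is_Ck_ext hc hV dV (f := fun q => f q * `|f q|^-1)) => [r Vr|].
  by rewrite {1}[f r]numEsg mulfK // normr_eq0 f0.
split=> // r Vr; have cr := smooth_cont sf Vr.
apply: cvgM => //; apply: cvgV; first by rewrite normr_eq0 f0.
exact: cvg_norm.
Qed.

Notation Z := (fun p => \det (zeta c p)).

Lemma smooth_det_zeta : smoothV Z.
Proof. by apply: smooth_det => // a b; apply: smooth_zeta. Qed.

Lemma orient_sqr p : V p -> o c p * o c p = 1.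
Proof. by move=> Vp; case: (ho ac Vp) => -[] -> _ _; rewrite ?mulr1 ?mulrNN ?mulr1. Qed.

Lemma orient_norm p : V p -> `|o c p| = 1.
Proof. by move=> Vp; case: (ho ac Vp) => -[] -> _ _; rewrite ?normrN normr1. Qed.

Lemma sigmaE p : V p -> sigma o zeta c p = Num.sg (Z p) * Z p.
Proof.
move=> Vp; rewrite /sigma /volume_zeta normrM orient_norm // mul1r normfV.
rewrite exprVn invrK ger0_norm ?sqrtr_ge0 // sqr_sqrtr ?normr_ge0 //.
by rewrite normrEsg.
Qed.

Lemma sigma_gt0 p : V p -> 0 < sigma o zeta c p.
Proof. by move=> Vp; rewrite sigmaE // -normrEsg normr_gt0 det_zeta_neq0. Qed.

Lemma flat_sg_zeta : flatV (fun p => Num.sg (Z p)).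
Proof. exact: flat_sg smooth_det_zeta det_zeta_neq0. Qed.

Lemma smooth_sigma : smoothV (sigma o zeta c).
Proof.
apply: (smooth_ext hc hV dV (f := fun p => Num.sg (Z p) * Z p)) => [p Vp|].
  by rewrite sigmaE.
apply: (smooth_mul hc hV dV); last exact: smooth_det_zeta.
exact: (flat_smooth hc hV dV flat_sg_zeta).
Qed.

Lemma pd_sigma p a : V p -> pd c a (sigma o zeta c) p =
  - 2 * (Num.sg (Z p) * (metric_row p *m \adj (zeta c p)) ord0 a
          + ctrace G c p a / n.+1%:R * sigma o zeta c p).
Proof.
move=> Vp; apply: (is_pd_pd hc dV Vp).
have [_ ds] := flat_sg_zeta Vp.
have := is_pd_mul hc dV Vp (smooth_cont smooth_det_zeta Vp) (ds a) (@pd_det_zeta p a Vp).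
rewrite mul0r add0r => hpd.
have -> : - 2 * (Num.sg (Z p) * (metric_row p *m \adj (zeta c p)) ord0 a
          + ctrace G c p a / n.+1%:R * sigma o zeta c p) =
   Num.sg (Z p) * (- 2 * ((metric_row p *m \adj (zeta c p)) ord0 a
          + ctrace G c p a / n.+1%:R * \det (zeta c p))).
  by rewrite sigmaE //; ring.
by apply: (is_pd_ext hc hV dV Vp _ hpd) => q Vq; rewrite sigmaE.
Qed.

(** The trace term of [pd_sigma] is cancelled by the weight 2 of sigma in the Thomas operator; what
    is left is proportional to the first row of the adjugate of [H]. *)
Lemma scale_tractorE p : V p -> scale_tractor o zeta G c p =
  (2 * Num.sg (Z p)) *:
    @row_mx R 1 1 n (Z p)%:M (- (metric_row p *m \adj (zeta c p))).
Proof.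
move=> Vp; apply/rowP => A; case: (unliftP ord0 A) => [a|] ->.
  rewrite !mxE /thomas liftK /nabla_cotractor big_ord0 subr0.
  have -> : (fun q => sigma o zeta c q) = sigma o zeta c by [].
  rewrite pd_sigma // (_ : lift ord0 a = rshift 1 a); last exact: val_inj.
  case: splitP => [[[|//] ?] //= |b eb]; rewrite [in RHS]mxE.
  have -> : b = a by apply: val_inj; move: eb => /= [].
  by move: (_ ord0 a) => X; ring.
rewrite !mxE /thomas unlift_none sigmaE //.
case: splitP => [b eb|//]; rewrite mxE ord1 eqxx mulr1n.
by ring.
Qed.

(* Half of f: see f_funE. *)
Definition lam p : R := 2 * (Num.sg (Z p) * \det (H p)).

Lemma metric_scale_tractor p A : V p ->
  \sum_B H p A B * scale_tractor o zeta G c p ord0 B = lam p * (A == ord0)%:R.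
Proof.
move=> Vp; have uZ : zeta c p \in unitmx by rewrite unitmxE unitfE det_zeta_neq0.
have e : scale_tractor o zeta G c p *m H p =
    lam p *: (delta_mx 0 0 : 'rV[R]_n.+1).
  rewrite scale_tractorE // -scalemxAl metric_tractorE.
  apply: etrans (congr1 (fun X : 'rV[R]_(1 + n) => (2 * Num.sg (Z p)) *: X)
    (adj_block_solve (metric_corner p) (metric_row p) uZ)) _.
  rewrite -metric_tractorE /lam mulrA -[RHS]scalerA; congr (_ *: _).
  apply/rowP => B; case: (@split_ordP 1 n B) => b ->.
    apply: etrans (@row_mxEl R 1 1 n _ _ _ _) _.
    by rewrite !mxE ord1 eqxx mulr1n -val_eqE /= mulr1.
  apply: etrans (@row_mxEr R 1 1 n _ _ _ _) _.
  by rewrite !mxE -val_eqE /= mulr0.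
have /rowP/(_ A) := e; rewrite [in LHS]mxE [in RHS]mxE [in RHS]mxE eqxx /= => <-.
apply: eq_bigr => B _; rewrite mulrC; congr (_ * _).
by rewrite -[in LHS](metric_tractor_sym Vp) [LHS]mxE.
Qed.

(** I^2 is [lam] times the pairing of X with I, and that pairing is 2 sigma since sigma has weight
    2. *)
Lemma f_funE p : V p -> f_fun o zeta G c p = 2 * lam p.
Proof.
move=> Vp; rewrite /f_fun /scale_norm2.
have -> : \sum_A \sum_B H p A B * scale_tractor o zeta G c p ord0 A *
    scale_tractor o zeta G c p ord0 B = lam p * scale_tractor o zeta G c p ord0 ord0.
  rewrite (eq_bigr (fun A => lam p * (A == ord0)%:R * scale_tractor o zeta G c p ord0 A)).
    rewrite (bigD1 ord0) //= ?eqxx mulr1 big1 ?addr0 // => A hA.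
    by rewrite (negbTE hA) mulr0 mul0r.
  move=> A _; rewrite -metric_scale_tractor // mulr_suml.
  by apply: eq_bigr => B _; rewrite mulrAC.
rewrite [scale_tractor _ _ _ _ _ _ _]mxE /thomas unlift_none.
by have := sigma_gt0 Vp; rewrite lt0r => /andP[s0 _]; field.
Qed.

Lemma flat_lam : flatV lam.
Proof.
apply: (flat_mul hc dV); first exact: flat_cst.
exact: (flat_mul hc dV flat_sg_zeta flat_det_metric).
Qed.

Lemma lam_neq0 p : V p -> lam p != 0.
Proof.
move=> Vp; rewrite !mulf_neq0 ?pnatr_eq0 ?sgr_eq0 ?det_zeta_neq0 //.
exact: det_metric_neq0.
Qed.

(** f is a positive multiple of s det H. This matches the signs in [codiff] with the one in
    [codiff_field]. *)
Lemma sg_f_fun p : V p ->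
  Num.sg (Z p) * Num.sg (f_fun o zeta G c p) = Num.sg (\det (H p)).
Proof.
move=> Vp; rewrite f_funE // /lam !sgrM !(gtr0_sg (ltr0n R 2)) !mul1r sgr_id mulrA.
by rewrite -expr2 sqr_sg det_zeta_neq0 // mul1r.
Qed.

(** The coefficient of the tractor volume form with respect to the Levi-Civita symbol, as
    [tractor_volumeE] shows. *)
Definition vol p : R := o c p / Num.sqrt `|\det (H p)|.

Lemma sqrt_metric_gt0 p : V p -> 0 < Num.sqrt `|\det (H p)|.
Proof. by move=> Vp; rewrite sqrtr_gt0 normr_gt0 det_metric_neq0. Qed.

Lemma vol_sqr p : V p -> vol p * vol p = (Num.sg (\det (H p)) * \det (H p))^-1.
Proof.
move=> Vp; rewrite /vol mulrACA orient_sqr // mul1r -invfM -expr2 sqr_sqrtr //.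
by rewrite normrEsg.
Qed.

Lemma vol_sqr_det p : V p -> vol p ^+ 2 * \det (H p) = Num.sg (\det (H p)).
Proof.
move=> Vp; have d0 := det_metric_neq0 Vp; have s0 : Num.sg (\det (H p)) != 0 by rewrite sgr_eq0.
rewrite expr2 vol_sqr // invfM mulfVK //.
by case: sgrP d0 => // _ _; rewrite ?invrN ?invr1.
Qed.

Lemma smooth_det_metric : smoothV (fun p => \det (H p)).
Proof. by apply: smooth_det => // A B; apply: smooth_metric. Qed.

Lemma flat_vol : flatV vol.
Proof.
apply: (flat_sqr hc dV) => [p Vp|p Vp|].
- have [_ co _] := ho ac Vp.
  apply: cvgM; first exact: co.
  apply: cvgV; first by rewrite gt_eqF ?sqrt_metric_gt0.
  have h1 : `|\det (H q)| @[q --> p] --> `|\det (H p)|.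
    by apply: cvg_norm; exact: smooth_cont smooth_det_metric Vp.
  exact: (cvg_comp _ _ h1 (@sqrt_continuous R _)).
- apply: mulf_neq0; first by rewrite -normr_eq0 orient_norm ?oner_neq0.
  by rewrite invr_neq0 // gt_eqF // sqrt_metric_gt0.
apply: (flat_ext hc hV dV) => [p Vp|]; first by rewrite vol_sqr.
apply: (flat_inv hc hV dV) => [p Vp|].
  by rewrite mulf_neq0 ?sgr_eq0 ?det_metric_neq0.
apply: (flat_mul hc dV); last exact: flat_det_metric.
exact: flat_sg smooth_det_metric det_metric_neq0.
Qed.

(** Orthonormality gives sigma (det w)^2 = 1, and the orientation condition selects the root. *)
Lemma det_coframe p w : V p -> pos_orthonormal o zeta c p w ->
  \det w = o c p / Num.sqrt (sigma o zeta c p).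
Proof.
move=> Vp [[e he hw] ow].
have sg0 := sigma_gt0 Vp; have s0 : 0 < Num.sqrt (sigma o zeta c p) by rewrite sqrtr_gt0.
pose x := Num.sqrt (sigma o zeta c p) * \det w.
have x1 : x * x = 1.
  have : `|\det (w *m zeta c p *m w^T)| = 1.
    rewrite hw det_diag normr_prod big1 // => i _.
    by case: (he i) => ->; rewrite ?normrN normr1.
  rewrite !det_mulmx det_tr !normrM [`|\det (zeta c p)|]normrEsg -sigmaE //.
  rewrite /x mulrACA -expr2 sqr_sqrtr ?ltW // => h.
  have e2 : `|\det w| * `|\det w| = \det w * \det w.
    by rewrite -normrM ger0_norm // -expr2 sqr_ge0.
  by rewrite -[RHS]h -e2; ring.
have ox : 0 < o c p * x by rewrite /x mulrCA mulr_gt0.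
suff <- : x = o c p by rewrite /x mulrAC divff ?mul1r ?gt_eqF.
have : (x - o c p) * (x + o c p) = 0.
  by rewrite -subr_sqr !expr2 x1 orient_sqr // subrr.
move/eqP; rewrite mulf_eq0 => /orP[/eqP/subr0_eq //|]; rewrite addr_eq0 => /eqP xo.
by move: ox; rewrite xo mulrN orient_sqr // oppr_gt0 ltr10.
Qed.

(** The X-component of J^0 is sigma^(1/2) / |det H|^(1/2) and det w is o sigma^(-1/2): sigma cancels
    and no trace of the coframe is left. *)
Lemma tractor_volumeE p : V p ->
  tractor_volume o zeta G c p = (fun A => vol p * levi R A).
Proof.
move=> Vp.
have wedgeE w : pos_orthonormal o zeta c p w ->
    wedge_list (J0 o zeta G c p :: [seq Jform (row i w) | i <- enum 'I_n]) =
    (fun A => vol p * levi R A).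
  move=> hw; apply/funext => A.
  rewrite wedge_list_levi; last by rewrite /= size_map size_enum_ord.
  apply: (congr1 (fun x => x * levi R A)).
  pose J : 'rV[R]_(1 + n) := J0 o zeta G c p.
  (* The forms J^1, ..., J^n have no component along Y, so the matrix is block triangular. *)
  transitivity (\det (@block_mx R 1 n 1 n (lsubmx J) (rsubmx J) 0 w)).
    congr (\det _); apply/matrixP => i j; rewrite mxE.
    case: (unliftP ord0 i) => [i'|] -> /=.
      rewrite add0n (nth_map i') ?size_enum_ord // nth_ord_enum.
      rewrite (_ : lift ord0 i' = rshift 1 i'); last exact: val_inj.
      apply: esym; case: (@split_ordP 1 n j) => j' ->.
        apply: etrans (@block_mxEdl R 1 n 1 n _ _ _ _ _ _) _.
        by apply: esym; apply: etrans (@row_mxEl R 1 1 n _ _ _ _) _; rewrite !mxE.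
      apply: etrans (@block_mxEdr R 1 n 1 n _ _ _ _ _ _) _.
      by apply: esym; apply: etrans (@row_mxEr R 1 1 n _ _ _ _) _; rewrite mxE.
    have e0 : ord0 = lshift n ord0 :> 'I_(1 + n) by exact: val_inj.
    pose Bk (i : 'I_(1 + n)) := @block_mx R 1 n 1 n (lsubmx J) (rsubmx J) 0 w i.
    apply: esym; case: (@split_ordP 1 n j) => j' ->.
      apply: etrans (congr1 (fun i => Bk i (lshift n j')) e0) _.
      apply: etrans (@block_mxEul R 1 n 1 n _ _ _ _ _ _) _.
      by rewrite mxE; congr (fun_of_matrix J _ _); apply: val_inj.
    apply: etrans (congr1 (fun i => Bk i (rshift 1 j')) e0) _.
    apply: etrans (@block_mxEur R 1 n 1 n _ _ _ _ _ _) _.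
    by rewrite mxE; congr (fun_of_matrix J _ _); apply: val_inj.
  rewrite det_ublock det_mx11 (det_coframe Vp hw) mxE.
  have -> : J 0 (lshift n 0) = (Num.sqrt (sigma o zeta c p))^-1 /
      Num.sqrt `|f_fun o zeta G c p| * (2 * sigma o zeta c p).
    rewrite (_ : lshift n 0 = ord0); last exact: val_inj.
    by rewrite /J /J0 !mxE /thomas unlift_none.
  have -> : Num.sqrt `|f_fun o zeta G c p| = 2 * Num.sqrt `|\det (H p)|.
    rewrite f_funE // /lam mulrA !normrM (ger0_norm (ler0n R 2)).
    rewrite normr_sg det_zeta_neq0 //= mulr1 mulrA.
    have -> : 2 * 2 = 2 ^+ 2 :> R by rewrite expr2.
    by rewrite sqrtrM ?sqr_ge0 // sqrtr_sqr ger0_norm.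
  have sg0 := sigma_gt0 Vp; have s0 : 0 < Num.sqrt (sigma o zeta c p) by rewrite sqrtr_gt0.
  have h0 := sqrt_metric_gt0 Vp.
  rewrite /vol; set r := Num.sqrt (sigma o zeta c p) in s0 *.
  have -> : sigma o zeta c p = r ^+ 2 by rewrite sqr_sqrtr // ltW.
  move: s0 h0.
  move: (r) (Num.sqrt _) => s h s0 h0.
  by field; rewrite !gt_eqF.
(* An actual coframe is needed to keep [xget] from returning its default 0. *)
have [|||w ow] := @orthonormal_coframe R n (zeta c p) (o c p) n0.
- by case: hzeta => _ h _; apply: h => //; exact: dV.
- by rewrite unitmxE unitfE det_zeta_neq0.
- by rewrite -normr_eq0 orient_norm ?oner_neq0.
rewrite /tractor_volume; apply: xget_unique.
  by exists w => //; rewrite wedgeE.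
by move=> Om [w' hw' ->]; exact: wedgeE.
Qed.

Lemma scale_tractor_thomas0 p B : scale_tractor o zeta G c p ord0 B =
  thomas0 c G 2 (sigma o zeta c) p B.
Proof. by rewrite mxE. Qed.

Lemma codiffE k w (F : tractor_field R n T) : smooth_field c V (F G c) ->
  forall p A, V p -> codiff o zeta k w F G c p A = codiff_field c G H vol k w (F G c) p A.
Proof.
move=> sF p A Vp; rewrite /codiff /codiff_field.
rewrite -[_ * _ * Num.sg (f_fun _ _ _ _ _)]mulrA sg_f_fun //.
congr (_ * _); rewrite /tractor_star /star_field tractor_volumeE // star_starE.
apply: eq_star_form => B _; symmetry.
apply: (@ext_field_eq R n T c hc V hV dV G _ _ _ _ _ _ p Vp) => [|q Vq C].
  apply: (@smooth_star R n T c hc V hV dV H vol _ _ _ _ sF); [exact: smooth_metric|exact: flat_vol].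
by rewrite tractor_volumeE // star_starE.
Qed.

Lemma y_op_laplace k w (F : tractor_field R n T) : form_field c V k (F G c) ->
  forall p A, V p -> op_act (y_op o zeta) k w F G c p A =
  (2 * lam p)^-1 * laplace_field c G H vol k w (F G c) p A.
Proof.
move=> hF p A Vp; rewrite /= f_funE //; congr (_ * (_ + _)).
  symmetry; apply: (@ext_field_eq R n T c hc V hV dV G _ _ _ _ _ _ p Vp) => [|q Vq B].
    apply: (@form_field_codiff R n T c hc V hV dV G _ _ H vol _ _ _ _ _ _ hF.2).2.
    - exact: smooth_ctrace.
    - exact: smooth_tractor_conn.
    - exact: smooth_metric.
    - exact: flat_vol.
    - exact: vol_sqr_det.
  by rewrite codiffE //; exact: hF.2.
apply: codiffE => //; apply: (@form_field_ext R n T c hc V hV dV G _ _ _ _ _ hF.2).2.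
  exact: smooth_ctrace.
exact: smooth_tractor_conn.
Qed.

Lemma tractor_form_field pr k w F : pr G -> tractor_form atl pr k w F ->
  form_field c V k (F G c).
Proof.
by move=> prG [h1 h2 _ _]; split=> [p Vp|A]; [exact: h1|exact: h2].
Qed.

Lemma comm_x_y k w (F : tractor_field R n T) : form_field c V k (F G c) ->
  forall p A, V p ->
  op_act (op_comm (x_op o zeta) (y_op o zeta)) k w F G c p A = op_act (h_op R n T) k w F G c p A.
Proof.
move=> hF p A Vp.
have hxF : form_field c V k (op_act (x_op o zeta) k w F G c).
  by apply: (form_field_mul hc hV dV) => //; exact: smooth_sigma.
rewrite [LHS](_ : _ = sigma o zeta c p * op_act (y_op o zeta) k w F G c p A -
   op_act (y_op o zeta) k (w + 2) (op_act (x_op o zeta) k w F) G c p A) //.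
rewrite !y_op_laplace //= [w + 2]addrC.
rewrite (@laplace_field_mul_scale R n T c hc V hV dV G _ _ H vol lam) //.
(* Dividing lam (2w + n + 1) by f = 2 lam leaves the eigenvalue w + (n+1)/2. *)
- have := lam_neq0 Vp; move: (lam p) (laplace_field _ _ _ _ _ _ _ _ _) => l X l0.
  by field.
- exact: smooth_ctrace.
- exact: smooth_tractor_conn.
- exact: smooth_metric.
- exact: metric_tractor_sym.
- exact: det_metric_neq0.
- exact: flat_vol.
- exact: vol_sqr_det.
- exact: flat_lam.
- exact: smooth_sigma.
- by move=> q Vq a; rewrite -metric_scale_tractor //; apply: eq_bigr => b _;
    rewrite scale_tractor_thomas0.
Qed.

(** Only homogeneity matters: on a fixed weight [h] is a constant, which passes through the
    Laplacian, and [y] lowers the weight by 2. *)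
Lemma comm_h_y k w (F : tractor_field R n T) : form_field c V k (F G c) ->
  forall p A, V p ->
  op_act (op_comm (h_op R n T) (y_op o zeta)) k w F G c p A =
  op_act (op_scale (- 2) (y_op o zeta)) k w F G c p A.
Proof.
move=> hF p A Vp; pose a := w + n.+1%:R / 2.
have haF : form_field c V k (fun p A => a * F G c p A).
  by apply: (form_field_mul hc hV dV) => //; exact: smooth_cst.
rewrite [LHS](_ : _ = (w + - 2 + n.+1%:R / 2) * op_act (y_op o zeta) k w F G c p A -
   op_act (y_op o zeta) k (w + 0) (op_act (h_op R n T) k w F) G c p A) //.
rewrite addr0 [RHS](_ : _ = - 2 * op_act (y_op o zeta) k w F G c p A) //.
rewrite !y_op_laplace //= -/a.
rewrite (@laplace_field_scale R n T c hc V hV dV G _ _ H vol) //.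
- by rewrite /a; ring.
- exact: smooth_ctrace.
- exact: smooth_tractor_conn.
- exact: smooth_metric.
- exact: flat_vol.
- exact: vol_sqr_det.
Qed.

End InteriorGeometry.

Theorem corollary4p11 (R : realType) (n : nat) (hn : (2 <= n)%N)
    (T : topologicalType) (atl : set (chart R n T))
    (hM : smooth_manifold atl) (hconn : connected [set: T])
    (o : chart R n T -> T -> R) (ho : orientation atl (mfd_interior atl) o)
    (pr : set (connection R n T)) (hpr : projective_structure atl pr)
    (zeta : bivector_field R n T)
    (hzeta : sym_bivector_weight_m2 atl zeta)
    (hmet : metrisability_eq atl pr zeta)
    (hdeg : degeneracy_locus atl zeta = mfd_boundary atl)
    (hnondeg : tractor_nondegenerate atl pr zeta)
    (hnormal : normal_solution atl pr zeta) :
  sl2_triple atl pr (x_op o zeta) (y_op o zeta) (h_op R n T).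
Proof.
have n0 : (0 < n)%N by apply: ltnW.
have hatl : forall c, atl c -> is_chart c by case: hM.
have htf G : pr G -> torsion_free_connection atl G.
  by case: hpr => G0 _ -> [].
split; split=> /=; try by ring.
- move=> k w F hF G prG c ac p Vp A.
  exact: (comm_x_y n0 hatl ac ho (htf _ prG) hzeta hdeg (hnondeg _ prG c ac)
    (hnormal _ prG c ac) w (tractor_form_field ac prG hF) A Vp).
(* The relation [h, x] = 2x is arithmetic of weights alone. *)
- by move=> k w F hF G prG c ac p Vp A; rewrite /=; ring.
- move=> k w F hF G prG c ac p Vp A.
  exact: (comm_h_y n0 hatl ac ho (htf _ prG) hzeta hdeg (hnondeg _ prG c ac)
    (hnormal _ prG c ac) w (tractor_form_field ac prG hF) A Vp).
Qed.
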